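(* Assume $\nu\in\mathbb{C}$ with $2\nu\notin\mathbb{Z}$. Then the map $\Phi^{\mathrm{top}}\colon \mathrm{Rep}_{\bar\nu}(\mathbb{P}^1,D)\to \mathrm{Rep}_{\boldsymbol\nu}(C,T)$ is a branched covering of degree $2$ (in particular it is surjective). The branch locus consists of the diagonal representations, which form the $2$-dimensional singular set of $\mathrm{Rep}_{\boldsymbol\nu}(C,T)$. The Galois involution $\Psi^{\mathrm{top}}\colon \mathrm{Rep}_{\bar\nu}(\mathbb{P}^1,D)\to \mathrm{Rep}_{\bar\nu}(\mathbb{P}^1,D)$ of the covering fixes the ramification locus, which consists of dihedral representations. In particular there is an isomorphism $\mathrm{Rep}_{\boldsymbol\nu}(C,T)\stackrel{\sim}{\longrightarrow}\mathrm{Rep}_{\bar\nu}(\mathbb{P}^1,D)/\Psi^{\mathrm{top}}$.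
   Context: Let $C$ be the elliptic curve $y^2=x(x-1)(x-\lambda)$, $\lambda\in\mathbb{C}\setminus\{0,1\}$, with elliptic quotient $\pi\colon C\to\mathbb{P}^1$, $(x,y)\mapsto x$; let $t\in\mathbb{P}^1\setminus\{0,1,\lambda,\infty\}$, $D=0+1+\lambda+\infty+t$, $T=\pi^{-1}(t)=\mathbf{t}_1+\mathbf{t}_2$. Define $\mathrm{Rep}_{\bar\nu}(\mathbb{P}^1,D)$ as the set of $(M_0,M_1,M_t,M_\lambda,M_\infty)\in \mathrm{SL}_2(\mathbb{C})^5$ with $M_0M_1M_tM_\lambda M_\infty=I$, $\mathrm{tr}(M_i)=0$ for $i\ne t$, and $\mathrm{tr}(M_t)=2\cos(2\pi\nu)$, modulo simultaneous conjugation by $\mathrm{SL}_2(\mathbb{C})$. All such representations are irreducible when $2\nu\notin\mathbb{Z}$, and this is a smooth irreducible affine variety of dimension $4$. Define $\mathrm{Rep}_{\boldsymbol\nu}(C,T)$ as the GIT quotient by simultaneous $\mathrm{SL}_2(\mathbb{C})$-conjugation of the set of $(A,B,C_1,C_2)\in\mathrm{SL}_2(\mathbb{C})^4$ with $AB=C_1BAC_2$ and $\mathrm{tr}(C_1)=\mathrm{tr}(C_2)=2\cos(2\pi\nu)$ (representations of the fundamental group of the torus with two punctures). It is an irreducible affine variety of dimension $4$; triangular representations are identified with their diagonal part. The map $\Phi^{\mathrm{top}}$ is defined as follows: pull back a representation via $\pi$ to a representation of $\pi_1(C\setminus(\mathbf{W}\cup T))$, where $\mathbf{W}$ is the set of the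 four ramification points of $\pi$ (its local monodromy at each point of $\mathbf{W}$ is $-I$); twist by the central representation $\pi_1(C\setminus \mathbf{W})\to\{\pm I\}$ having local monodromy $-I$ at each point of $\mathbf{W}$; regard the result as a representation of $\pi_1(C\setminus T)$ and take its class in $\mathrm{Rep}_{\boldsymbol\nu}(C,T)$. Explicitly it is given by $A=M_1M_tM_\lambda$, $B=M_\lambda M_\infty$, $C_1=M_t$, $C_2=M_\infty M_tM_\infty^{-1}$. A representation is diagonal if it is conjugate to one with all matrices diagonal; it is dihedral if it is conjugate to one in which every matrix is either diagonal or antidiagonal (here: $M_t$ diagonal and $M_0,M_1,M_\lambda,M_\infty$ antidiagonal). *)

(* Defs.v *)
From HB Require Import structures.
From mathcomp Require Import all_boot all_order all_algebra generic_quotient.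
From mathcomp Require Import complex mpoly.
From mathcomp Require Import boolp reals sequences trigo.
From mathcomp Require Import ring.

Set Implicit Arguments.
Unset Strict Implicit.
Unset Printing Implicit Defensive.

Import GRing.Theory.
Local Open Scope ring_scope.
Local Open Scope quotient_scope.

(* An affine variety over F is handled through its closed points together with
   its algebra of regular functions. *)
Record variety (F : fieldType) := Variety {
  pt :> choiceType;
  regular : (pt -> F) -> Prop
}.
Arguments regular {F} _ _.

Section Geometry.
Variable F : fieldType.
Implicit Types X Y : variety F.

Definition morphism X Y (phi : X -> Y) : Prop :=
  forall f : Y -> F, regular Y f -> regular X (f \o phi).

Definition isomorphism X Y (phi : X -> Y) : Prop :=
  morphism phi /\ exists2 psi : Y -> X, morphism psi & cancel phi psi /\ cancel psi phi.

Section Quotient.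
Variables (X : variety F) (E : X -> X -> Prop).
Hypotheses (Erefl : forall x, E x x) (Esym : forall x y, E x y -> E y x)
  (Etrans : forall x y z, E x y -> E y z -> E x z).

Definition quot_rel : rel X := fun x y => `[< E x y >].

Fact quot_rel_refl : reflexive quot_rel.
Proof. by move=> x; apply/asboolP; exact: Erefl. Qed.

Fact quot_rel_sym : ssrbool.symmetric quot_rel.
Proof. by move=> x y; apply/asboolP/asboolP; exact: Esym. Qed.

Fact quot_rel_trans : transitive quot_rel.
Proof.
by move=> y x z /asboolP xy /asboolP yz; apply/asboolP; exact: Etrans xy yz.
Qed.

Definition quot_equiv := EquivRel quot_rel quot_rel_refl quot_rel_sym quot_rel_trans.

Definition quot_type : choiceType := {eq_quot quot_equiv}.

Definition quot_proj (x : X) : quot_type := \pi_{eq_quot quot_equiv} x.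

(* A regular function on X / E is a function whose pullback to X is regular,
   so the coordinate ring of X / E is the ring of E-invariant regular functions. *)
Definition quot : variety F :=
  @Variety F quot_type (fun f => regular X (f \o quot_proj)).

Lemma quot_projP x y : quot_proj x = quot_proj y <-> E x y.
Proof.
split=> [/eqquotP/asboolP //|Exy].
by apply/eqquotP/asboolP.
Qed.

Lemma quot_repr (q : quot_type) : quot_proj (repr q) = q.
Proof. exact: reprK. Qed.
End Quotient.

(* n functions are algebraically independent on a subset S of X when they are
   so after restriction to S. The dimension of a nonempty S (equivalently, of
   its Zariski closure) is the maximal number of regular functions that are
   algebraically independent on S. *)
Definition alg_indep_on X (S : X -> Prop) n (f : 'I_n -> X -> F) : Prop :=
  forall p : {mpoly F[n]},
    (forall x, S x -> p.@[fun i => f i x] = 0) -> p = 0.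

Definition dim_eq X (S : X -> Prop) (n : nat) : Prop :=
  (exists2 f : 'I_n -> X -> F,
     forall i, regular X (f i) & alg_indep_on S f) /\
  (forall m (f : 'I_m -> X -> F),
     (forall i, regular X (f i)) -> alg_indep_on S f -> (m <= n)%N).

(* Zariski tangent vectors at x, as point derivations of the coordinate ring.
   Only the values of d on regular functions are meaningful. *)
Definition tangent X (x : X) (d : (X -> F) -> F) : Prop :=
  (forall (a : F) f g, regular X f -> regular X g ->
     d (fun z => a * f z + g z) = a * d f + d g) /\
  (forall f g, regular X f -> regular X g ->
     d (fun z => f z * g z) = f x * d g + g x * d f).

Definition tangent_dim_eq X (x : X) (n : nat) : Prop :=
  exists D : 'I_n -> (X -> F) -> F,
  [/\ forall i, tangent x (D i),
      forall c : 'I_n -> F,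
        (forall f, regular X f -> \sum_i c i * D i f = 0) -> forall i, c i = 0
    & forall d, tangent x d ->
        exists c : 'I_n -> F, forall f, regular X f -> d f = \sum_i c i * D i f].

(* For irreducible X, whose local dimension is dim X at every point. *)
Definition singular X (x : X) : Prop :=
  ~ exists2 n, dim_eq (fun _ : X => True) n & tangent_dim_eq x n.

Definition finite_morphism X Y (phi : X -> Y) : Prop :=
  morphism phi /\
  exists n (e : 'I_n -> X -> F), (forall i, regular X (e i)) /\
    forall f, regular X f ->
      exists2 a : 'I_n -> Y -> F, forall i, regular Y (a i) &
        forall x, f x = \sum_i a i (phi x) * e i x.

(* phi is finite etale of degree d over the principal open set g <> 0: there
   the coordinate ring of X is a free module of rank d over that of Y, and
   every fiber is reduced, i.e. has exactly d points. *)
Definition finite_etale_over X Y (d : nat) (phi : X -> Y) (g : Y -> F) : Prop :=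
  (exists e : 'I_d -> X -> F,
     [/\ forall i, regular X (e i),
         forall f, regular X f -> exists k (a : 'I_d -> Y -> F),
           (forall i, regular Y (a i)) /\
           (forall x, g (phi x) != 0 ->
              g (phi x) ^+ k * f x = \sum_i a i (phi x) * e i x)
       & forall a : 'I_d -> Y -> F, (forall i, regular Y (a i)) ->
           (forall x, g (phi x) != 0 -> \sum_i a i (phi x) * e i x = 0) ->
           forall i y, g y != 0 -> a i y = 0]) /\
  (forall y, g y != 0 ->
     exists2 s : d.-tuple X, uniq s & forall x, (phi x == y) = (x \in s)).

Definition etale_at X Y (d : nat) (phi : X -> Y) (y : Y) : Prop :=
  exists g, [/\ regular Y g, g y != 0 & finite_etale_over d phi g].

(* The last clause says that the etale locus is Zariski dense in Y. *)
Definition branched_covering X Y (d : nat) (phi : X -> Y) : Prop :=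
  [/\ finite_morphism phi,
      forall y, exists x, phi x = y
    & forall h, regular Y h -> (exists y, h y != 0) ->
        exists2 y, h y != 0 & etale_at d phi y].

Definition branch_point X Y (d : nat) (phi : X -> Y) (y : Y) : Prop :=
  ~ etale_at d phi y.

(* phi is ramified at x when its differential kills a nonzero tangent vector,
   i.e. when the relative differentials of phi do not vanish at x. *)
Definition ramification_point X Y (phi : X -> Y) (x : X) : Prop :=
  exists d, [/\ tangent x d, exists2 f, regular X f & d f != 0
              & forall a, regular Y a -> d (a \o phi) = 0].

(* The generator psi of the Galois group of a degree 2 covering phi. *)
Definition galois_involution X Y (phi : X -> Y) (psi : X -> X) : Prop :=
  [/\ morphism psi, involutive psi, exists x, psi x != x,
      forall x, phi (psi x) = phi x
    & forall x x', phi x = phi x' -> x' = x \/ x' = psi x].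

Section InvolutionQuotient.
Variables (X : variety F) (psi : X -> X) (psiK : involutive psi).

Definition orbit2 (x y : X) : Prop := y = x \/ y = psi x.

Fact orbit2_refl x : orbit2 x x. Proof. by left. Qed.

Fact orbit2_sym x y : orbit2 x y -> orbit2 y x.
Proof. by case=> ->; [left | right; rewrite psiK]. Qed.

Fact orbit2_trans x y z : orbit2 x y -> orbit2 y z -> orbit2 x z.
Proof.
by case=> -> [] ->; [left | right | right | left; rewrite psiK].
Qed.

Definition quot_invol : variety F := quot orbit2_refl orbit2_sym orbit2_trans.

Definition quot_invol_proj : X -> quot_invol :=
  quot_proj orbit2_refl orbit2_sym orbit2_trans.
End InvolutionQuotient.

(* Tuples of 2 x 2 matrices *)

Definition coord n (M : n.-tuple 'M[F]_2) (k : 'I_#|{: 'I_n * 'I_2 * 'I_2}|) : F :=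
  let: (a, i, j) := enum_val k in tnth M a i j.

(* The Zariski closed subset S of the affine space of n-tuples of matrices. *)
Definition closed_subvariety n (S : pred (n.-tuple 'M[F]_2)) : variety F :=
  @Variety F {M : n.-tuple 'M[F]_2 | S M}
    (fun f => exists p : {mpoly F[#|{: 'I_n * 'I_2 * 'I_2}|]},
       forall M, f M = p.@[coord (val M)]).

Definition conj_tuple n (g : 'M[F]_2) (M : n.-tuple 'M[F]_2) : n.-tuple 'M[F]_2 :=
  [tuple of map (fun A => g * A * g^-1) M].

Section Conjugation.
Variables (n : nat) (S : pred (n.-tuple 'M[F]_2)).
Local Notation X := (closed_subvariety S).

Definition conjugate (M N : X) : Prop :=
  exists2 g : 'M[F]_2, \det g = 1 & val N = conj_tuple g (val M).

Fact conjugate_refl M : conjugate M M.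
Proof.
exists 1; first exact: det1.
apply: eq_from_tnth => i; rewrite tnth_map invr1 mulr1 mul1r //.
Qed.

Fact conjugate_sym M N : conjugate M N -> conjugate N M.
Proof.
move=> [g dg eN]; have ug : g \is a GRing.unit by rewrite unitmxE dg unitr1.
exists g^-1; first by rewrite det_inv dg invr1.
apply: eq_from_tnth => i; rewrite eN !tnth_map invrK.
by rewrite !mulrA mulVr // mul1r -mulrA mulVr // mulr1.
Qed.

Fact conjugate_trans M N P : conjugate M N -> conjugate N P -> conjugate M P.
Proof.
move=> [g dg eN] [h dh eP].
have ug : g \is a GRing.unit by rewrite unitmxE dg unitr1.
have uh : h \is a GRing.unit by rewrite unitmxE dh unitr1.
exists (h * g); first by rewrite det_mulmx dg dh mulr1.
apply: eq_from_tnth => i; rewrite eP eN !tnth_map invrM //.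
by rewrite !mulrA.
Qed.

Definition conj_quotient : variety F := quot conjugate_refl conjugate_sym conjugate_trans.

Definition conj_class : X -> conj_quotient :=
  quot_proj conjugate_refl conjugate_sym conjugate_trans.

(* The GIT quotient X // SL_2: its coordinate ring is the ring of invariant
   regular functions, and two points of X have the same image when no such
   function separates them (equivalently, when their orbit closures meet). *)
Definition git_equiv (M N : X) : Prop :=
  forall f, regular X f -> (forall P Q, conjugate P Q -> f P = f Q) -> f M = f N.

Fact git_equiv_refl M : git_equiv M M. Proof. by []. Qed.

Fact git_equiv_sym M N : git_equiv M N -> git_equiv N M.
Proof. by move=> MN f rf If; rewrite MN. Qed.

Fact git_equiv_trans M N P : git_equiv M N -> git_equiv N P -> git_equiv M P.
Proof. by move=> MN NP f rf If; rewrite MN // NP. Qed.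

Definition git_quotient : variety F := quot git_equiv_refl git_equiv_sym git_equiv_trans.

Definition git_class : X -> git_quotient :=
  quot_proj git_equiv_refl git_equiv_sym git_equiv_trans.

Lemma conjugate_git M N : conjugate M N -> git_equiv M N.
Proof. by move=> MN f _; apply. Qed.
End Conjugation.

(* Representations with trace c at t. The five matrices are listed in the order
   of the relation, M_0, M_1, M_t, M_lambda, M_infty. *)
Definition is_rep_P1 (c : F) (M : 5.-tuple 'M[F]_2) : bool :=
  [&& all (fun A => \det A == 1) M,
      M`_0 * M`_1 * M`_2 * M`_3 * M`_4 == 1,
      \tr M`_0 == 0, \tr M`_1 == 0, \tr M`_3 == 0, \tr M`_4 == 0
    & \tr M`_2 == c].

(* The four matrices are A, B, C_1, C_2. *)
Definition is_rep_C (c : F) (N : 4.-tuple 'M[F]_2) : bool :=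
  [&& all (fun A => \det A == 1) N,
      N`_0 * N`_1 == N`_2 * N`_1 * N`_0 * N`_3,
      \tr N`_2 == c & \tr N`_3 == c].

(* Monodromy of the pullback to the double cover C, after the twist by the
   central character with local monodromy -1 at the four Weierstrass points:
   A = M_1 M_t M_lambda, B = M_lambda M_infty, C_1 = M_t,
   C_2 = M_infty M_t M_infty^-1. *)
Definition phi_tuple (M : 5.-tuple 'M[F]_2) : 4.-tuple 'M[F]_2 :=
  [tuple M`_1 * M`_2 * M`_3; M`_3 * M`_4; M`_2; M`_4 * M`_2 * (M`_4)^-1].

Lemma det_mx2 (A : 'M[F]_2) : \det A = A 0 0 * A 1 1 - A 0 1 * A 1 0.
Proof.
rewrite (expand_det_row A 0) !big_ord_recl big_ord0 /cofactor !det_mx11 !mxE /=.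
rewrite /= !(expr0, expr1, addn0, add0n) mul1r addr0 mulN1r mulrN.
by congr (A _ _ * A _ _ - A _ _ * A _ _); apply: val_inj.
Qed.
Lemma sqr_tr0 (A : 'M[F]_2) : \det A = 1 -> \tr A = 0 -> A * A = -1.
Proof.
rewrite det_mx2 /mxtrace !big_ord_recl big_ord0 addr0.
have -> : lift ord0 ord0 = 1 :> 'I_2 by apply: val_inj.
move=> dA /eqP; rewrite addrC addr_eq0 => /eqP tA.
apply/matrixP=> i j; rewrite !mxE !big_ord_recl big_ord0 addr0.
have -> : lift ord0 ord0 = 1 :> 'I_2 by apply: val_inj.
have -> : ord0 = 0 :> 'I_2 by apply: val_inj.
have key : A 0 0 * A 0 0 + A 0 1 * A 1 0 = -1 by rewrite -dA tA; ring.
have c2 (k : 'I_2) : k = 0 \/ k = 1.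
  by case: k => [[|[|//]]] H; [left|right]; apply: val_inj.
case: (c2 i) (c2 j) => -> [] ->; rewrite /= ?tA -?key; ring.
Qed.

Section RepresentationVarieties.
Variable c : F.

Definition rep_P1 : variety F := conj_quotient (is_rep_P1 c).

Definition rep_C : variety F := git_quotient (is_rep_C c).

Lemma phi_tuple_rep (M : 5.-tuple 'M[F]_2) : is_rep_P1 c M -> is_rep_C c (phi_tuple M).
Proof.
case: M => [[|M0 [|M1 [|M2 [|M3 [|M4 [|//]]]]]]] //= szM.
rewrite /is_rep_P1 /is_rep_C /= andbT => /and5P[/and5P[/eqP d0 /eqP d1 /eqP d2 /eqP d3 /eqP d4]].
move=> /eqP rel /eqP t0 /eqP t1 /and3P[/eqP t3 /eqP t4 /eqP t2].
have u0 : M0 \is a GRing.unit by rewrite unitmxE d0 unitr1.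
have u4 : M4 \is a GRing.unit by rewrite unitmxE d4 unitr1.
have s0 := sqr_tr0 d0 t0; have s1 := sqr_tr0 d1 t1.
have s3 := sqr_tr0 d3 t3; have s4 := sqr_tr0 d4 t4.
have i4 : M4^-1 = - M4.
  by apply: (mulrI u4); rewrite mulrV // mulrN s4 opprK.
have r0 : M1 * M2 * M3 * M4 = - M0.
  by apply: (mulrI u0); rewrite !mulrA rel mulrN s0 opprK.
have r1 : M2 * M3 * M4 = M1 * M0.
  have u1 : M1 \is a GRing.unit by rewrite unitmxE d1 unitr1.
  by apply: (mulrI u1); rewrite !mulrA r0 s1 mulN1r.
have dm (A B : 'M[F]_2) : \det (A * B) = \det A * \det B by exact: det_mulmx.
rewrite !dm d1 d2 d3 d4 det_inv d4 invr1 !mulr1 !eqxx /=.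
apply/and3P; split.
- apply/eqP; rewrite i4.
  have -> : M1 * M2 * M3 * (M3 * M4) = - (M1 * M2 * M4).
    by rewrite -!mulrA [M3 * (M3 * M4)]mulrA s3 mulN1r !mulrN.
  have -> : M2 * (M3 * M4) * (M1 * M2 * M3) * (M4 * M2 * - M4)
          = - ((M2 * M3 * M4) * (M1 * M2 * M3 * M4) * M2 * M4).
    by rewrite !mulrN !mulrA.
  rewrite r0 r1 !mulrN !mulNr opprK -[M1 * M0 * M0]mulrA s0.
  by rewrite mulrN1 !mulNr.
- by rewrite t2.
- have -> : \tr (M4 * M2 * M4^-1) = \tr (M4^-1 * (M4 * M2)) by exact: mxtrace_mulC.
  by rewrite mulrA mulVr // mul1r t2.
Qed.

Definition phi0 (M : closed_subvariety (is_rep_P1 c)) : closed_subvariety (is_rep_C c) :=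
  exist _ (phi_tuple (val M)) (phi_tuple_rep (valP M)).

Definition Phi_top (x : rep_P1) : rep_C := git_class (phi0 (repr x)).

(* Phi_top does not depend on the choice of representatives. *)
Lemma Phi_topE (M : closed_subvariety (is_rep_P1 c)) :
  Phi_top (conj_class M) = git_class (phi0 M).
Proof.
apply/quot_projP; apply: conjugate_git.
set N := repr _.
have /quot_projP[g dg eM] : conj_class N = conj_class M by exact: quot_repr.
exists g => //; rewrite /= eM.
have ug : g \is a GRing.unit by rewrite unitmxE dg unitr1.
case: N eM => [[[|N0 [|N1 [|N2 [|N3 [|N4 [|//]]]]]] //= szN] repN] _.
have u4 : N4 \is a GRing.unit.
  by case/and5P: repN => /= /and5P[_ _ _ _ /andP[/eqP d4 _]] *; rewrite unitmxE d4 unitr1.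
have gM A B : g * A * g^-1 * (g * B * g^-1) = g * (A * B) * g^-1.
  by rewrite !mulrA mulrVK.
have gV : (g * N4 * g^-1)^-1 = g * N4^-1 * g^-1.
  by rewrite !invrM ?unitrV ?unitrMl // invrK mulrA.
by apply: val_inj; rewrite /= gV !gM.
Qed.

Definition diagonal_rep (y : rep_C) : Prop :=
  exists2 N : closed_subvariety (is_rep_C c),
    y = git_class N & forall k, is_diag_mx (tnth (val N) k).

Definition antidiagonal_mx (A : 'M[F]_2) : Prop := forall i, A i i = 0.

(* Dihedral of the type M_t diagonal, all the other matrices antidiagonal; other
   mixtures of diagonal and antidiagonal matrices occur in rep_P1 as well, but
   in general these do not become diagonal on C. *)
Definition dihedral_rep (x : rep_P1) : Prop :=
  exists2 M : closed_subvariety (is_rep_P1 c),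
    x = conj_class M &
    let M := val M in
    is_diag_mx M`_2 /\
    [/\ antidiagonal_mx M`_0, antidiagonal_mx M`_1,
        antidiagonal_mx M`_3 & antidiagonal_mx M`_4].
End RepresentationVarieties.
End Geometry.

Section ComplexCosine.
Variable R : realType.
Local Open Scope complex_scope.

Definition cexp (z : R[i]) : R[i] :=
  (expR (Re z) * cos (Im z)) +i* (expR (Re z) * sin (Im z)).

Definition ccos (z : R[i]) : R[i] := (cexp ('i%C * z) + cexp (- ('i%C * z))) / 2.

Definition cpi : R[i] := (trigo.pi : R)%:C.
End ComplexCosine.

(* Main.v *)
Require Import Defs.
From HB Require Import structures.
From mathcomp Require Import all_boot all_order all_algebra generic_quotient.
From mathcomp Require Import complex mpoly.
From mathcomp Require Import boolp reals sequences trigo.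
From mathcomp Require Import exp perm separable ring.

(** The eigenvalues q and s = q^-1 of M_t are distinct because 2 nu is not an integer. So M_t
    is diagonalizable, and each conjugacy class meets the slice where M_t (on C: C_1) is the
    diagonal matrix with entries q, s, in an orbit of the diagonal torus. Invariant functions
    are determined on the slice, where they are polynomials in the diagonal entries and in the
    products of an upper right by a lower left entry ([invariant_gen]).

    The involution changes the signs of M_0, M_1, M_lambda and M_oo: it is the twist by the
    character of the double cover, which is trivial on C. Conjugation by M_oo realizes the
    elliptic involution, so these four matrices are M_oo times words in A, B, C_1, C_2, and
    their products two by two come from C ([branch_mul], [branch_mul2]). Let m_k be their upper
    left entries on the slice, the odd coordinates. The products m_k m_l come from C
    ([even_odd_coord2]), and each function on the source is f + \sum_k m_k f_k where f and the
    f_k come from C ([odd_decomposition]). Hence Phi_top is finite, its fibers are the orbits of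
    the involution, every function invariant under the involution comes from C, and the fixed
    points are the zeros of all m_k, that is, the dihedral representations; their images are the
    diagonal ones. Near a point with m_k <> 0 the functions 1 and m_k form a basis and Phi_top is
    etale. At a fixed point x the odd functions form a module over those of C whose fiber at
    Phi_top x is not 0 ([odd_cotangent]); a nonzero functional on this fiber is a tangent vector
    at x that the differential of Phi_top kills.

    Surjectivity: M_oo has to be a trace free matrix orthogonal, for the trace form, to 1, A, B
    and C_1 B A, and any such matrix of determinant 1 gives a preimage ([phi0_lift]). It exists
    because the equality of the traces of C_1 and C_2 is the linear dependence of these four
    matrices. If it is nilpotent, the representation is triangular, and the diagonal one in its
    class has a dihedral preimage.

    Singularities: a1, a2, b1, b2 (the diagonal entries of A and B on the slice) and
    u = A_01 B_10, v = B_01 A_10 embed Rep(C, T) in the affine space of dimension 6, with two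
    equations, u v = (a1 a2 - 1) (b1 b2 - 1) and [chart_eq], the trace of C_2. Modulo these, each
    polynomial is a combination of 1, u, v, v^2 with coefficients in a1, a2, b1, b2, in a unique
    way since over a generic point of the base there are four points with distinct v
    ([nform_eq0]). So the two equations generate the ideal, the dimension is 4 by counting
    monomials, and the tangent spaces are the kernels of the Jacobian matrix. This has rank 2
    except at the critical points of \tr (C_1^-1 A B A^-1 B^-1) on SL_2 x SL_2, where A, B and C_1
    are simultaneously diagonal ([critical_diag]). *)

Set Implicit Arguments.
Unset Strict Implicit.
Unset Printing Implicit Defensive.

Import Order.TTheory GRing.Theory Num.Theory.
Local Open Scope ring_scope.
Local Open Scope quotient_scope.

Local Notation coord := Defs.coord.

(** * Polynomials and two by two matrices *)

Section Polynomials.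

Lemma mpoly_alg_ind (R : comNzRingType) n (P : {mpoly R[n]} -> Prop) :
  (forall a, P a%:MP) -> (forall i, P 'X_i) ->
  (forall p r, P p -> P r -> P (p + r)) ->
  (forall p r, P p -> P r -> P (p * r)) -> forall p, P p.
Proof.
move=> PC PX PD PM p; have PE a i : P a -> P (a ^+ i).
  move=> Pa; elim: i => [|i IH]; first by rewrite expr0 -mpolyC1; exact: PC.
  by rewrite exprS; exact: PM.
have P1 : P 1 by rewrite -mpolyC1; exact: PC.
rewrite (mpolyE p); apply: (big_ind P) => [||m _].
- by rewrite -mpolyC0; exact: PC.
- exact: PD.
rewrite -mul_mpolyC; apply: (PM _ _) => //; rewrite mpolyXE_id.
by apply: (big_ind P) => [//||i _]; [exact: PM | exact: PE].
Qed.

Lemma base_expansion_inj B n (f g : 'I_n -> nat) :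
  (forall i, f i < B)%N -> (forall i, g i < B)%N ->
  (\sum_i f i * B ^ i = \sum_i g i * B ^ i)%N -> f =1 g.
Proof.
elim: n f g => [|n IHn] f g fB gB; first by move=> _ [].
have step (h : 'I_n.+1 -> nat) :
    (\sum_i h i * B ^ i = (\sum_(i < n) h (lift ord0 i) * B ^ i) * B + h ord0)%N.
  rewrite big_ord_recl expn0 muln1 addnC big_distrl /=; congr (_ + _)%N.
  by apply: eq_bigr => i _; rewrite /bump /= add1n expnSr mulnA.
have B0 : (0 < B)%N by apply: leq_trans (fB ord0).
rewrite !step => e.
have e0 : f ord0 = g ord0.
  by have := congr1 (modn^~ B) e; rewrite /= !modnMDl !modn_small.
have := congr1 (divn^~ B) e; rewrite /= !divnMDl // !divn_small // !addn0 => e1.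
move=> i; case: (unliftP ord0 i) => [j ->|-> //].
exact: (IHn (fun j => f (lift ord0 j)) (fun j => g (lift ord0 j))).
Qed.

Variable F : numFieldType.

Lemma poly_eq0_horner (p : {poly F}) : (forall x, x != 0 -> p.[x] = 0) -> p = 0.
Proof.
move=> p0; apply/eqP; apply: contraT => pN0.
pose rs := [seq (i.+1)%:R : F | i <- iota 0 (size p)].
have /max_poly_roots : p != 0 by [].
move=> /(_ rs); rewrite size_map size_iota ltnn; apply.
  by apply/allP => x /mapP[i _ ->]; apply/rootP/p0; rewrite pnatr_eq0.
rewrite map_inj_uniq ?iota_uniq // => i j /eqP.
by rewrite eqr_nat => /eqP[].
Qed.

(** Kronecker substitution: the powers of t with exponents 1, B, B^2, ... separate
    the monomials of p when B exceeds its degree. *)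
Lemma mpoly_eq0_meval n (p : {mpoly F[n]}) : (forall v, p.@[v] = 0) -> p = 0.
Proof.
move=> p0; pose B := msize p.
pose code (m : 'X_{1..n}) := (\sum_i m i * B ^ i)%N.
pose P : {poly F} := \sum_(m <- msupp p) p@_m *: 'X^(code m).
have P0 : P = 0.
  apply: poly_eq0_horner => t _; rewrite -(p0 (fun i => t ^+ (B ^ i))) mevalE.
  rewrite horner_sum; apply: eq_bigr => m _; rewrite hornerZ hornerXn.
  congr (_ * _); rewrite -prodrXr; apply: eq_bigr => i _.
  by rewrite mulnC exprM.
have mB m i : m \in msupp p -> (m i < B)%N.
  move=> /msize_mdeg_lt; apply: leq_ltn_trans.
  by rewrite mdegE (bigD1 i) //= leq_addr.
apply/mpolyP => m; rewrite mcoeff0; case: (boolP (m \in msupp p)) => [mp|/memN_msupp_eq0 //].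
have := congr1 (fun Q : {poly F} => Q`_(code m)) P0.
rewrite coef0 coef_sum (bigD1_seq m) ?msupp_uniq //= coefZ coefXn eqxx mulr1.
rewrite big_seq_cond big1 ?addr0 // => m' /andP[m'p m'm].
rewrite coefZ coefXn; case: eqP => [e|_]; last by rewrite mulr0.
case/eqP: m'm; apply/mnmP; apply: (@base_expansion_inj B) => [i|i|]; rewrite ?mB //.
Qed.

End Polynomials.

Section Matrices.
Variable F : fieldType.
Implicit Types (A B C : 'M[F]_2) (a b c d : F).

Definition mx2 a b c d : 'M[F]_2 :=
  \matrix_(i < 2, j < 2)
    if i == 0 then (if j == 0 then a else b) else (if j == 0 then c else d).

Lemma ord2P (i : 'I_2) : i = 0 \/ i = 1.
Proof. by case: i => [[|[|//]]] H; [left | right]; apply: val_inj. Qed.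

Lemma mx2E a b c d :
  ((mx2 a b c d 0 0 = a) * (mx2 a b c d 0 1 = b) *
   (mx2 a b c d 1 0 = c) * (mx2 a b c d 1 1 = d))%type.
Proof. by rewrite !mxE. Qed.

Lemma mx2P A B : A 0 0 = B 0 0 -> A 0 1 = B 0 1 -> A 1 0 = B 1 0 ->
  A 1 1 = B 1 1 -> A = B.
Proof.
by move=> ? ? ? ?; apply/matrixP => i j; case: (ord2P i) (ord2P j) => -> [] ->.
Qed.

Lemma mx2_eta A : A = mx2 (A 0 0) (A 0 1) (A 1 0) (A 1 1).
Proof. by apply: mx2P; rewrite mx2E. Qed.

Lemma sum_ord2 (f : 'I_2 -> F) : \sum_i f i = f 0 + f 1.
Proof.
rewrite !big_ord_recl big_ord0 addr0; congr (f _ + f _); exact: val_inj.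
Qed.

Lemma mul2E A B i j : (A * B) i j = A i 0 * B 0 j + A i 1 * B 1 j.
Proof. by rewrite mxE sum_ord2. Qed.

Lemma mx2M a b c d a' b' c' d' : mx2 a b c d * mx2 a' b' c' d' =
  mx2 (a * a' + b * c') (a * b' + b * d') (c * a' + d * c') (c * b' + d * d').
Proof. by apply: mx2P; rewrite mul2E !mx2E. Qed.

Lemma mx2D a b c d a' b' c' d' : mx2 a b c d + mx2 a' b' c' d' =
  mx2 (a + a') (b + b') (c + c') (d + d').
Proof. by apply: mx2P; rewrite !mxE. Qed.

Lemma mx2N a b c d : - mx2 a b c d = mx2 (- a) (- b) (- c) (- d).
Proof. by apply: mx2P; rewrite !mxE. Qed.

Lemma mx2Z k a b c d : k *: mx2 a b c d = mx2 (k * a) (k * b) (k * c) (k * d).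
Proof. by apply: mx2P; rewrite !mxE. Qed.

Lemma mx2_1 : 1 = mx2 1 0 0 1.
Proof. by apply: mx2P; rewrite !mxE. Qed.

Lemma mx2_0 : 0 = mx2 0 0 0 0.
Proof. by apply: mx2P; rewrite !mxE. Qed.

Lemma mx2_inj a b c d a' b' c' d' : mx2 a b c d = mx2 a' b' c' d' ->
  [/\ a = a', b = b', c = c' & d = d'].
Proof.
move/matrixP => e; split.
- by have := e 0 0; rewrite !mx2E.
- by have := e 0 1; rewrite !mx2E.
- by have := e 1 0; rewrite !mx2E.
- by have := e 1 1; rewrite !mx2E.
Qed.

Lemma tr2 A : \tr A = A 0 0 + A 1 1.
Proof. exact: sum_ord2. Qed.

Lemma tr_mx2 a b c d : \tr (mx2 a b c d) = a + d.
Proof. by rewrite tr2 !mx2E. Qed.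

Lemma det_mx2E a b c d : \det (mx2 a b c d) = a * d - b * c.
Proof. by rewrite det_mx2 !mx2E. Qed.

Lemma det2M A B : \det (A * B) = \det A * \det B.
Proof. exact: det_mulmx. Qed.

Lemma tr2C A B : \tr (A * B) = \tr (B * A).
Proof. exact: mxtrace_mulC. Qed.

Definition adj2 A := mx2 (A 1 1) (- A 0 1) (- A 1 0) (A 0 0).

Lemma adj2_mx2 a b c d : adj2 (mx2 a b c d) = mx2 d (- b) (- c) a.
Proof. by rewrite /adj2 !mx2E. Qed.

Lemma mul_adj2 A : adj2 A * A = (\det A)%:A.
Proof.
rewrite (mx2_eta A) adj2_mx2 mx2M det_mx2E mx2_1 mx2Z; congr mx2; ring.
Qed.

Lemma mul_2adj A : A * adj2 A = (\det A)%:A.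
Proof.
rewrite (mx2_eta A) adj2_mx2 mx2M det_mx2E mx2_1 mx2Z; congr mx2; ring.
Qed.

Lemma unit2 A : \det A = 1 -> A \is a GRing.unit.
Proof. by move=> dA; rewrite unitmxE dA unitr1. Qed.

Lemma inv2 A : \det A = 1 -> A^-1 = adj2 A.
Proof.
move=> dA; apply: (mulrI (unit2 dA)); rewrite mulrV ?unit2 // mul_2adj dA.
by rewrite scale1r.
Qed.

Lemma det_adj2 A : \det (adj2 A) = \det A.
Proof. by rewrite (mx2_eta A) adj2_mx2 !det_mx2E; ring. Qed.

Lemma adj2M A B : adj2 (A * B) = adj2 B * adj2 A.
Proof.
rewrite (mx2_eta A) (mx2_eta B) mx2M !adj2_mx2 mx2M; congr mx2; ring.
Qed.

Lemma adj2E A : adj2 A = (\tr A)%:A - A.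
Proof.
rewrite (mx2_eta A) adj2_mx2 tr_mx2 mx2_1 mx2Z mx2N mx2D; congr mx2; ring.
Qed.

Lemma adj2K A : adj2 (adj2 A) = A.
Proof. by rewrite {2}(mx2_eta A) /adj2 !mx2E !opprK. Qed.

Lemma adj2_tr0 A : \tr A = 0 -> adj2 A = - A.
Proof. by move=> t; rewrite adj2E t scale0r sub0r. Qed.

Lemma conj2M (g A B : 'M[F]_2) : \det g = 1 ->
  g * (A * B) * g^-1 = (g * A * g^-1) * (g * B * g^-1).
Proof. by move=> dg; rewrite !mulrA mulrVK ?unit2. Qed.

Lemma tr_conj2 (g A : 'M[F]_2) : \det g = 1 -> \tr (g * A * g^-1) = \tr A.
Proof. by move=> dg; rewrite tr2C mulrA mulVr ?mul1r ?unit2. Qed.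

Lemma det_conj2 (g A : 'M[F]_2) : \det g = 1 -> \det (g * A * g^-1) = \det A.
Proof. by move=> dg; rewrite !det2M det_inv dg invr1 mul1r mulr1. Qed.

Lemma adj2_conj (g A : 'M[F]_2) : \det g = 1 ->
  adj2 (g * A * g^-1) = g * adj2 A * g^-1.
Proof.
by move=> dg; rewrite inv2 // !adj2M adj2K mulrA.
Qed.

End Matrices.

(** * Regular functions and torus invariants *)

Section RegularMaps.
Variables (F : fieldType) (n : nat) (S : pred (n.-tuple 'M[F]_2)).
Local Notation X := (closed_subvariety S).
Implicit Types (f g : X -> F) (h : X -> 'M[F]_2).

Lemma regular_cst a : regular X (fun _ => a).
Proof. by exists a%:MP => M; rewrite mevalC. Qed.

Lemma regularD f g : regular X f -> regular X g -> regular X (fun M => f M + g M).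
Proof. by move=> [p fp] [r gr]; exists (p + r) => M; rewrite mevalD fp gr. Qed.

Lemma regularM f g : regular X f -> regular X g -> regular X (fun M => f M * g M).
Proof. by move=> [p fp] [r gr]; exists (p * r) => M; rewrite mevalM fp gr. Qed.

Lemma regularN f : regular X f -> regular X (fun M => - f M).
Proof. by move=> [p fp]; exists (- p) => M; rewrite mevalN fp. Qed.

Lemma regular_sum (I : Type) (r : seq I) (f : I -> X -> F) :
  (forall i, regular X (f i)) -> regular X (fun M => \sum_(i <- r) f i M).
Proof.
move=> rf; elim: r => [|i r IHr].
  rewrite (_ : (fun M => _) = fun _ => 0); first exact: regular_cst.
  by apply/funext => M; rewrite big_nil.
rewrite (_ : (fun M => _) = fun M => f i M + \sum_(j <- r) f j M); first exact: regularD.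
by apply/funext => M; rewrite big_cons.
Qed.


Lemma regular_meval m (p : {mpoly F[m]}) (z : 'I_m -> X -> F) :
  (forall i, regular X (z i)) -> regular X (fun M => p.@[fun i => z i M]).
Proof.
move=> rz; pose r i := sval (cid (rz i)).
exists (p \mPo [tuple r i | i < m]) => M; rewrite comp_mpoly_meval; apply: meval_eq => i.
by rewrite tnth_mktuple; have := svalP (cid (rz i)) M.
Qed.


Lemma regular_entry k i j : regular X (fun M => tnth (val M) k i j).
Proof.
exists 'X_(enum_rank (k, i, j)) => M.
by rewrite mevalXU /coord enum_rankK.
Qed.

Definition regular_mx h : Prop := forall i j, regular X (fun M => h M i j).

Lemma regular_mx_cst A : regular_mx (fun _ => A).
Proof. by move=> i j; exact: regular_cst. Qed.

Lemma regular_mx_tnth k : regular_mx (fun M => tnth (val M) k).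
Proof. by move=> i j; exact: regular_entry. Qed.

Lemma regular_mxM h h' : regular_mx h -> regular_mx h' ->
  regular_mx (fun M => h M * h' M).
Proof.
move=> rh rh' i j.
rewrite (_ : (fun M => _) = fun M => h M i 0 * h' M 0 j + h M i 1 * h' M 1 j).
  by apply: regularD; apply: regularM.
by apply/funext => M; rewrite mul2E.
Qed.

Lemma regular_mxN h : regular_mx h -> regular_mx (fun M => - h M).
Proof.
move=> rh i j; rewrite (_ : (fun M => _) = fun M => - h M i j).
  exact: regularN.
by apply/funext => M; rewrite mxE.
Qed.

Lemma regular_mx2 f1 f2 f3 f4 :
  regular X f1 -> regular X f2 -> regular X f3 -> regular X f4 ->
  regular_mx (fun M => mx2 (f1 M) (f2 M) (f3 M) (f4 M)).
Proof.
move=> r1 r2 r3 r4 i j.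
case: (ord2P i) (ord2P j) => -> [] ->.
- by rewrite (_ : (fun M => _) = f1) //; apply/funext => M; rewrite mx2E.
- by rewrite (_ : (fun M => _) = f2) //; apply/funext => M; rewrite mx2E.
- by rewrite (_ : (fun M => _) = f3) //; apply/funext => M; rewrite mx2E.
- by rewrite (_ : (fun M => _) = f4) //; apply/funext => M; rewrite mx2E.
Qed.

Lemma regular_mx_adj2 h : regular_mx h -> regular_mx (fun M => adj2 (h M)).
Proof.
by move=> rh; apply: regular_mx2 => //; apply: regularN.
Qed.

Lemma regular_tr h : regular_mx h -> regular X (fun M => \tr (h M)).
Proof.
move=> rh; rewrite (_ : (fun M => _) = fun M => h M 0 0 + h M 1 1).
  exact: regularD.
by apply/funext => M; rewrite tr2.
Qed.

Definition equivariant h : Prop := forall (g : 'M[F]_2) (M N : X), \det g = 1 ->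
  val N = conj_tuple g (val M) -> h N = g * h M * g^-1.

Lemma equivariant_tnth k : equivariant (fun M => tnth (val M) k).
Proof. by move=> g M N dg ->; rewrite tnth_map. Qed.

Lemma equivariantM h h' : equivariant h -> equivariant h' ->
  equivariant (fun M => h M * h' M).
Proof.
move=> eh eh' g M N dg e.
by rewrite (eh _ _ _ dg e) (eh' _ _ _ dg e) conj2M.
Qed.

Lemma equivariantN h : equivariant h -> equivariant (fun M => - h M).
Proof.
by move=> eh g M N dg e; rewrite (eh _ _ _ dg e) mulrN mulNr.
Qed.

Lemma equivariant_adj2 h : equivariant h -> equivariant (fun M => adj2 (h M)).
Proof.
by move=> eh g M N dg e; rewrite (eh _ _ _ dg e) adj2_conj.
Qed.

Lemma equivariant1 : equivariant (fun _ => 1).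
Proof. by move=> g M N dg e; rewrite mulr1 mulrV ?unit2. Qed.

(** Equivariant polynomial matrices; their traces are invariant functions. *)
Definition word h : Prop := regular_mx h /\ equivariant h.

Lemma word_tnth k : word (fun M => tnth (val M) k).
Proof. by split; [exact: regular_mx_tnth | exact: equivariant_tnth]. Qed.

Lemma wordM h h' : word h -> word h' -> word (fun M => h M * h' M).
Proof.
by move=> [r e] [r' e']; split; [exact: regular_mxM | exact: equivariantM].
Qed.

Lemma wordN h : word h -> word (fun M => - h M).
Proof. by move=> [r e]; split; [exact: regular_mxN | exact: equivariantN]. Qed.

Lemma word_adj2 h : word h -> word (fun M => adj2 (h M)).
Proof.
by move=> [r e]; split; [exact: regular_mx_adj2 | exact: equivariant_adj2].
Qed.

Lemma word1 : word (fun _ => 1).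
Proof. by split; [exact: regular_mx_cst | exact: equivariant1]. Qed.

Definition invariant f : Prop := forall M N, conjugate M N -> f M = f N.

Definition inv_regular f : Prop := regular X f /\ invariant f.

Lemma inv_regular_tr h : word h -> inv_regular (fun M => \tr (h M)).
Proof.
move=> [r e]; split; first exact: regular_tr.
by move=> M N [g dg eN]; rewrite (e _ _ _ dg eN) tr_conj2.
Qed.

Lemma inv_regular_cst a : inv_regular (fun _ => a).
Proof. by split=> //; exact: regular_cst. Qed.

Lemma inv_regularD f g : inv_regular f -> inv_regular g ->
  inv_regular (fun M => f M + g M).
Proof.
move=> [rf If] [rg Ig]; split; first exact: regularD.
by move=> M N MN; rewrite (If _ _ MN) (Ig _ _ MN).
Qed.

Lemma inv_regularM f g : inv_regular f -> inv_regular g ->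
  inv_regular (fun M => f M * g M).
Proof.
move=> [rf If] [rg Ig]; split; first exact: regularM.
by move=> M N MN; rewrite (If _ _ MN) (Ig _ _ MN).
Qed.

Lemma inv_regularN f : inv_regular f -> inv_regular (fun M => - f M).
Proof.
move=> [rf If]; split; first exact: regularN.
by move=> M N MN; rewrite (If _ _ MN).
Qed.

End RegularMaps.

Section TorusInvariants.
Variables (F : numClosedFieldType) (n : nat) (S : pred (n.-tuple 'M[F]_2)).
Local Notation X := (closed_subvariety S).
Local Notation index := 'I_#|{: 'I_n * 'I_2 * 'I_2}|.
Local Notation mono := 'X_{1..#|{: 'I_n * 'I_2 * 'I_2}|}.

Definition torus_mx (t : F) := mx2 t 0 0 t^-1.

Lemma det_torus t : t != 0 -> \det (torus_mx t) = 1.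
Proof. by move=> t0; rewrite det_mx2E mulr0 subr0 mulfV. Qed.

Lemma torus_conj t A : t != 0 -> torus_mx t * A * (torus_mx t)^-1 =
  mx2 (A 0 0) (t ^+ 2 * A 0 1) (t ^- 2 * A 1 0) (A 1 1).
Proof.
move=> t0; rewrite inv2 ?det_torus // {1}(mx2_eta A) adj2_mx2 !mx2M.
by congr mx2; field.
Qed.

Definition upper_wt (k : index) : bool :=
  let: (_, i, j) := enum_val k in (i == 0) && (j == 1).
Definition lower_wt (k : index) : bool :=
  let: (_, i, j) := enum_val k in (i == 1) && (j == 0).

Lemma coord_torus t (M : n.-tuple 'M[F]_2) k : t != 0 ->
  coord (conj_tuple (torus_mx t) M) k * (t ^+ 2) ^+ lower_wt k =
  (t ^+ 2) ^+ upper_wt k * coord M k.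
Proof.
move=> t0; rewrite /coord /upper_wt /lower_wt.
case: (enum_val k) => -[a i] j; rewrite tnth_map torus_conj //.
case: (ord2P i) (ord2P j) => -> [] ->; rewrite !mx2E /= ?expr0 ?expr1 ?mul1r ?mulr1 //.
by rewrite mulrC mulrA mulfV ?mul1r // expf_neq0.
Qed.

Definition upper_deg (m : mono) :=
  (\sum_k upper_wt k * m k)%N.
Definition lower_deg (m : mono) :=
  (\sum_k lower_wt k * m k)%N.

Lemma lower_deg_le m : (lower_deg m <= mdeg m)%N.
Proof. by rewrite mdegE; apply: leq_sum => k _; case: (lower_wt k); rewrite ?mul1n ?mul0n. Qed.

Lemma mono_torus t (M : n.-tuple 'M[F]_2) m : t != 0 ->
  'X_[m].@[coord (conj_tuple (torus_mx t) M)] * (t ^+ 2) ^+ lower_deg m =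
  (t ^+ 2) ^+ upper_deg m * 'X_[m].@[coord M].
Proof.
move=> t0; rewrite !mevalX -!prodrXr -!big_split /=; apply: eq_bigr => k _.
by rewrite !exprM -!exprMn coord_torus.
Qed.

Hypothesis torus_stable : forall (t : F) M, t != 0 -> S M -> S (conj_tuple (torus_mx t) M).

(** A function invariant under the torus is the sum of its monomials of weight 0:
    as a Laurent polynomial in the torus parameter it is constant. *)
Lemma torus_invariant_wt0 (p : {mpoly F[#|{: 'I_n * 'I_2 * 'I_2}|]}) (f : X -> F) :
  (forall M, f M = p.@[coord (val M)]) -> invariant f ->
  forall M, f M = \sum_(m <- msupp p | upper_deg m == lower_deg m)
                     p@_m * 'X_[m].@[coord (val M)].
Proof.
move=> fp If M; pose K := msize p.
(* the factor 'X^K clears the negative powers of the torus parameter; in Q the weight 0 part has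
   degree K *)
pose Q : {poly F} := f M *: 'X^K -
  \sum_(m <- msupp p) (p@_m * 'X_[m].@[coord (val M)]) *:
     'X^(K - lower_deg m + upper_deg m).
have ldK m : m \in msupp p -> (lower_deg m <= K)%N.
  by move=> /msize_mdeg_lt /ltnW; apply: leq_trans; exact: lower_deg_le.
have Q0 : Q = 0.
  apply: poly_eq0_horner => T T0; pose t := sqrtC T.
  have tT : t ^+ 2 = T by rewrite sqrtCK.
  have t0 : t != 0 by rewrite sqrtC_eq0.
  have SM : S (conj_tuple (torus_mx t) (val M)) := torus_stable t0 (valP M).
  pose N : X := Sub (conj_tuple (torus_mx t) (val M)) SM.
  have fMN : f M = f N.
    by apply: If; exists (torus_mx t); [exact: det_torus | rewrite SubK].
  rewrite hornerD hornerN hornerZ hornerXn horner_sum fMN fp SubK.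
  apply/eqP; rewrite subr_eq0; apply/eqP.
  rewrite {1}(mpolyE p) raddf_sum mulr_suml big_seq [RHS]big_seq.
  apply: eq_bigr => m mp; rewrite /= mevalZ hornerZ hornerXn -!mulrA; congr (_ * _).
  rewrite exprD [T ^+ (K - _) * _]mulrC mulrA [_ * T ^+ upper_deg m]mulrC -tT -mono_torus //.
  by rewrite -mulrA -exprD subnKC ?ldK.
have := congr1 (fun P : {poly F} => P`_K) Q0.
rewrite coef0 coefB coefZ coefXn eqxx mulr1 coef_sum => /eqP.
rewrite subr_eq0 => /eqP ->; rewrite [RHS]big_mkcond big_seq [RHS]big_seq /=.
apply: eq_bigr => m mp; rewrite coefZ coefXn.
have -> : (K == K - lower_deg m + upper_deg m)%N = (upper_deg m == lower_deg m).
  by rewrite -{1}(subnK (ldK m mp)) eqn_add2l eq_sym.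
by case: ifP; rewrite ?mulr1 ?mulr0.
Qed.

Variables (slice : X -> Prop) (A : (X -> F) -> Prop).
Hypotheses (A_ext : forall f g, (forall M, slice M -> f M = g M) -> A f -> A g)
  (A_cst : forall a, A (fun _ => a))
  (A_add : forall f g, A f -> A g -> A (fun M => f M + g M))
  (A_mul : forall f g, A f -> A g -> A (fun M => f M * g M))
  (A_diag : forall a i, A (fun M => tnth (val M) a i i))
  (A_pair : forall a b, A (fun M => tnth (val M) a 0 1 * tnth (val M) b 1 0)).

(** A monomial of weight 0 contains a diagonal entry, or else as many upper right as lower left
    entries, which are split off in pairs. *)
Lemma mono_wt0 m : upper_deg m = lower_deg m ->
  A (fun M => 'X_[m].@[coord (val M)]).
Proof.
have [d] := ubnP (mdeg m); elim: d m => // d IHd m md ul.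
case: (eqVneq m 0%MM) => [->|m0].
  by apply: (A_ext (f := fun _ => 1)) => // M _; rewrite mpolyX0 meval1.
have split_mono (k : index) (m1 : mono) : m1 k != 0%N -> exists2 m2,
    m1 = (U_(k) + m2)%MM & (mdeg m2 < mdeg m1)%N.
  move=> mk; have e : m1 = (U_(k) + (m1 - U_(k)))%MM by rewrite addmC submK // lep1mP.
  by exists (m1 - U_(k))%MM => //; rewrite [X in (_ < mdeg X)%N]e mdegD mdeg1.
have degU k (m1 : mono) : (upper_deg (U_(k) + m1) = upper_wt k + upper_deg m1)%N /\
    (lower_deg (U_(k) + m1) = lower_wt k + lower_deg m1)%N.
  have wD (w : index -> bool) : (\sum_j w j * (U_(k) + m1)%MM j = w k + \sum_j w j * m1 j)%N.
    under eq_bigr do rewrite mnmDE mnm1E mulnDr.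
    rewrite big_split /= (bigD1 k) //= eqxx muln1 big1 ?addn0 // => j /negbTE jk.
    by rewrite eq_sym jk muln0.
  by split; exact: wD.
have ex_pos (w : index -> bool) : (\sum_k w k * m k)%N != 0%N ->
    exists k, w k && (m k != 0%N).
  move=> s0; apply/existsP; rewrite -[X in is_true X]negbK; apply: contra s0.
  rewrite negb_exists => /forallP al.
  by rewrite big1 // => k _; have := al k; case: (w k) => //= /negPn/eqP ->.
have [k mk] : exists k, m k != 0%N.
  apply/existsP; rewrite -[X in is_true X]negbK; apply: contra m0.
  rewrite negb_exists => /forallP al; apply/eqP/mnmP => k.
  by rewrite mnm0E; apply/eqP; have := al k; rewrite negbK.
case wk: (upper_wt k || lower_wt k); last first.
  have [m2 em m2d] := split_mono k m mk; have [eu el] := degU k m2.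
  move/norP: (negbT wk) => [wu wl]; rewrite em eu el (negbTE wu) (negbTE wl) in ul.
  apply: (A_ext (f := fun M => coord (val M) k * 'X_[m2].@[coord (val M)])).
    by move=> M _; rewrite em mpolyXD mevalM mevalXU.
  apply: A_mul; last by apply: IHd => //; rewrite -ltnS; apply: leq_trans md.
  move: wu wl; rewrite /upper_wt /lower_wt /coord; case: (enum_val k) => -[a i] j.
  by case: (ord2P i) (ord2P j) => -> [] -> //= _ _; exact: A_diag.
have [kp /andP[wp mkp]] : exists k, upper_wt k && (m k != 0%N).
  apply: ex_pos; case/orP: wk => wk.
    by rewrite -/(upper_deg m) /upper_deg (bigD1 k) //= wk mul1n addn_eq0 (negbTE mk).
  by rewrite -/(upper_deg m) ul /lower_deg (bigD1 k) //= wk mul1n addn_eq0 (negbTE mk).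
have [kl /andP[wl mkl]] : exists k, lower_wt k && (m k != 0%N).
  apply: ex_pos; rewrite -/(lower_deg m) -ul /upper_deg (bigD1 kp) //= wp mul1n.
  by rewrite addn_eq0 (negbTE mkp).
have excl k' : upper_wt k' -> lower_wt k' -> False.
  rewrite /upper_wt /lower_wt; case: (enum_val k') => -[a i] j.
  by case/andP=> /eqP ->.
have [m2 em m2d] := split_mono kp m mkp; have [eu el] := degU kp m2.
have kpl : kp != kl by apply/eqP => e; apply: (excl kp) => //; rewrite e.
have m2kl : m2 kl != 0%N by move: mkl; rewrite em mnmDE mnm1E (negbTE kpl).
have [m3 em3 m3d] := split_mono kl m2 m2kl; have [eu3 el3] := degU kl m3.
have lkp : lower_wt kp = false by apply/negP => /(excl _ wp).
have ukl : upper_wt kl = false by apply/negP => /excl /(_ wl).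
move: ul; rewrite em eu el em3 eu3 el3 wp wl lkp ukl /= !add0n => -[ul3].
apply: (A_ext (f := fun M =>
   coord (val M) kp * coord (val M) kl * 'X_[m3].@[coord (val M)])).
  by move=> M _; rewrite !mpolyXD !mevalM !mevalXU mulrA.
apply: A_mul; last first.
  apply: IHd ul3; rewrite -ltnS; apply: leq_trans md.
  by rewrite ltnS; apply: leq_ltn_trans m2d; exact: ltnW.
move: wp wl; rewrite /upper_wt /lower_wt /coord.
case: (enum_val kp) => -[a i] j; case: (enum_val kl) => -[b i'] j'.
by case/andP=> /eqP -> /eqP ->; case/andP=> /eqP -> /eqP ->; exact: A_pair.
Qed.

(** Induction principle for invariant functions: a property that is stable under the ring
    operations and depends only on the restriction to a slice needs to be checked on the diagonal
    entries and on the products of an upper right by a lower left entry. *)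
Lemma invariant_gen f : inv_regular f -> A f.
Proof.
move=> [[p fp] If]; apply: (A_ext (f := fun M =>
  \sum_(m <- msupp p | upper_deg m == lower_deg m) p@_m * 'X_[m].@[coord (val M)])).
  by move=> M _; rewrite (torus_invariant_wt0 fp If).
elim: (msupp p) => [|m r IHr].
  by apply: (A_ext (f := fun _ => 0)) => // M _; rewrite big_nil.
case: (boolP (upper_deg m == lower_deg m)) => ul; last first.
  by apply: A_ext IHr => M _; rewrite big_cons (negbTE ul).
apply: (A_ext (f := fun M => p@_m * 'X_[m].@[coord (val M)] +
  \sum_(m <- r | upper_deg m == lower_deg m) p@_m * 'X_[m].@[coord (val M)])).
  by move=> M _; rewrite big_cons ul.
by apply: A_add => //; apply: A_mul => //; apply: mono_wt0; apply/eqP.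
Qed.

End TorusInvariants.

(** * Quotients by conjugation and diagonalization *)

Section Quotients.
Variables (F : fieldType) (n : nat) (S : pred (n.-tuple 'M[F]_2)).
Local Notation X := (closed_subvariety S).

Definition conj_descend (f : X -> F) : conj_quotient S -> F := fun x => f (repr x).
Definition git_descend (f : X -> F) : git_quotient S -> F := fun x => f (repr x).

Lemma conj_classP (M N : X) : conj_class M = conj_class N <-> conjugate M N.
Proof. exact: quot_projP. Qed.

Lemma git_classP (M N : X) : git_class M = git_class N <->
  (forall f, inv_regular f -> f M = f N).
Proof.
split=> [/quot_projP MN f [rf If] | MN]; first exact: MN.
by apply/quot_projP => f rf If; apply: MN.
Qed.

Lemma conj_class_repr (x : conj_quotient S) : conj_class (repr x) = x.
Proof. exact: quot_repr. Qed.

Lemma git_class_repr (x : git_quotient S) : git_class (repr x) = x.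
Proof. exact: quot_repr. Qed.

Lemma conj_descendE f (M : X) : inv_regular f -> conj_descend f (conj_class M) = f M.
Proof.
by move=> [_ If]; apply: If; apply/conj_classP; exact: conj_class_repr.
Qed.

Lemma git_descendE f (M : X) : inv_regular f -> git_descend f (git_class M) = f M.
Proof.
by move=> If; have /git_classP := git_class_repr (git_class M); apply.
Qed.

Lemma regular_conj_descend f : inv_regular f -> regular (conj_quotient S) (conj_descend f).
Proof.
move=> If; change (regular X (fun M => conj_descend f (conj_class M))).
rewrite (_ : (fun M => _) = f); first by case: If.
by apply/funext => M; exact: conj_descendE.
Qed.

Lemma regular_git_descend f : inv_regular f -> regular (git_quotient S) (git_descend f).
Proof.
move=> If; change (regular X (fun M => git_descend f (git_class M))).
rewrite (_ : (fun M => _) = f); first by case: If.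
by apply/funext => M; exact: git_descendE.
Qed.

Lemma inv_regular_conj_class f : regular (conj_quotient S) f ->
  inv_regular (fun M : X => f (conj_class M)).
Proof. by move=> rf; split=> // M N /conj_classP ->. Qed.

Lemma inv_regular_git_class f : regular (git_quotient S) f ->
  inv_regular (fun M : X => f (git_class M)).
Proof.
move=> rf; split=> // M N MN; congr f.
by apply/quot_projP; exact: conjugate_git.
Qed.

End Quotients.

Lemma nth_conj_tuple (F : fieldType) n (g : 'M[F]_2) (M : n.-tuple 'M[F]_2) k :
  (conj_tuple g M)`_k = g * M`_k * g^-1.
Proof.
case: (ltnP k n) => kn; first by rewrite (nth_map 0) ?size_tuple.
by rewrite !nth_default ?size_tuple // mulr0 mul0r.
Qed.

Lemma word_nth (F : fieldType) n (S : pred (n.-tuple 'M[F]_2)) k : (k < n)%N ->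
  word (fun M : closed_subvariety S => (val M)`_k).
Proof.
move=> kn; rewrite (_ : (fun M => _) =
  fun M : closed_subvariety S => tnth (val M) (Ordinal kn)); first exact: word_tnth.
by apply/funext => M; rewrite (tnth_nth 0).
Qed.

Section Diagonalization.
Variables (F : fieldType) (q s : F).
Hypotheses (qs : q * s = 1) (q_neq_s : q != s).

(** By the Cayley-Hamilton theorem the rows of C - r' are left eigenvectors for r. *)
Lemma left_eigenvector (r r' : F) (C : 'M[F]_2) : r * r' = 1 -> r != r' ->
  \det C = 1 -> \tr C = r + r' ->
  exists x y, [/\ (x != 0) || (y != 0), x * C 0 0 + y * C 1 0 = r * x
                & x * C 0 1 + y * C 1 1 = r * y].
Proof.
rewrite det_mx2 tr2; set a := C 0 0; set b := C 0 1; set c := C 1 0; set d := C 1 1.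
move=> rr' rNr' dC tC; have ed : d = r + r' - a by rewrite -tC; ring.
have ebc : b * c = a * d - r * r' by rewrite rr' -dC; ring.
case: (boolP ((a - r' != 0) || (b != 0))) => [nz|].
  exists (a - r'), b; split => //; last by rewrite ed; ring.
  by rewrite ebc ed; ring.
rewrite negb_or !negbK => /andP[/eqP ar /eqP b0].
have ear : a = r' by apply/eqP; rewrite -subr_eq0 ar.
exists c, (d - r'); split.
- by rewrite ed ear addrK subr_eq0 rNr' orbT.
- by rewrite ed ear; ring.
- by rewrite b0 ed ear; ring.
Qed.

Definition diag_qs := mx2 q 0 0 s.

(** The rows of g are left eigenvectors for q and s, the first one scaled to make the
    determinant 1. *)
Lemma diagonalize (C : 'M[F]_2) : \det C = 1 -> \tr C = q + s ->
  exists2 g : 'M[F]_2, \det g = 1 & g * C * g^-1 = diag_qs.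
Proof.
move=> dC tC.
have [x [y [xy0 e1 e2]]] := left_eigenvector qs q_neq_s dC tC.
have [z [w [zw0 e3 e4]]] : exists z w, [/\ (z != 0) || (w != 0),
    z * C 0 0 + w * C 1 0 = s * z & z * C 0 1 + w * C 1 1 = s * w].
  by apply: (left_eigenvector (r' := q)) => //; rewrite 1?mulrC 1?eq_sym // addrC.
pose D := x * w - y * z.
have D0 : D != 0.
  apply/eqP => D0; have xw : x * w = y * z by apply/eqP; rewrite -subr_eq0 -/D D0.
  have qs0 k : (q - s) * k = 0 -> k = 0.
    by move/eqP; rewrite mulf_eq0 subr_eq0 (negbTE q_neq_s) /= => /eqP.
  have xz : x * z = 0.
    apply: qs0; rewrite (_ : _ * _ = z * (q * x) - x * (s * z)); last by ring.
    rewrite -e1 -e3 (_ : _ - _ = C 1 0 * (y * z - x * w)); last by ring.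
    by rewrite xw subrr mulr0.
  have yw : y * w = 0.
    apply: qs0; rewrite (_ : _ * _ = w * (q * y) - y * (s * w)); last by ring.
    rewrite -e2 -e4 (_ : _ - _ = C 0 1 * (x * w - y * z)); last by ring.
    by rewrite xw subrr mulr0.
  have xw0 : x * w = 0.
    by apply/eqP; rewrite -sqrf_eq0 expr2 {2}xw [y * z]mulrC mulrACA xz mul0r.
  have yz : y * z = 0 by rewrite -xw.
  move: zw0; case/orP: xy0 => n0.
    move/eqP: xz; rewrite mulf_eq0 (negbTE n0) => /= ->.
    by move/eqP: xw0; rewrite mulf_eq0 (negbTE n0) => /= ->.
  move/eqP: yz; rewrite mulf_eq0 (negbTE n0) => /= ->.
  by move/eqP: yw; rewrite mulf_eq0 (negbTE n0) => /= ->.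
have dg : \det (mx2 (x / D) (y / D) z w) = 1.
  rewrite det_mx2E (_ : _ - _ = (x * w - y * z) / D); first exact: mulfV.
  by rewrite mulrBl mulrAC [y / D * z]mulrAC.
exists (mx2 (x / D) (y / D) z w) => //; apply: (canLR (mulrK (unit2 dg))).
rewrite (mx2_eta C) !mx2M; congr mx2.
- by rewrite mul0r addr0 [RHS]mulrA -e1; ring.
- by rewrite mul0r addr0 [RHS]mulrA -e2; ring.
- by rewrite mul0r add0r -e3.
- by rewrite mul0r add0r -e4.
Qed.

(** The upper left entry of A in a basis where C is [diag_qs], written with traces so that it is
    invariant under simultaneous conjugation. *)
Definition diag_part (C A : 'M[F]_2) : F := (\tr (A * C) - s * \tr A) / (q - s).

Lemma qBs_neq0 : q - s != 0. Proof. by rewrite subr_eq0. Qed.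

Lemma diag_part_slice A : diag_part diag_qs A = A 0 0.
Proof.
rewrite /diag_part {1}(mx2_eta A) mx2M tr_mx2 tr2.
by apply: (canLR (mulfK qBs_neq0)); ring.
Qed.

Lemma inv_regular_diag_part n (S : pred (n.-tuple 'M[F]_2))
    (h h' : closed_subvariety S -> 'M[F]_2) : word h -> word h' ->
  inv_regular (fun M => diag_part (h M) (h' M)).
Proof.
move=> wh wh'; rewrite (_ : (fun M => _) = fun M =>
  (\tr (h' M * h M) + - (s * \tr (h' M))) * (q - s)^-1) //.
apply: inv_regularM; last exact: inv_regular_cst.
apply: inv_regularD; first by apply: inv_regular_tr; exact: wordM.
apply: inv_regularN; apply: inv_regularM; first exact: inv_regular_cst.
exact: inv_regular_tr.
Qed.

End Diagonalization.

(** * The odd coordinates and the fibers of the covering *)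

Section RepresentationFacts.
Variables (F : fieldType) (c : F).
Local Notation XP := (closed_subvariety (is_rep_P1 c)).
Local Notation XC := (closed_subvariety (is_rep_C c)).

Lemma rep_P1I (M0 M1 M2 M3 M4 : 'M[F]_2) :
  [/\ \det M0 = 1, \det M1 = 1, \det M2 = 1, \det M3 = 1 & \det M4 = 1] ->
  M0 * M1 * M2 * M3 * M4 = 1 ->
  [/\ \tr M0 = 0, \tr M1 = 0, \tr M2 = c, \tr M3 = 0 & \tr M4 = 0] ->
  is_rep_P1 c [tuple M0; M1; M2; M3; M4].
Proof.
move=> [d0 d1 d2 d3 d4] r [t0 t1 t2 t3 t4].
by rewrite /is_rep_P1 /= d0 d1 d2 d3 d4 r t0 t1 t2 t3 t4 !eqxx.
Qed.

Lemma rep_CI (A B C1 C2 : 'M[F]_2) :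
  [/\ \det A = 1, \det B = 1, \det C1 = 1 & \det C2 = 1] ->
  A * B = C1 * B * A * C2 -> \tr C1 = c -> \tr C2 = c ->
  is_rep_C c [tuple A; B; C1; C2].
Proof.
by move=> [d0 d1 d2 d3] r t2 t3; rewrite /is_rep_C /= d0 d1 d2 d3 r t2 t3 !eqxx.
Qed.

Lemma rep_P1_det (M : XP) k : (k < 5)%N -> \det (val M)`_k = 1.
Proof.
move=> k5; have /and5P[/allP al _ _ _ _] := valP M.
by apply/eqP/al/mem_nth; rewrite size_tuple.
Qed.

Lemma rep_C_det (N : XC) k : (k < 4)%N -> \det (val N)`_k = 1.
Proof.
move=> k4; have /and4P[/allP al _ _ _] := valP N.
by apply/eqP/al/mem_nth; rewrite size_tuple.
Qed.

Lemma rep_P1_rel (M : XP) :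
  (val M)`_0 * (val M)`_1 * (val M)`_2 * (val M)`_3 * (val M)`_4 = 1.
Proof. by have /and5P[_ /eqP] := valP M. Qed.

Lemma rep_P1_tr (M : XP) : [/\ \tr (val M)`_0 = 0, \tr (val M)`_1 = 0,
  \tr (val M)`_3 = 0, \tr (val M)`_4 = 0 & \tr (val M)`_2 = c].
Proof.
by have /and5P[_ _ /eqP ? /eqP ? /and3P[/eqP ? /eqP ? /eqP ?]] := valP M.
Qed.

Lemma rep_C_rel (N : XC) :
  (val N)`_0 * (val N)`_1 = (val N)`_2 * (val N)`_1 * (val N)`_0 * (val N)`_3.
Proof. by have /and4P[_ /eqP] := valP N. Qed.

Lemma rep_C_tr (N : XC) : \tr (val N)`_2 = c /\ \tr (val N)`_3 = c.
Proof. by have /and4P[_ _ /eqP ? /eqP ?] := valP N. Qed.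

Lemma conj_tuple_det n (M : n.-tuple 'M[F]_2) (g : 'M[F]_2) : \det g = 1 ->
  all (fun A => \det A == 1) M -> all (fun A => \det A == 1) (conj_tuple g M).
Proof.
move=> dg /allP al; apply/allP => A /mapP[B /al dB ->].
by rewrite det_conj2.
Qed.

Lemma rep_P1_conj M (g : 'M[F]_2) : \det g = 1 ->
  is_rep_P1 c M -> is_rep_P1 c (conj_tuple g M).
Proof.
move=> dg /and5P[d r t0 t1 /and3P[t3 t4 t2]].
rewrite /is_rep_P1 conj_tuple_det // !nth_conj_tuple !tr_conj2 //.
rewrite -!conj2M // (eqP r) t0 t1 t3 t4 t2 mulr1 mulrV ?unit2 //.
by rewrite eqxx.
Qed.

Lemma rep_C_conj N (g : 'M[F]_2) : \det g = 1 ->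
  is_rep_C c N -> is_rep_C c (conj_tuple g N).
Proof.
move=> dg /and4P[d r t2 t3].
rewrite /is_rep_C conj_tuple_det // !nth_conj_tuple !tr_conj2 //.
by rewrite -!conj2M // (eqP r) t2 t3 eqxx.
Qed.

End RepresentationFacts.

Section Upstairs.
Variables (F : numClosedFieldType) (q s c : F).
Hypotheses (qs : q * s = 1) (q_neq_s : q != s) (cE : c = q + s).
Local Notation XP := (closed_subvariety (is_rep_P1 c)).
Local Notation XC := (closed_subvariety (is_rep_C c)).
Local Notation diag_part := (diag_part q s).

(** The trace free matrices; M_t is at position 2. *)
Definition branch (k : 'I_4) : nat := nth 0%N [:: 0; 1; 3; 4]%N k.

Lemma branch_lt k : (branch k < 5)%N.
Proof. by case: k => [[|[|[|[|//]]]]]. Qed.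

Lemma ord4P (P : 'I_4 -> Prop) : P (@Ordinal 4 0 isT) -> P (@Ordinal 4 1 isT) ->
  P (@Ordinal 4 2 isT) -> P (@Ordinal 4 3 isT) -> forall k, P k.
Proof.
move=> P0 P1 P2 P3 [[|[|[|[|//]]]] Hk].
- by rewrite (_ : Ordinal Hk = @Ordinal 4 0 isT) //; exact: val_inj.
- by rewrite (_ : Ordinal Hk = @Ordinal 4 1 isT) //; exact: val_inj.
- by rewrite (_ : Ordinal Hk = @Ordinal 4 2 isT) //; exact: val_inj.
- by rewrite (_ : Ordinal Hk = @Ordinal 4 3 isT) //; exact: val_inj.
Qed.

Lemma branch_tr0 (M : XP) k : \tr (val M)`_(branch k) = 0.
Proof. by have [? ? ? ? _] := rep_P1_tr M; elim/ord4P: k. Qed.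

Lemma branch_adj2 (M : XP) k : adj2 (val M)`_(branch k) = - (val M)`_(branch k).
Proof. by rewrite adj2_tr0 ?branch_tr0. Qed.

Lemma branch_sqr (M : XP) k : (val M)`_(branch k) * (val M)`_(branch k) = -1.
Proof. by rewrite sqr_tr0 ?branch_tr0 // rep_P1_det // branch_lt. Qed.

(** The twist by the character of the double cover, which is trivial on C. *)
Definition psi_tuple (M : 5.-tuple 'M[F]_2) : 5.-tuple 'M[F]_2 :=
  [tuple - M`_0; - M`_1; M`_2; - M`_3; - M`_4].

Lemma det2N (A : 'M[F]_2) : \det (- A) = \det A.
Proof. by rewrite (mx2_eta A) mx2N !det_mx2E !mulrNN. Qed.

Lemma psi_tuple_rep M : is_rep_P1 c M -> is_rep_P1 c (psi_tuple M).
Proof.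
move=> rM; pose M' : XP := Sub M rM.
have [t0 t1 t3 t4 t2] := rep_P1_tr M'; have r := rep_P1_rel M'.
apply: rep_P1I; first by rewrite !det2N; split; exact: (rep_P1_det M').
  by rewrite !(mulrN, mulNr) !opprK; exact: r.
have trN (A : 'M[F]_2) : \tr (- A) = - \tr A by exact: raddfN.
by rewrite !trN; split; rewrite ?t0 ?t1 ?t3 ?t4 ?oppr0 //.
Qed.

Definition psi0 (M : XP) : XP := Sub (psi_tuple (val M)) (psi_tuple_rep (valP M)).

Lemma psi0E M k : (val (psi0 M))`_(branch k) = - (val M)`_(branch k).
Proof. by rewrite /psi0 SubK; elim/ord4P: k. Qed.

Lemma psi0_2 M : (val (psi0 M))`_2 = (val M)`_2. Proof. by []. Qed.

Lemma tuple5_eta (T : Type) (x : T) (M : 5.-tuple T) :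
  M = [tuple nth x M 0; nth x M 1; nth x M 2; nth x M 3; nth x M 4].
Proof.
case: M => [[|M0 [|M1 [|M2 [|M3 [|M4 [|//]]]]]] //= szM]; exact: val_inj.
Qed.

Lemma rep_P1_ext (M N : XP) : (val M)`_2 = (val N)`_2 ->
  (forall k, (val M)`_(branch k) = (val N)`_(branch k)) -> M = N.
Proof.
move=> e2 e; apply: val_inj; rewrite (tuple5_eta 0 (val M)) (tuple5_eta 0 (val N)).
have := e (@Ordinal 4 0 isT); have := e (@Ordinal 4 1 isT).
have := e (@Ordinal 4 2 isT); have := e (@Ordinal 4 3 isT).
by rewrite /branch /= => -> -> -> ->; rewrite e2.
Qed.

Lemma psi0K M : psi0 (psi0 M) = M.
Proof. by apply: rep_P1_ext => // k; rewrite !psi0E opprK. Qed.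

Lemma psi0_conj M N : conjugate M N -> conjugate (psi0 M) (psi0 N).
Proof.
move=> [g dg eN]; exists g => //; apply: eq_from_tnth => i.
rewrite tnth_map /= eN !(tnth_nth 0).
by case: i => [[|[|[|[|[|//]]]]] Hi] /=; rewrite !nth_conj_tuple ?mulrN ?mulNr.
Qed.

Lemma phi0_psi0 M : phi0 (psi0 M) = phi0 M.
Proof.
apply: val_inj; rewrite /= /phi_tuple /=; apply: val_inj => /=.
have d4 := rep_P1_det M (isT : (4 < 5)%N).
by rewrite !inv2 ?det2N // !mulrN !mulNr !opprK adj2E adj2E raddfN /= scaleNr
   -opprD mulrN opprK.
Qed.

Definition slice n (S : pred (n.-tuple 'M[F]_2)) (M : closed_subvariety S) : Prop :=
  (val M)`_2 = diag_qs q s.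

Lemma P1_to_slice (M : XP) : exists2 N : XP, conjugate M N & slice N.
Proof.
have [_ _ _ _ t2] := rep_P1_tr M.
have [g dg e] := diagonalize qs q_neq_s (rep_P1_det M (isT : (2 < 5)%N)) (etrans t2 cE).
exists (Sub (conj_tuple g (val M)) (rep_P1_conj dg (valP M))).
  by exists g; rewrite ?SubK.
by rewrite /slice SubK nth_conj_tuple.
Qed.

Lemma C_to_slice (N : XC) : exists2 N' : XC, conjugate N N' & slice N'.
Proof.
have [t2 _] := rep_C_tr N.
have [g dg e] := diagonalize qs q_neq_s (rep_C_det N (isT : (2 < 4)%N)) (etrans t2 cE).
exists (Sub (conj_tuple g (val N)) (rep_C_conj dg (valP N))).
  by exists g; rewrite ?SubK.
by rewrite /slice SubK nth_conj_tuple.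
Qed.

Lemma phi0_slice (M : XP) : slice M -> slice (phi0 M).
Proof. by []. Qed.

Lemma phi0_git (M N : XP) : conjugate M N -> git_class (phi0 M) = git_class (phi0 N).
Proof. by move=> MN; rewrite -!Phi_topE; congr Phi_top; apply/conj_classP. Qed.

(** Odd with respect to [psi0], which fixes M_t and changes the sign of the branch matrices. *)
Definition odd_coord (k : 'I_4) (M : XP) : F :=
  diag_part (val M)`_2 (val M)`_(branch k).

Lemma inv_regular_odd_coord k : inv_regular (odd_coord k).
Proof. by apply: inv_regular_diag_part; apply: word_nth; rewrite ?branch_lt. Qed.

Lemma odd_coord_slice k M : slice M -> odd_coord k M = (val M)`_(branch k) 0 0.
Proof. by move=> sM; rewrite /odd_coord sM diag_part_slice. Qed.

Lemma odd_coord_psi0 k M : odd_coord k (psi0 M) = - odd_coord k M.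
Proof.
rewrite /odd_coord psi0E psi0_2 /diag_part mulNr !raddfN /= mulrN.
by rewrite -opprD mulNr.
Qed.

(** Conjugation by M_oo realizes the elliptic involution; hence each of the four
    matrices is M_oo times a word in the restriction to C, on either side. *)
Definition left_word (k : 'I_4) (N : XC) : 'M[F]_2 :=
  nth 0 [:: - (val N)`_0; (val N)`_0 * (val N)`_1 * adj2 (val N)`_3;
            - (val N)`_1; 1] k.
Definition right_word (k : 'I_4) (N : XC) : 'M[F]_2 :=
  nth 0 [:: - adj2 (val N)`_0; adj2 (val N)`_0 * adj2 (val N)`_1 * adj2 (val N)`_2;
            - adj2 (val N)`_1; 1] k.

Lemma word_left k : word (left_word k).
Proof.
elim/ord4P: k; rewrite /left_word /=.
- by apply: wordN; exact: word_nth.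
- by do ?apply: wordM; try apply: word_adj2; exact: word_nth.
- by apply: wordN; exact: word_nth.
- exact: word1.
Qed.

Lemma word_right k : word (right_word k).
Proof.
elim/ord4P: k; rewrite /right_word /=.
- by apply: wordN; apply: word_adj2; exact: word_nth.
- by do ?apply: wordM; apply: word_adj2; exact: word_nth.
- by apply: wordN; apply: word_adj2; exact: word_nth.
- exact: word1.
Qed.

Section Words.
Variable M : XP.
Local Notation M0 := (val M)`_0.
Local Notation M1 := (val M)`_1.
Local Notation M2 := (val M)`_2.
Local Notation M3 := (val M)`_3.
Local Notation M4 := (val M)`_4.

Let s0 : M0 * M0 = -1. Proof. exact: (branch_sqr M (@Ordinal 4 0 isT)). Qed.
Let s1 : M1 * M1 = -1. Proof. exact: (branch_sqr M (@Ordinal 4 1 isT)). Qed.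
Let s3 : M3 * M3 = -1. Proof. exact: (branch_sqr M (@Ordinal 4 2 isT)). Qed.
Let s4 : M4 * M4 = -1. Proof. exact: (branch_sqr M (@Ordinal 4 3 isT)). Qed.
Let a1 : adj2 M1 = - M1. Proof. exact: (branch_adj2 M (@Ordinal 4 1 isT)). Qed.
Let a3 : adj2 M3 = - M3. Proof. exact: (branch_adj2 M (@Ordinal 4 2 isT)). Qed.
Let a4 : adj2 M4 = - M4. Proof. exact: (branch_adj2 M (@Ordinal 4 3 isT)). Qed.
Let a2 : M2 * adj2 M2 = 1. Proof. by rewrite mul_2adj rep_P1_det // scale1r. Qed.
Let i4 : M4^-1 = - M4. Proof. by rewrite inv2 ?rep_P1_det. Qed.

Let r0 : M1 * M2 * M3 * M4 = - M0.
Proof.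
apply: (mulrI (unit2 (rep_P1_det M (isT : (0 < 5)%N)))).
by rewrite mulrN s0 opprK !mulrA rep_P1_rel.
Qed.

Let r1 : M4 * M3 * adj2 M2 * M1 = - M0.
Proof.
have := congr1 (@adj2 F) r0; rewrite !adj2M a1 a3 a4.
have -> : adj2 (- M0) = M0.
  rewrite adj2_tr0 ?opprK // -(psi0E M (@Ordinal 4 0 isT)).
  exact: (branch_tr0 (psi0 M) (@Ordinal 4 0 isT)).
by move=> <-; rewrite !(mulrN, mulNr) !opprK !mulrA.
Qed.

Let e2 X : X * M2 * adj2 M2 = X. Proof. by rewrite -mulrA a2 mulr1. Qed.
Let e3 X : X * M3 * M3 = - X. Proof. by rewrite -mulrA s3 mulrN1. Qed.
Let e4 X : X * M4 * M4 = - X. Proof. by rewrite -mulrA s4 mulrN1. Qed.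
Let a4n : adj2 (- M4) = M4. Proof. by rewrite -a4 adj2K. Qed.

Lemma branch_left k : (val M)`_(branch k) = left_word k (phi0 M) * M4.
Proof.
elim/ord4P: k; rewrite /left_word /phi0 /phi_tuple /=.
- by rewrite mulNr r0 opprK.
- rewrite i4 !adj2M a4n a4 !(mulrN, mulNr) !mulrA.
  by rewrite !(e2, e3, e4, mulrN, mulNr, opprK).
- by rewrite mulNr e4 opprK.
- by rewrite mul1r.
Qed.

Lemma branch_right k : (val M)`_(branch k) = M4 * right_word k (phi0 M).
Proof.
elim/ord4P: k; rewrite /right_word /phi0 /phi_tuple /=.
- by rewrite !adj2M a1 a3 !(mulrN, mulNr) opprK !mulrA r1 opprK.
- rewrite !adj2M a1 a3 a4 !(mulrN, mulNr) !opprK !mulrA r1 !mulNr.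
  have -> : M0 = - (M1 * M2 * M3 * M4) by rewrite r0 opprK.
  by rewrite !(mulNr, mulrN, e4, e3, opprK) e2.
- by rewrite adj2M a3 a4 !(mulrN, mulNr) opprK !mulrA s4 mulN1r opprK.
- by rewrite mulr1.
Qed.

(** M_oo^2 = -1 eliminates M_oo from the product; in [branch_mul2] the conjugate of M_t by M_oo
    that remains is C_2. *)
Lemma branch_mul k l : (val M)`_(branch k) * (val M)`_(branch l) =
  - (left_word k (phi0 M) * right_word l (phi0 M)).
Proof. by rewrite branch_left branch_right mulrA e4 mulNr. Qed.

Lemma branch_mul2 k l : (val M)`_(branch k) * M2 * (val M)`_(branch l) =
  - (left_word k (phi0 M) * (val (phi0 M))`_3 * right_word l (phi0 M)).
Proof.
by rewrite branch_left branch_right /phi0 SubK /= i4 !(mulrN, mulNr) !mulrA opprK.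
Qed.

(** If the off-diagonal entries vanish on one side, the diagonal of the relation reads m q = 1 and
    m s = 1, where m is the product of the four odd coordinates. *)
Lemma branch_offdiag : slice M ->
  (exists k, (val M)`_(branch k) 0 1 != 0) /\ (exists k, (val M)`_(branch k) 1 0 != 0).
Proof.
move=> sM; have := rep_P1_rel M; rewrite sM.
have t2 (A : 'M[F]_2) : \tr A = 0 -> A 1 1 = - A 0 0.
  by rewrite tr2 addrC => /eqP; rewrite addr_eq0 => /eqP.
have [/t2 t0 /t2 t1 /t2 t3 /t2 t4 _] := rep_P1_tr M => r.
split.
  apply/existsP; apply: contraT; rewrite negb_exists => /forallP nz.
  have z k : (val M)`_(branch k) 0 1 = 0 by apply/eqP; rewrite -[_ == _]negbK.
  have z0 : M0 0 1 = 0 := z (@Ordinal 4 0 isT).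
  have z1 : M1 0 1 = 0 := z (@Ordinal 4 1 isT).
  have z3 : M3 0 1 = 0 := z (@Ordinal 4 2 isT).
  have z4 : M4 0 1 = 0 := z (@Ordinal 4 3 isT).
  move: r; rewrite (mx2_eta M0) (mx2_eta M1) (mx2_eta M3) (mx2_eta M4).
  rewrite t0 t1 t3 t4 z0 z1 z3 z4 /diag_qs !mx2M mx2_1 => /mx2_inj[p _ _ p'].
  by case/eqP: q_neq_s; rewrite -[q in LHS]mulr1 -p' -[s in RHS]mulr1 -p; ring.
  apply/existsP; apply: contraT; rewrite negb_exists => /forallP nz.
  have z k : (val M)`_(branch k) 1 0 = 0 by apply/eqP; rewrite -[_ == _]negbK.
  have z0 : M0 1 0 = 0 := z (@Ordinal 4 0 isT).
  have z1 : M1 1 0 = 0 := z (@Ordinal 4 1 isT).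
  have z3 : M3 1 0 = 0 := z (@Ordinal 4 2 isT).
  have z4 : M4 1 0 = 0 := z (@Ordinal 4 3 isT).
  move: r; rewrite (mx2_eta M0) (mx2_eta M1) (mx2_eta M3) (mx2_eta M4).
  rewrite t0 t1 t3 t4 z0 z1 z3 z4 /diag_qs !mx2M mx2_1 => /mx2_inj[p _ _ p'].
  by case/eqP: q_neq_s; rewrite -[q in LHS]mulr1 -p' -[s in RHS]mulr1 -p; ring.
Qed.
End Words.
End Upstairs.

Section Decomposition.
Variables (F : numClosedFieldType) (q s c : F).
Hypotheses (qs : q * s = 1) (q_neq_s : q != s) (cE : c = q + s).
Local Notation XP := (closed_subvariety (is_rep_P1 c)).
Local Notation XC := (closed_subvariety (is_rep_C c)).
Local Notation diag_part := (diag_part q s).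
Local Notation slice := (slice q s).
Local Notation odd_coord := (odd_coord q s).

(** Matrix entries are not invariant, but on the slice they can agree with functions that come
    from [rep_C]. *)
Definition even (f : XP -> F) : Prop :=
  exists2 h : XC -> F, inv_regular h & forall M, slice M -> f M = h (phi0 M).

Lemma even_cst a : even (fun _ => a).
Proof. by exists (fun _ => a) => //; exact: inv_regular_cst. Qed.

Lemma evenD f g : even f -> even g -> even (fun M => f M + g M).
Proof.
move=> [h rh fh] [k rk gk]; exists (fun N => h N + k N); first exact: inv_regularD.
by move=> M sM; rewrite fh ?gk.
Qed.

Lemma evenM f g : even f -> even g -> even (fun M => f M * g M).
Proof.
move=> [h rh fh] [k rk gk]; exists (fun N => h N * k N); first exact: inv_regularM.
by move=> M sM; rewrite fh ?gk.
Qed.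

Lemma even_sum n (f : 'I_n -> XP -> F) : (forall i, even (f i)) ->
  even (fun M => \sum_i f i M).
Proof.
elim: n f => [|n IHn] f ef.
  rewrite (_ : (fun M => _) = fun _ => 0); first exact: even_cst.
  by apply/funext => M; rewrite big_ord0.
rewrite (_ : (fun M => _) =
   fun M => \sum_(i < n) f (widen_ord (leqnSn n) i) M + f ord_max M).
  by apply: evenD => //; apply: (IHn (fun i => f (widen_ord (leqnSn n) i))).
by apply/funext => M; rewrite big_ord_recr.
Qed.

Lemma even_ext f g : (forall M, slice M -> f M = g M) -> even f -> even g.
Proof. by move=> fg [h rh fh]; exists h => // M sM; rewrite -fg ?fh. Qed.

Lemma even_word (h : XC -> 'M[F]_2) (h' : XP -> 'M[F]_2) : word h ->
  (forall M, h' M = h (phi0 M)) -> even (fun M => h' M 0 0).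
Proof.
move=> wh hh'; exists (fun N : XC => diag_part (val N)`_2 (h N)).
  by apply: inv_regular_diag_part => //; exact: word_nth.
move=> M sM; rewrite (phi0_slice sM : _`_2 = _) diag_part_slice //.
by rewrite hh'.
Qed.

Lemma even_mul k l :
  even (fun M => ((val M)`_(branch k) * (val M)`_(branch l)) 0 0).
Proof.
apply: (even_word (h := fun N : XC => - (left_word k N * right_word l N))).
  by apply: wordN; apply: wordM; [exact: word_left | exact: word_right].
by move=> M; rewrite branch_mul.
Qed.

Lemma even_mul2 k l :
  even (fun M => ((val M)`_(branch k) * (val M)`_2 * (val M)`_(branch l)) 0 0).
Proof.
apply: (even_word (h := fun N : XC => - (left_word k N * (val N)`_3 * right_word l N))).
  apply: wordN; apply: wordM; last exact: word_right.
  by apply: wordM; [exact: word_left | exact: word_nth].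
by move=> M; rewrite branch_mul2.
Qed.

(** On the slice (M_k M_t M_l)_00 - s (M_k M_l)_00 = (q - s) m_k m_l, where m_k is the odd
    coordinate of M_k. *)
Lemma even_odd_coord2 k l : even (fun M => odd_coord k M * odd_coord l M).
Proof.
apply: (even_ext (f := fun M => (q - s)^-1 *
   (((val M)`_(branch k) * (val M)`_2 * (val M)`_(branch l)) 0 0 +
    - s * ((val M)`_(branch k) * (val M)`_(branch l)) 0 0))).
  move=> M sM; rewrite !odd_coord_slice // sM /diag_qs !mul2E !mx2E.
  by rewrite mulrC; apply: (canLR (mulfK (qBs_neq0 q_neq_s))); ring.
apply: evenM; first exact: even_cst.
apply: evenD; first exact: even_mul2.
by apply: evenM; [exact: even_cst | exact: even_mul].
Qed.

Lemma even_offdiag k l :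
  even (fun M => (val M)`_(branch k) 0 1 * (val M)`_(branch l) 1 0).
Proof.
apply: (even_ext (f := fun M =>
   ((val M)`_(branch k) * (val M)`_(branch l)) 0 0 +
    -1 * (odd_coord k M * odd_coord l M))).
  by move=> M sM; rewrite !odd_coord_slice // mul2E; ring.
apply: evenD; first exact: even_mul.
by apply: evenM; [exact: even_cst | exact: even_odd_coord2].
Qed.

Definition decomposable (f : XP -> F) : Prop :=
  exists (fe : XP -> F) (fo : 'I_4 -> XP -> F),
  [/\ even fe, forall k, even (fo k)
    & forall M, slice M -> f M = fe M + \sum_k odd_coord k M * fo k M].

Lemma decomposable_even f : even f -> decomposable f.
Proof.
move=> ef; exists f, (fun _ _ => 0); split=> // [k|M sM]; first exact: even_cst.
by rewrite big1 ?addr0 // => k _; rewrite mulr0.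
Qed.

Lemma decomposable_odd k : decomposable (odd_coord k).
Proof.
exists (fun _ => 0), (fun l _ => (k == l)%:R); split=> [|l|M sM]; try exact: even_cst.
rewrite add0r (bigD1 k) //= eqxx mulr1 big1 ?addr0 // => l /negbTE lk.
by rewrite eq_sym lk mulr0.
Qed.

Lemma decomposableD f g : decomposable f -> decomposable g ->
  decomposable (fun M => f M + g M).
Proof.
move=> [fe [fo [efe efo fE]]] [ge [go [ege ego gE]]].
exists (fun M => fe M + ge M), (fun k M => fo k M + go k M); split.
- exact: evenD.
- by move=> k; exact: evenD.
- move=> M sM; rewrite fE // gE // addrACA -big_split; congr (_ + _).
  by apply: eq_bigr => k _; rewrite mulrDr.
Qed.

Lemma decomposableM f g : decomposable f -> decomposable g ->
  decomposable (fun M => f M * g M).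
Proof.
move=> [fe [fo [efe efo fE]]] [ge [go [ege ego gE]]].
(* the products of two odd coordinates go to the even part *)
exists (fun M => fe M * ge M + \sum_k \sum_l
           odd_coord k M * odd_coord l M * (fo k M * go l M)),
       (fun k M => fe M * go k M + fo k M * ge M); split.
- apply: evenD; first exact: evenM.
  apply: even_sum => k; apply: even_sum => l.
  by apply: evenM; [exact: even_odd_coord2 | exact: evenM].
- by move=> k; apply: evenD; exact: evenM.
- move=> M sM; rewrite fE // gE //.
  have -> : \sum_k odd_coord k M * (fe M * go k M + fo k M * ge M) =
      fe M * (\sum_k odd_coord k M * go k M) + (\sum_k odd_coord k M * fo k M) * ge M.
    rewrite mulr_sumr mulr_suml -big_split; apply: eq_bigr => k _ /=; ring.
  have -> : \sum_k \sum_l odd_coord k M * odd_coord l M * (fo k M * go l M) =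
      (\sum_k odd_coord k M * fo k M) * (\sum_k odd_coord k M * go k M).
    rewrite mulr_suml; apply: eq_bigr => k _; rewrite mulr_sumr.
    by apply: eq_bigr => l _; ring.
  ring.
Qed.

Lemma decomposable_ext f g : (forall M, slice M -> f M = g M) ->
  decomposable f -> decomposable g.
Proof.
move=> fg [fe [fo [efe efo fE]]]; exists fe, fo; split=> // M sM.
by rewrite -fg ?fE.
Qed.

Lemma ord5P (a : 'I_5) : nat_of_ord a = 2%N \/ exists k, nat_of_ord a = branch k.
Proof.
case: a => [[|[|[|[|[|//]]]]] Ha] /=; try by left.
- by right; exists (@Ordinal 4 0 isT).
- by right; exists (@Ordinal 4 1 isT).
- by right; exists (@Ordinal 4 2 isT).
- by right; exists (@Ordinal 4 3 isT).
Qed.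

Lemma branch_11 (M : XP) k : slice M -> (val M)`_(branch k) 1 1 = - odd_coord k M.
Proof.
move=> sM; rewrite odd_coord_slice //; have := branch_tr0 M k.
by rewrite tr2 addrC => /eqP; rewrite addr_eq0 => /eqP.
Qed.

Lemma inv_regular_decomposable f : inv_regular f -> decomposable f.
Proof.
have st (t : F) M : t != 0 -> is_rep_P1 c M -> is_rep_P1 c (conj_tuple (torus_mx t) M).
  by move=> t0; apply: rep_P1_conj; exact: det_torus.
apply: (invariant_gen st (slice := fun M => slice M)).
- by move=> f' g; exact: decomposable_ext.
- by move=> a; apply: decomposable_even; exact: even_cst.
- exact: decomposableD.
- exact: decomposableM.
- move=> a i; case: (ord5P a) => [a2|[k ak]].
    apply: (decomposable_ext (f := fun _ => diag_qs q s i i)).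
      by move=> M sM; rewrite (tnth_nth 0) a2 sM.
    by apply: decomposable_even; exact: even_cst.
  case: (ord2P i) => ->.
    apply: (decomposable_ext (f := odd_coord k)); last exact: decomposable_odd.
    by move=> M sM; rewrite (tnth_nth 0) ak odd_coord_slice.
  apply: (decomposable_ext (f := fun M => -1 * odd_coord k M)).
    by move=> M sM; rewrite (tnth_nth 0) ak branch_11 // mulN1r.
  apply: decomposableM; last exact: decomposable_odd.
  by apply: decomposable_even; exact: even_cst.
- move=> a b; case: (ord5P a) => [a2|[k ak]].
    apply: (decomposable_ext (f := fun _ => 0)).
      by move=> M sM; rewrite !(tnth_nth 0) a2 sM !mx2E mul0r.
    by apply: decomposable_even; exact: even_cst.
  case: (ord5P b) => [b2|[l bl]].
    apply: (decomposable_ext (f := fun _ => 0)).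
      by move=> M sM; rewrite !(tnth_nth 0) b2 sM !mx2E mulr0.
    by apply: decomposable_even; exact: even_cst.
  apply: decomposable_even; apply: even_ext (even_offdiag k l) => M sM.
  by rewrite !(tnth_nth 0) ak bl.
Qed.

(** On the slice the diagonal entries are constants or odd coordinates up to sign, and the products
    of an upper right by a lower left entry are even, as are the products of two odd
    coordinates. *)
Lemma odd_decomposition (f : XP -> F) : inv_regular f ->
  exists (he : XC -> F) (ho : 'I_4 -> XC -> F),
  [/\ inv_regular he, forall k, inv_regular (ho k)
    & forall M, f M = he (phi0 M) + \sum_k odd_coord k M * ho k (phi0 M)].
Proof.
move=> If; have [fe [fo [[he rhe feE] efo fE]]] := inv_regular_decomposable If.
pose ho k := s2val (cid2 (efo k)).
have rho k : inv_regular (ho k) := s2valP (cid2 (efo k)).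
have foE k : forall M, slice M -> fo k M = ho k (phi0 M) := s2valP' (cid2 (efo k)).
exists he, ho; split=> // M; have [N MN sN] := P1_to_slice qs q_neq_s cE M.
have /git_classP e := phi0_git MN.
have [_ If'] := If; rewrite (If' _ _ MN) fE // feE // -e //; congr (_ + _).
apply: eq_bigr => k _; have [_ Im] := inv_regular_odd_coord q s c k.
by rewrite foE // -e // (Im _ _ MN).
Qed.

(** The torus multiplies all upper right entries by a common factor and all lower left entries by
    its inverse. A nonzero entry of each kind determines the factor, and their products with the
    other entries then determine these. *)
Lemma slice_conjugate (M N : XP) : slice M -> slice N ->
  (forall k, odd_coord k M = odd_coord k N) ->
  (forall k l, (val M)`_(branch k) 0 1 * (val M)`_(branch l) 1 0 =
               (val N)`_(branch k) 0 1 * (val N)`_(branch l) 1 0) ->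
  conjugate M N.
Proof.
move=> sM sN em eo; have [[k0 b0] [l0 c0]] := branch_offdiag q_neq_s sM.
have := mulf_neq0 b0 c0; rewrite eo mulf_eq0 negb_or => /andP[b0' c0'].
(* the torus element with parameter t multiplies the upper right entries by t^2 *)
pose T := (val N)`_(branch k0) 0 1 / (val M)`_(branch k0) 0 1.
have T0 : T != 0 by rewrite mulf_neq0 ?invr_eq0.
have t0 : sqrtC T != 0 by rewrite sqrtC_eq0.
exists (torus_mx (sqrtC T)); first exact: det_torus.
have e2 : (val N)`_2 = (conj_tuple (torus_mx (sqrtC T)) (val M))`_2.
  rewrite nth_conj_tuple sM sN torus_conj // /diag_qs !mx2E.
  by rewrite !mulr0.
have eb k : (val N)`_(branch k) = (conj_tuple (torus_mx (sqrtC T)) (val M))`_(branch k).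
  rewrite nth_conj_tuple torus_conj // sqrtCK (mx2_eta (val N)`_(branch k)).
  congr mx2.
  - by rewrite -(odd_coord_slice q_neq_s k sN) -(odd_coord_slice q_neq_s k sM) em.
  - apply: (mulIf c0'); rewrite -eo /T.
    have := eo k0 l0 => e; apply: (mulfI b0).
    rewrite [RHS](_ : _ = (val M)`_(branch k) 0 1 * ((val N)`_(branch k0) 0 1 *
       (val N)`_(branch l0) 1 0)); last by field.
    by rewrite -e; ring.
  - apply: (mulfI b0'); rewrite -eo /T; field.
    by rewrite b0 b0'.
  - by rewrite (branch_11 k sN) (branch_11 k sM) em.
apply: eq_from_tnth => i; rewrite !(tnth_nth 0).
by case: (ord5P i) => [->|[k ->]].
Qed.

Lemma eq_up_to_sign n (x y : 'I_n -> F) :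
  (forall k l, x k * x l = y k * y l) ->
  (forall k, x k = y k) \/ (forall k, x k = - y k).
Proof.
move=> e; case: (pselect (exists k, x k != 0)) => [[k0 xk0]|nx]; last first.
  left=> k; have xk : x k = 0 by apply/eqP; apply: contraT => xk; case: nx; exists k.
  by have /esym/eqP := e k k; rewrite xk mul0r mulf_eq0 orbb => /eqP.
have /eqP := e k0 k0; rewrite -!expr2 eqf_sqr => /orP[]/eqP e0.
  by left=> k; apply: (mulfI xk0); rewrite e e0.
by right=> k; apply: (mulfI xk0); rewrite e e0 mulrNN.
Qed.

Lemma even_eq (f : XP -> F) (M N : XP) : even f -> slice M -> slice N ->
  git_class (phi0 M) = git_class (phi0 N) -> f M = f N.
Proof. by move=> [h rh fh] sM sN /git_classP e; rewrite !fh // e. Qed.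

(** The even functions include the products m_k m_l, which determine the odd coordinates up to a
    common sign; [psi0] realizes the change of sign. *)
Lemma phi0_fiber (M N : XP) : git_class (phi0 M) = git_class (phi0 N) ->
  conjugate M N \/ conjugate (psi0 M) N.
Proof.
have [M' MM' sM] := P1_to_slice qs q_neq_s cE M.
have [N' NN' sN] := P1_to_slice qs q_neq_s cE N.
rewrite (phi0_git MM') (phi0_git NN') => e.
have : forall k l, odd_coord k M' * odd_coord l M' = odd_coord k N' * odd_coord l N'.
  by move=> k l; apply: (even_eq (even_odd_coord2 k l)).
have eo k l := even_eq (even_offdiag k l) sM sN e.
case/eq_up_to_sign => em; [left | right].
  apply: conjugate_trans MM' _; apply: conjugate_trans (conjugate_sym NN').
  exact: slice_conjugate.
apply: conjugate_trans (psi0_conj MM') _; apply: conjugate_trans (conjugate_sym NN').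
apply: slice_conjugate => //; first by move=> k; rewrite odd_coord_psi0 em opprK.
by move=> k l; rewrite !psi0E -eo !mxE mulrNN.
Qed.

Lemma psi0_fixed (M : XP) :
  conjugate (psi0 M) M <-> forall k, odd_coord k M = 0.
Proof.
split=> [e k|m0].
  have [_ Im] := inv_regular_odd_coord q s c k.
  have := Im _ _ e; rewrite odd_coord_psi0 => /eqP.
  by rewrite eq_sym -addr_eq0 -mulr2n mulrn_eq0 => /eqP.
have [N MN sN] := P1_to_slice qs q_neq_s cE M.
have n0 k : odd_coord k N = 0.
  by have [_ Im] := inv_regular_odd_coord q s c k; rewrite -(Im _ _ MN).
apply: conjugate_trans (psi0_conj MN) _; apply: conjugate_trans (conjugate_sym MN).
apply: slice_conjugate => //; first by move=> k; rewrite odd_coord_psi0 n0 oppr0.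
by move=> k l; rewrite !psi0E !mxE mulrNN.
Qed.

End Decomposition.

(** * The chart in the affine space of dimension 6 *)

(** The trace condition on C_2 in the coordinates of the chart: it says that
    s K_00 + q K_11 = q + s for the commutator K = A B A^-1 B^-1. *)
Definition chart_eq (R : comNzRingType) (q s a1 a2 b1 b2 u v : R) : R :=
  let al := a1 * a2 - 1 in let be := b1 * b2 - 1 in
  s * ((a1 * b1 + u) * (a2 * b2 + u) -
       (a1 * a1 * be + a1 * b2 * v + a1 * b2 * u + b2 * b2 * al)) +
  q * ((a1 * b1 + v) * (a2 * b2 + v) -
       (b1 * b1 * al + a2 * b1 * v + a2 * b1 * u + a2 * a2 * be)) - (q + s).

Section Downstairs.
Variables (F : numClosedFieldType) (q s c : F).
Hypotheses (qs : q * s = 1) (q_neq_s : q != s) (cE : c = q + s).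
Local Notation XP := (closed_subvariety (is_rep_P1 c)).
Local Notation XC := (closed_subvariety (is_rep_C c)).
Local Notation diag_part := (diag_part q s).
Local Notation slice := (slice q s).

(** On the slice: the diagonal entries of A and B, A_01 B_10 and B_01 A_10 ([chart_slice]). *)
Definition chart (N : XC) (i : 'I_6) : F :=
  let A := (val N)`_0 in let B := (val N)`_1 in let d := diag_part (val N)`_2 in
  nth 0 [:: d A; \tr A - d A; d B; \tr B - d B;
            d (A * B) - d A * d B; d (B * A) - d A * d B] i.

Lemma ord6P (P : 'I_6 -> Prop) :
  P (@Ordinal 6 0 isT) -> P (@Ordinal 6 1 isT) -> P (@Ordinal 6 2 isT) ->
  P (@Ordinal 6 3 isT) -> P (@Ordinal 6 4 isT) -> P (@Ordinal 6 5 isT) ->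
  forall k, P k.
Proof.
move=> P0 P1 P2 P3 P4 P5 [[|[|[|[|[|[|//]]]]]] Hk].
- by rewrite (_ : Ordinal Hk = @Ordinal 6 0 isT) //; exact: val_inj.
- by rewrite (_ : Ordinal Hk = @Ordinal 6 1 isT) //; exact: val_inj.
- by rewrite (_ : Ordinal Hk = @Ordinal 6 2 isT) //; exact: val_inj.
- by rewrite (_ : Ordinal Hk = @Ordinal 6 3 isT) //; exact: val_inj.
- by rewrite (_ : Ordinal Hk = @Ordinal 6 4 isT) //; exact: val_inj.
- by rewrite (_ : Ordinal Hk = @Ordinal 6 5 isT) //; exact: val_inj.
Qed.

Lemma inv_regular_chart i : inv_regular (fun N => chart N i).
Proof.
have w0 : word (fun N : XC => (val N)`_0) by exact: word_nth.
have w1 : word (fun N : XC => (val N)`_1) by exact: word_nth.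
have dw h : word h -> inv_regular (fun N : XC => diag_part (val N)`_2 (h N)).
  by move=> wh; apply: inv_regular_diag_part => //; exact: word_nth.
elim/ord6P: i; rewrite /chart /=; try exact: dw.
- by apply: inv_regularD; [exact: inv_regular_tr | apply: inv_regularN; exact: dw].
- by apply: inv_regularD; [exact: inv_regular_tr | apply: inv_regularN; exact: dw].
- apply: inv_regularD; first exact: (dw _ (wordM w0 w1)).
  by apply: inv_regularN; apply: inv_regularM; exact: dw.
- apply: inv_regularD; first exact: (dw _ (wordM w1 w0)).
  by apply: inv_regularN; apply: inv_regularM; exact: dw.
Qed.

Definition point6 (a1 a2 b1 b2 u v : F) (i : 'I_6) : F :=
  nth 0 [:: a1; a2; b1; b2; u; v] i.

Lemma chart_slice N : slice N ->
  let A := (val N)`_0 in let B := (val N)`_1 in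
  chart N = point6 (A 0 0) (A 1 1) (B 0 0) (B 1 1) (A 0 1 * B 1 0) (B 0 1 * A 1 0).
Proof.
move=> sN A B; apply/funext; elim/ord6P; rewrite /chart /point6 sN /= -/A -/B.
- by rewrite diag_part_slice.
- by rewrite diag_part_slice // tr2; ring.
- by rewrite diag_part_slice.
- by rewrite diag_part_slice // tr2; ring.
- by rewrite !diag_part_slice // mul2E; ring.
- by rewrite !diag_part_slice // mul2E; ring.
Qed.

Lemma det_slice (A : 'M[F]_2) : \det A = 1 -> A 0 1 * A 1 0 = A 0 0 * A 1 1 - 1.
Proof. by rewrite det_mx2 => <-; ring. Qed.

Definition polynomial (f : XC -> F) : Prop :=
  exists p : {mpoly F[6]}, forall N, slice N -> f N = p.@[chart N].

Lemma polynomial_cst a : polynomial (fun _ => a).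
Proof. by exists a%:MP => N _; rewrite mevalC. Qed.

Lemma polynomialD f g : polynomial f -> polynomial g ->
  polynomial (fun N => f N + g N).
Proof.
by move=> [p fp] [r gr]; exists (p + r) => N sN; rewrite mevalD fp ?gr.
Qed.

Lemma polynomialM f g : polynomial f -> polynomial g ->
  polynomial (fun N => f N * g N).
Proof.
by move=> [p fp] [r gr]; exists (p * r) => N sN; rewrite mevalM fp ?gr.
Qed.

Lemma polynomialN f : polynomial f -> polynomial (fun N => - f N).
Proof. by move=> [p fp]; exists (- p) => N sN; rewrite mevalN fp. Qed.

Lemma polynomial_ext f g : (forall N, slice N -> f N = g N) ->
  polynomial f -> polynomial g.
Proof. by move=> fg [p fp]; exists p => N sN; rewrite -fg ?fp. Qed.

Lemma polynomial_entry k i j : (k < 2)%N -> i = j ->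
  polynomial (fun N => (val N)`_k i j).
Proof.
move=> k2 <-; case: k k2 => [|[|//]] _; case: (ord2P i) => ->.
- by exists 'X_(@Ordinal 6 0 isT) => N sN; rewrite mevalXU chart_slice.
- by exists 'X_(@Ordinal 6 1 isT) => N sN; rewrite mevalXU chart_slice.
- by exists 'X_(@Ordinal 6 2 isT) => N sN; rewrite mevalXU chart_slice.
- by exists 'X_(@Ordinal 6 3 isT) => N sN; rewrite mevalXU chart_slice.
Qed.

Lemma polynomial_pair k l : (k < 2)%N -> (l < 2)%N ->
  polynomial (fun N => (val N)`_k 0 1 * (val N)`_l 1 0).
Proof.
have same (m : nat) : (m < 2)%N ->
    polynomial (fun N => (val N)`_m 0 1 * (val N)`_m 1 0).
  move=> m2; apply: (polynomial_ext (f := fun N =>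
    (val N)`_m 0 0 * (val N)`_m 1 1 + -1)).
    by move=> N sN; rewrite det_slice // rep_C_det //; apply: ltn_trans m2 _.
  apply: polynomialD; last exact: polynomial_cst.
  by apply: polynomialM; exact: polynomial_entry.
case: k => [|[|//]] _; case: l => [|[|//]] _; try exact: same.
- by exists 'X_(@Ordinal 6 4 isT) => N sN; rewrite mevalXU chart_slice.
- by exists 'X_(@Ordinal 6 5 isT) => N sN; rewrite mevalXU chart_slice.
Qed.

(** Matrices whose off-diagonal entries are linear in those of A and B. They are closed under
    products since a product of an upper right by a lower left entry is a polynomial in the
    chart; the relation writes C_2 as such a product. *)
Definition graded (h : XC -> 'M[F]_2) : Prop :=
  exists x y : 'I_2 -> XC -> F,
  [/\ polynomial (fun N => h N 0 0), polynomial (fun N => h N 1 1),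
      (forall i, polynomial (x i)), (forall i, polynomial (y i))
    & forall N, slice N ->
      h N 0 1 = x 0 N * (val N)`_0 0 1 + x 1 N * (val N)`_1 0 1 /\
      h N 1 0 = y 0 N * (val N)`_0 1 0 + y 1 N * (val N)`_1 1 0].

Lemma graded_pair h h' : graded h -> graded h' ->
  polynomial (fun N => h N 0 1 * h' N 1 0).
Proof.
move=> [x [y [_ _ px _ hx]]] [x' [y' [_ _ _ py' hy]]].
apply: (polynomial_ext (f := fun N =>
  (x 0 N * y' 0 N) * ((val N)`_0 0 1 * (val N)`_0 1 0) +
  (x 0 N * y' 1 N) * ((val N)`_0 0 1 * (val N)`_1 1 0) +
  (x 1 N * y' 0 N) * ((val N)`_1 0 1 * (val N)`_0 1 0) +
  (x 1 N * y' 1 N) * ((val N)`_1 0 1 * (val N)`_1 1 0))).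
  by move=> N sN; have [-> _] := hx N sN; have [_ ->] := hy N sN; ring.
by do 3?apply: polynomialD; apply: polynomialM;
  (exact: polynomial_pair || exact: polynomialM).
Qed.

Lemma gradedM h h' : graded h -> graded h' -> graded (fun N => h N * h' N).
Proof.
move=> gh gh'; have p := graded_pair gh gh'; have p' := graded_pair gh' gh.
case: gh => x [y [p0 p1 px py hxy]]; case: gh' => x' [y' [p0' p1' px' py' hxy']].
exists (fun i N => h N 0 0 * x' i N + x i N * h' N 1 1),
       (fun i N => y i N * h' N 0 0 + h N 1 1 * y' i N); split.
- apply: (polynomial_ext (f := fun N => h N 0 0 * h' N 0 0 + h N 0 1 * h' N 1 0)).
    by move=> N _; rewrite mul2E.
  by apply: polynomialD => //; exact: polynomialM.
- apply: (polynomial_ext (f := fun N => h' N 0 1 * h N 1 0 + h N 1 1 * h' N 1 1)).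
    by move=> N _; rewrite mul2E; ring.
  by apply: polynomialD => //; exact: polynomialM.
- by move=> i; apply: polynomialD; exact: polynomialM.
- by move=> i; apply: polynomialD; exact: polynomialM.
- move=> N sN; have [e1 e2] := hxy N sN; have [e3 e4] := hxy' N sN.
  by rewrite !mul2E e1 e2 e3 e4; split; ring.
Qed.

Lemma graded_adj2 h : graded h -> graded (fun N => adj2 (h N)).
Proof.
move=> [x [y [p0 p1 px py hxy]]].
exists (fun i N => - x i N), (fun i N => - y i N); split.
- by apply: polynomial_ext p1 => N _; rewrite mx2E.
- by apply: polynomial_ext p0 => N _; rewrite mx2E.
- by move=> i; exact: polynomialN.
- by move=> i; exact: polynomialN.
- move=> N sN; have [e1 e2] := hxy N sN.
  by rewrite !mx2E e1 e2; split; ring.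
Qed.

Lemma rep_C_last (N : XC) : (val N)`_3 =
  adj2 ((val N)`_2 * (val N)`_1 * (val N)`_0) * ((val N)`_0 * (val N)`_1).
Proof.
by rewrite rep_C_rel mulrA mul_adj2 !det2M !rep_C_det // !mul1r scale1r mul1r.
Qed.

Lemma graded_nth k : (k < 4)%N -> graded (fun N => (val N)`_k).
Proof.
have gAB m : (m < 2)%N -> graded (fun N => (val N)`_m).
  move=> m2; exists (fun i _ => (m == i :> nat)%:R), (fun i _ => (m == i :> nat)%:R).
  split; try (by move=> i; exact: polynomial_cst); try exact: polynomial_entry.
  move=> N _; case: m m2 => [|[|//]] _ /=;
  by rewrite !(mul1r, mul0r, addr0, add0r).
have g2 : graded (fun N => (val N)`_2).
  exists (fun _ _ => 0), (fun _ _ => 0).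
  split; try (by move=> i; exact: polynomial_cst).
  - by apply: (polynomial_ext (f := fun _ => q)) => [N sN|]; [rewrite sN mx2E | exact: polynomial_cst].
  - by apply: (polynomial_ext (f := fun _ => s)) => [N sN|]; [rewrite sN mx2E | exact: polynomial_cst].
  - by move=> N sN; rewrite sN !mx2E !mul0r addr0.
case: k => [|[|[|[|//]]]] _; [exact: gAB|exact: gAB|exact: g2|].
rewrite (_ : (fun N => _) = fun N : XC =>
  adj2 ((val N)`_2 * (val N)`_1 * (val N)`_0) * ((val N)`_0 * (val N)`_1)).
  apply: gradedM; last by apply: gradedM; exact: gAB.
  apply: graded_adj2; apply: gradedM; last exact: gAB.
  by apply: gradedM; [exact: g2 | exact: gAB].
by apply/funext => N; exact: rep_C_last.
Qed.

(** All matrices of the representation being graded, their diagonal entries and the products of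
    an upper right by a lower left entry are polynomials in the chart. *)
Lemma chart_generates f : inv_regular f ->
  exists p : {mpoly F[6]}, forall N, f N = p.@[chart N].
Proof.
move=> If; suff [p fp] : polynomial f.
  exists p => N; have [N' NN' sN'] := C_to_slice qs q_neq_s cE N.
  have [_ If'] := If; rewrite (If' _ _ NN') fp //; apply: meval_eq => i.
  by have [_ Ic] := inv_regular_chart i; rewrite (Ic _ _ NN').
have st (t : F) N : t != 0 -> is_rep_C c N -> is_rep_C c (conj_tuple (torus_mx t) N).
  by move=> t0; apply: rep_C_conj; exact: det_torus.
apply: (invariant_gen st (slice := fun N => slice N)) If.
- by move=> f' g; exact: polynomial_ext.
- exact: polynomial_cst.
- exact: polynomialD.
- exact: polynomialM.
- move=> a i; have [x [y [p0 p1 _ _ _]]] := graded_nth (ltn_ord a).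
  case: (ord2P i) => ->.
    by apply: polynomial_ext p0 => N _; rewrite (tnth_nth 0).
  by apply: polynomial_ext p1 => N _; rewrite (tnth_nth 0).
- move=> a b; apply: polynomial_ext (graded_pair (graded_nth (ltn_ord a)) (graded_nth (ltn_ord b))).
  by move=> N _; rewrite !(tnth_nth 0).
Qed.

Lemma chart_git (N N' : XC) : git_class N = git_class N' <-> chart N = chart N'.
Proof.
split=> [/git_classP e | e].
  by apply/funext => i; exact: e (inv_regular_chart i).
by apply/git_classP => f /chart_generates[p fp]; rewrite !fp e.
Qed.

Lemma chart_eqE (A B : 'M[F]_2) : \det A = 1 -> \det B = 1 ->
  chart_eq q s (A 0 0) (A 1 1) (B 0 0) (B 1 1) (A 0 1 * B 1 0) (B 0 1 * A 1 0) =
  \tr (adj2 (diag_qs q s * B * A) * (A * B)) - (q + s).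
Proof.
move=> dA dB; have hA := det_slice dA; have hB := det_slice dB.
rewrite tr2 !mul2E /adj2 !mx2E !mul2E /diag_qs !mx2E /chart_eq.
by ring: hA hB.
Qed.

Lemma chart_point (N : XC) : exists a1 a2 b1 b2 u v,
  [/\ chart N = point6 a1 a2 b1 b2 u v,
      u * v = (a1 * a2 - 1) * (b1 * b2 - 1) & chart_eq q s a1 a2 b1 b2 u v = 0].
Proof.
have [N' NN' sN] := C_to_slice qs q_neq_s cE N.
have dA := rep_C_det N' (isT : (0 < 4)%N); have dB := rep_C_det N' (isT : (1 < 4)%N).
have e : chart N = chart N'.
  by apply/chart_git/quot_projP; exact: conjugate_git.
rewrite e chart_slice //; do 6![eexists]; split; first by [].
  by rewrite -!det_slice //; ring.
rewrite chart_eqE // -sN -rep_C_last -cE; have [_ ->] := rep_C_tr N'.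
by rewrite subrr.
Qed.

(** The matrix with rows (al, u) and (v, be) has determinant 0, so it is a column times a row. *)
Lemma rank1_mx2 (al be u v : F) : u * v = al * be ->
  exists x y z w, [/\ x * y = al, z * w = be, x * w = u & z * y = v].
Proof.
move=> uv; case: (eqVneq al 0) => [a0|a0]; last first.
  exists al, 1, v, (u / al); rewrite !mulr1; split=> //; last by field.
  by rewrite mulrA [v * u]mulrC uv mulrAC mulfV ?mul1r.
case: (eqVneq be 0) => [b0|b0]; last first.
  exists u, (v / be), be, 1; rewrite !mulr1; split=> //; last by field.
  by rewrite mulrA uv a0 !mul0r.
move/eqP: uv; rewrite a0 mul0r mulf_eq0 => /orP[]/eqP uv0; rewrite b0 uv0.
  by exists 0, 1, v, 0; rewrite !mul0r !mulr0 mulr1.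
by exists u, 0, 0, 1; rewrite !mul0r !mulr0 mulr1.
Qed.

Lemma chart_surj (a1 a2 b1 b2 u v : F) :
  u * v = (a1 * a2 - 1) * (b1 * b2 - 1) -> chart_eq q s a1 a2 b1 b2 u v = 0 ->
  exists N : XC, [/\ slice N, chart N = point6 a1 a2 b1 b2 u v,
    (val N)`_0 0 0 = a1 /\ (val N)`_0 1 1 = a2 & (val N)`_1 0 0 = b1 /\ (val N)`_1 1 1 = b2].
Proof.
move=> /rank1_mx2[x [y [z [w [exy ezw exw ezy]]]]] E0.
pose A := mx2 a1 x y a2; pose B := mx2 b1 z w b2; pose C1 := diag_qs q s.
have dA : \det A = 1 by rewrite det_mx2E exy; ring.
have dB : \det B = 1 by rewrite det_mx2E ezw; ring.
have dC : \det C1 = 1 by rewrite det_mx2E qs; ring.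
have tC1 : \tr C1 = c by rewrite tr_mx2 cE.
have rN : is_rep_C c [tuple A; B; C1; adj2 (C1 * B * A) * (A * B)].
  apply: rep_CI => //.
  - by rewrite det2M det_adj2 !det2M dA dB dC !mulr1.
  - by rewrite mulrA mul_2adj !det2M dA dB dC !mulr1 scale1r mul1r.
  - rewrite cE; apply/eqP; rewrite -subr_eq0 -chart_eqE // !mx2E exw ezy.
    by rewrite E0.
pose N : XC := Sub _ rN; have sN : slice N by [].
exists N; split=> //.
- by rewrite chart_slice // /N SubK /= !mx2E exw ezy.
- by rewrite /N SubK /= !mx2E.
- by rewrite /N SubK /= !mx2E.
Qed.

(** A trace free X of determinant 1 orthogonal to 1, A, B and C_1 B A for the trace
    form inverts A and B and exchanges the two punctures: it is the value of M_oo. *)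
Lemma phi0_lift (N : XC) (X : 'M[F]_2) :
  let A := (val N)`_0 in let B := (val N)`_1 in let C1 := (val N)`_2 in
  \det X = 1 -> \tr X = 0 -> \tr (A * X) = 0 -> \tr (B * X) = 0 ->
  \tr (C1 * B * A * X) = 0 -> exists2 M : XP, phi0 M = N & (val M)`_4 = X.
Proof.
move=> A B C1 dX tX tA tB tY.
have dA : \det A = 1 by exact: rep_C_det.
have dB : \det B = 1 by exact: rep_C_det.
have dC : \det C1 = 1 by exact: rep_C_det.
have aX : adj2 X = - X by exact: adj2_tr0.
have swap (Z : 'M[F]_2) : \tr (Z * X) = 0 -> X * adj2 Z = Z * X.
  by move=> /adj2_tr0; rewrite adj2M aX mulNr => /oppr_inj.
have XX (Z : 'M[F]_2) : Z * X * X = - Z.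
  by rewrite -mulrA sqr_tr0 // mulrN1.
have ZXZ (Z : 'M[F]_2) : \det Z = 1 -> \tr (Z * X) = 0 -> Z * X * Z = X.
  by move=> dZ tZ; rewrite -swap // -mulrA mul_adj2 dZ scale1r mulr1.
have AXA := ZXZ _ dA tA.
have BXB (Z : 'M[F]_2) : Z * B * X * B = Z * X by rewrite -!mulrA (mulrA B) ZXZ.
have CC (Z : 'M[F]_2) : Z * adj2 C1 * C1 = Z.
  by rewrite -mulrA mul_adj2 dC scale1r mulr1.
have YX : C1 * B * A * X = A * B * X * adj2 C1.
  by rewrite -swap // !adj2M !mulrA swap // -(mulrA A X) swap // !mulrA.
have detN (Z : 'M[F]_2) : \det (- Z) = \det Z by exact: det2N.
have iX : X^-1 = - X by rewrite inv2.
have rM : is_rep_P1 c [tuple - (A * X); A * B * X * adj2 C1; C1; - (B * X); X].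
  apply: rep_P1I.
  - by rewrite !detN !det2M det_adj2 dA dB dC dX !mulr1.
  - rewrite !(mulrN, mulNr) opprK !mulrA CC BXB AXA XX sqr_tr0 //.
    by rewrite opprK.
  - have [tC1 _] := rep_C_tr N; split=> //; first by rewrite raddfN /= tA oppr0.
      by rewrite -YX.
    by rewrite raddfN /= tB oppr0.
have eC2 : - (X * C1 * X) = (val N)`_3.
  have uY : C1 * B * A \is a GRing.unit by rewrite unit2 // !det2M dA dB dC !mulr1.
  apply: (mulrI uY); rewrite -rep_C_rel mulrN -/A -/B 2!mulrA YX CC.
  by rewrite XX opprK.
exists (Sub _ rM); last by rewrite SubK.
apply: val_inj; rewrite /phi0 !SubK /phi_tuple /=.
have -> : A * B * X * adj2 C1 * C1 * - (B * X) = A.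
  by rewrite CC mulrN !mulrA BXB XX opprK.
have -> : - (B * X) * X = B by rewrite mulNr XX opprK.
rewrite iX mulrN eC2; apply: val_inj; rewrite /= /A /B /C1.
by change (sval N) with (val N); case: (val N) => [[|A' [|B' [|C1' [|C2' [|//]]]]] szN].
Qed.

End Downstairs.

(** * Surjectivity *)

Section LinearAlgebra.
Variable F : fieldType.

Local Notation o0 := (@Ordinal 3 0 isT).
Local Notation o1 := (@Ordinal 3 1 isT).
Local Notation o2 := (@Ordinal 3 2 isT).

Lemma sum_ord3 (f : 'I_3 -> F) : \sum_i f i = f o0 + f o1 + f o2.
Proof.
rewrite !big_ord_recl big_ord0 addr0 addrA.
by congr (_ + _ + _); congr (f _); apply: val_inj.
Qed.

Lemma det_mx3 (A : 'M[F]_3) : \det A =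
  A o0 o0 * (A o1 o1 * A o2 o2 - A o1 o2 * A o2 o1) -
  A o0 o1 * (A o1 o0 * A o2 o2 - A o1 o2 * A o2 o0) +
  A o0 o2 * (A o1 o0 * A o2 o1 - A o1 o1 * A o2 o0).
Proof.
rewrite (expand_det_row A o0) sum_ord3 /cofactor !det_mx2 !mxE /=.
rewrite !(expr0, expr1, expr2, addn0, add0n, mulrNN, mulr1, mul1r, mulN1r, mulrN).
have e (i k : 'I_3) (j : 'I_2) : lift i j = k :> nat -> lift i j = k by exact: val_inj.
by rewrite (e o0 o1 0) // (e o0 o2 1) // (e o1 o0 0) // (e o1 o2 1) //
  (e o2 o0 0) // (e o2 o1 1).
Qed.

(** The hypothesis says that the trace free parts of A, B, C are linearly dependent: it is the
    vanishing of the determinant of the linear system for x, y, z. *)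
Lemma orthogonal_tr0 (A B C : 'M[F]_2) :
  (A 0 0 - A 1 1) * (B 1 0 * C 0 1 - C 1 0 * B 0 1) -
  (B 0 0 - B 1 1) * (A 1 0 * C 0 1 - C 1 0 * A 0 1) +
  (C 0 0 - C 1 1) * (A 1 0 * B 0 1 - B 1 0 * A 0 1) = 0 ->
  exists x y z, [/\ (x, y, z) != 0, \tr (A * mx2 x y z (- x)) = 0,
    \tr (B * mx2 x y z (- x)) = 0 & \tr (C * mx2 x y z (- x)) = 0].
Proof.
pose M (j : 'I_3) := nth 0 [:: A; B; C] j.
pose K : 'M[F]_3 := \matrix_(i, j)
  nth 0 [:: M j 0 0 - M j 1 1; M j 1 0; M j 0 1] i.
move=> d0; have /det0P[v v0 vK] : \det K == 0.
  apply/eqP; rewrite -d0 det_mx3 !mxE /=; ring.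
have tr0 j : \tr (M j * mx2 (v 0 o0) (v 0 o1) (v 0 o2) (- v 0 o0)) = 0.
  have /matrixP/(_ 0 j) := vK; rewrite mxE sum_ord3 !mxE /= => e.
  by rewrite tr2 !mul2E !mx2E -e; ring.
exists (v 0 o0), (v 0 o1), (v 0 o2); split; try exact: (tr0 o0); try exact: (tr0 o1);
  try exact: (tr0 o2).
apply: contra v0 => /eqP[e0 e1 e2]; apply/eqP/matrixP => i j; rewrite ord1 mxE.
by case: j => [[|[|[|//]]] Hj]; [rewrite -e0 | rewrite -e1 | rewrite -e2];
  congr (v 0 _); apply: val_inj.
Qed.

(** X A X = \tr (A X) X = 0 for X of rank 1, and the kernel of a nilpotent X is its image: A maps
    the image of X to itself. *)
Lemma nilpotent_eigen (A : 'M[F]_2) (x y z : F) : x * x + y * z = 0 ->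
  (x, y, z) != 0 -> \tr (A * mx2 x y z (- x)) = 0 ->
  exists k, A * mx2 x y z (- x) = k *: mx2 x y z (- x).
Proof.
move=> nil nz; rewrite (mx2_eta A).
move: (A 0 0) (A 0 1) (A 1 0) (A 1 1) => a b c d; rewrite !mx2M tr_mx2 => t0.
have ezy : y * z = - (x * x) by apply/eqP; rewrite -addr_eq0 addrC nil.
case: (eqVneq y 0) => [y0|y0].
  have x0 : x = 0 by move/eqP: ezy; rewrite y0 mul0r eq_sym oppr_eq0 mulf_eq0 orbb => /eqP.
  have z0 : z != 0 by apply: contra nz => /eqP ->; rewrite x0 y0.
  have b0 : b = 0.
    by apply: (mulIf z0); rewrite mul0r -t0 x0 y0; ring.
  by exists d; rewrite mx2Z x0 y0 b0; congr mx2; ring.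
exists ((a * y - b * x) / y); rewrite mx2Z; congr mx2; apply: (mulfI y0).
- rewrite [RHS](_ : _ = (a * y - b * x) * x); last by field.
  rewrite [RHS](_ : _ = y * (a * x) + b * - (x * x)); last by ring.
  by rewrite -ezy; ring.
- by rewrite [RHS](_ : _ = (a * y - b * x) * y); [ring | field].
- rewrite [RHS](_ : _ = (a * y - b * x) * z); last by field.
  apply/eqP; rewrite -subr_eq0; apply/eqP.
  rewrite (_ : _ - _ = x * (a * x + b * z + (c * y + d * - x)) +
      (d - a) * (y * z + x * x)); last by ring.
  by rewrite t0 [y * z + _]addrC nil !mulr0 addr0.
- rewrite [RHS](_ : _ = - ((a * y - b * x) * x)); last by field.
  apply/eqP; rewrite -subr_eq0; apply/eqP.
  rewrite (_ : _ - _ = y * (a * x + b * z + (c * y + d * - x)) -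
      b * (y * z + x * x)); last by ring.
  by rewrite t0 [y * z + _]addrC nil !mulr0 subr0.
Qed.

End LinearAlgebra.

Section Surjectivity.
Variables (F : numClosedFieldType) (q s c : F).
Hypotheses (qs : q * s = 1) (q_neq_s : q != s) (cE : c = q + s).
Local Notation XP := (closed_subvariety (is_rep_P1 c)).
Local Notation XC := (closed_subvariety (is_rep_C c)).
Local Notation slice := (slice q s).
Local Notation chart := (chart q s).

Definition diag_tuple (a b : F) : 4.-tuple 'M[F]_2 :=
  [tuple mx2 a 0 0 a^-1; mx2 b 0 0 b^-1; diag_qs q s; diag_qs s q].

Lemma diag_tuple_rep a b : a != 0 -> b != 0 -> is_rep_C c (diag_tuple a b).
Proof.
move=> a0 b0; apply: rep_CI.
- by rewrite !det_mx2E; split; rewrite ?mulfV ?[s * q]mulrC ?qs //; ring.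
- rewrite /diag_qs !mx2M; congr mx2; try ring.
    by rewrite -[LHS]mul1r -qs; ring.
  by rewrite -[LHS]mul1r -qs; ring.
- by rewrite tr_mx2 cE.
- by rewrite tr_mx2 cE addrC.
Qed.

Definition diag_rep a b (a0 : a != 0) (b0 : b != 0) : XC :=
  Sub (diag_tuple a b) (diag_tuple_rep a0 b0).

Lemma chart_diag_rep a b (a0 : a != 0) (b0 : b != 0) :
  chart (diag_rep a0 b0) = point6 a a^-1 b b^-1 0 0.
Proof.
by rewrite chart_slice // /diag_rep SubK /= !mx2E !mulr0.
Qed.

(** The Weyl element is a suitable M_oo: it is orthogonal to the diagonal matrices. *)
Lemma diag_rep_lift a b (a0 : a != 0) (b0 : b != 0) :
  exists2 M : XP, phi0 M = diag_rep a0 b0 & forall k, odd_coord q s k M = 0.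
Proof.
have [||||| M eM M4] := @phi0_lift F c (diag_rep a0 b0) (mx2 0 1 (-1) 0).
- by rewrite det_mx2E; ring.
- by rewrite tr_mx2 addr0.
- by rewrite /diag_rep SubK /= mx2M tr_mx2; ring.
- by rewrite /diag_rep SubK /= mx2M tr_mx2; ring.
- by rewrite /diag_rep SubK /= /diag_qs !mx2M tr_mx2; ring.
exists M => // k; rewrite odd_coord_slice //; last first.
  by change ((val M)`_2 = diag_qs q s); rewrite -[(val M)`_2]/((val (phi0 M))`_2) eM.
rewrite branch_left eM M4 /left_word /diag_rep SubK /=; elim/ord4P: k => /=;
by rewrite ?adj2_mx2 ?mx2_1 ?mx2M ?mx2N ?mx2M mx2E; ring.
Qed.

Definition diag_chart (z : 'I_6 -> F) : Prop :=
  exists2 a, a != 0 & exists2 b, b != 0 & z = point6 a a^-1 b b^-1 0 0.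

Lemma diag_chart_lift (N : XC) : diag_chart (chart N) ->
  exists M : XP, git_class (phi0 M) = git_class N.
Proof.
move=> [a a0 [b b0 e]]; have [M eM _] := diag_rep_lift a0 b0.
by exists M; apply/(chart_git qs q_neq_s cE); rewrite eM chart_diag_rep.
Qed.

(** 1, A, B and Y are linearly dependent if and only if \tr ((A B - B A) Y) = 0, and for
    Y = C_1 B A this trace is \tr C_1 - \tr C_2. *)
Lemma slice_orthogonal (N : XC) : slice N ->
  exists x y z, let X := mx2 x y z (- x) in
  [/\ (x, y, z) != 0, \tr ((val N)`_0 * X) = 0, \tr ((val N)`_1 * X) = 0
    & \tr ((val N)`_2 * (val N)`_1 * (val N)`_0 * X) = 0].
Proof.
move=> sN; apply: orthogonal_tr0; have [_ t3] := rep_C_tr N.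
have dA := rep_C_det N (isT : (0 < 4)%N); have dB := rep_C_det N (isT : (1 < 4)%N).
have hA := det_slice dA; have hB := det_slice dB.
move: (etrans t3 cE); rewrite rep_C_last sN.
move: ((val N)`_0) ((val N)`_1) {dA dB} hA hB => A B hA hB.
move=> e; rewrite -[RHS](subrr (q + s)) -[X in _ = X - _]e.
rewrite tr2 !mul2E /adj2 !mx2E !mul2E /diag_qs !mx2E.
by ring: hA hB.
Qed.

(** An orthogonal X with nonzero determinant can be rescaled to determinant 1 and used as M_oo.
    Otherwise X is nilpotent, its image is an eigenline of A, B and C_1 B A, hence of C_1, and the
    representation is triangular: it has the class of a diagonal one. *)
Lemma slice_lift (N : XC) : slice N -> exists M : XP, git_class (phi0 M) = git_class N.
Proof.
move=> sN; have [x [y [z [nz tA tB tY]]]] := slice_orthogonal sN.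
case: (eqVneq (x * x + y * z) 0) => [nil|nil]; last first.
  pose d := \det (mx2 x y z (- x)).
  have d0 : d != 0.
    by rewrite /d det_mx2E (_ : _ - _ = - (x * x + y * z)) ?oppr_eq0 //; ring.
  pose r := sqrtC d; have r0 : r != 0 by rewrite sqrtC_eq0.
  have rr : r * r = d by rewrite -expr2 sqrtCK.
  have trZ (A : 'M[F]_2) : \tr (A * mx2 x y z (- x)) = 0 ->
      \tr (A * (r^-1 *: mx2 x y z (- x))) = 0.
    by rewrite -scalerAr mxtraceZ => ->; rewrite mulr0.
  have [M eM _] : exists2 M : XP, phi0 M = N & (val M)`_4 = r^-1 *: mx2 x y z (- x).
    apply: (@phi0_lift F c N (r^-1 *: mx2 x y z (- x))); try exact: trZ.
      rewrite mx2Z det_mx2E (_ : _ - _ = r^-1 * r^-1 * d).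
        by rewrite -rr; field.
      by rewrite /d det_mx2E; ring.
    by rewrite mxtraceZ tr_mx2 subrr mulr0.
  by exists M; rewrite eM.
apply: diag_chart_lift; rewrite chart_slice //.
have dA := rep_C_det N (isT : (0 < 4)%N); have dB := rep_C_det N (isT : (1 < 4)%N).
have hA := det_slice dA; have hB := det_slice dB.
set A := (val N)`_0 in tA tB tY dA dB hA hB *; set B := (val N)`_1 in tA tB tY dA dB hA hB *.
pose X := mx2 x y z (- x).
have [kA eA] := nilpotent_eigen nil nz tA; have [kB eB] := nilpotent_eigen nil nz tB.
have [kY eY] := nilpotent_eigen nil nz tY.
have kBA : B * A * X = (kB * kA) *: X.
  by rewrite -mulrA eA -scalerAr eB scalerA mulrC.
have k0 : kB * kA != 0.
  apply/eqP => k0; have : X = 0.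
    by apply: (mulrI (unit2 (_ : \det (B * A) = 1))); rewrite ?det2M ?dA ?dB ?mulr1 // kBA k0 scale0r mulr0.
  move/matrixP => X0; case/eqP: nz.
  have := X0 0 0; have := X0 0 1; have := X0 1 0; rewrite !mx2E !mxE.
  by move=> -> -> ->.
have eC : diag_qs q s * X = (kY / (kB * kA)) *: X.
  apply: (scalerI k0); rewrite scalerA mulrCA mulfV // mulr1 -eY sN -/A -/B.
  by rewrite scalerAr -kBA !mulrA.
have [ex ey ez ex'] : [/\ q * x = kY / (kB * kA) * x, q * y = kY / (kB * kA) * y,
    s * z = kY / (kB * kA) * z & s * - x = kY / (kB * kA) * - x].
  move: eC; rewrite /diag_qs /X mx2M mx2Z => /mx2_inj[].
  by rewrite !mul0r !addr0 !add0r.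
have cancel k : q * k = s * k -> k = 0.
  move/eqP; rewrite -subr_eq0 -mulrBl mulf_eq0 (negbTE (qBs_neq0 q_neq_s)) /=.
  by move/eqP.
have x0 : x = 0.
  by apply: cancel; rewrite ex -[RHS]opprK -mulrN ex' mulrN opprK.
have yz : y * z = 0 by move: nil; rewrite x0 mul0r add0r.
have diag : A 0 1 * A 1 0 = 0 -> B 0 1 * B 1 0 = 0 -> A 0 1 * B 1 0 = 0 ->
    B 0 1 * A 1 0 = 0 ->
    diag_chart (point6 (A 0 0) (A 1 1) (B 0 0) (B 1 1) (A 0 1 * B 1 0) (B 0 1 * A 1 0)).
  rewrite hA hB => /eqP; rewrite subr_eq0 => /eqP eA1 /eqP.
  rewrite subr_eq0 => /eqP eB1 -> ->.
  have A0 : A 0 0 != 0 by apply/eqP => z0; move/eqP: eA1; rewrite z0 mul0r eq_sym oner_eq0.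
  have B0 : B 0 0 != 0 by apply/eqP => z0; move/eqP: eB1; rewrite z0 mul0r eq_sym oner_eq0.
  exists (A 0 0) => //; exists (B 0 0) => //.
  by congr point6; [apply: (mulfI A0); rewrite mulfV | apply: (mulfI B0); rewrite mulfV].
have trX (C : 'M[F]_2) : \tr (C * mx2 x y z (- x)) = C 1 0 * y + C 0 1 * z.
  by rewrite {1}(mx2_eta C) mx2M tr_mx2 x0; ring.
move: tA tB; rewrite !trX; case: (eqVneq y 0) => [y0|y0].
  have z0 : z != 0 by apply: contra nz => /eqP ->; rewrite x0 y0.
  rewrite y0 !mulr0 !add0r => /eqP; rewrite mulf_eq0 (negbTE z0) orbF => /eqP A01.
  move/eqP; rewrite mulf_eq0 (negbTE z0) orbF => /eqP B01.
  by apply: diag; rewrite ?A01 ?B01 !mul0r.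
have z0 : z = 0 by move/eqP: yz; rewrite mulf_eq0 (negbTE y0) => /eqP.
rewrite z0 !mulr0 !addr0 => /eqP; rewrite mulf_eq0 (negbTE y0) orbF => /eqP A10.
move/eqP; rewrite mulf_eq0 (negbTE y0) orbF => /eqP B10.
by apply: diag; rewrite ?A10 ?B10 !mulr0.
Qed.

Lemma phi0_surj (N : XC) : exists M : XP, git_class (phi0 M) = git_class N.
Proof.
have [N' NN' sN] := C_to_slice qs q_neq_s cE N.
have [M eM] := slice_lift sN; exists M; rewrite eM.
by apply/esym/quot_projP; exact: conjugate_git.
Qed.

End Surjectivity.

(** * The ideal of the chart *)

Section ChartQuartic.
Variable R : comNzRingType.
Variables q s a1 a2 b1 b2 : R.

Definition chart_prod := (a1 * a2 - 1) * (b1 * b2 - 1).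
Definition chart_lin_u := s * (a1 * b1 + a2 * b2 - a1 * b2) - q * (a2 * b1).
Definition chart_lin_v := q * (a1 * b1 + a2 * b2 - a2 * b1) - s * (a1 * b2).
Definition chart_cst :=
  s * (a1 * b1 * a2 * b2 - a1 * a1 * (b1 * b2 - 1) - b2 * b2 * (a1 * a2 - 1)) +
  q * (a1 * b1 * a2 * b2 - b1 * b1 * (a1 * a2 - 1) - a2 * a2 * (b1 * b2 - 1)) - (q + s).

Lemma chart_eq_conic u v : chart_eq q s a1 a2 b1 b2 u v =
  s * (u * u) + q * (v * v) + chart_lin_u * u + chart_lin_v * v + chart_cst.
Proof. by rewrite /chart_eq /chart_lin_u /chart_lin_v /chart_cst; ring. Qed.

(** The equation of v after elimination of u = chart_prod / v. *)
Definition chart_quartic : {poly R} :=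
  Poly [:: s * chart_prod * chart_prod; chart_lin_u * chart_prod; chart_cst; chart_lin_v; q].

Definition chart_cubic : {poly R} :=
  Poly [:: chart_lin_u * chart_prod; chart_cst *+ 2; chart_lin_v *+ 3; q *+ 4].

Lemma deriv_chart_quartic : chart_quartic^`() = chart_cubic.
Proof.
apply/polyP => i; rewrite coef_deriv !coef_Poly.
by case: i => [|[|[|[|i]]]] //=; rewrite !nth_nil mul0rn.
Qed.

Lemma chart_quartic_horner u v : u * v = chart_prod ->
  chart_quartic.[v] = v * v * chart_eq q s a1 a2 b1 b2 u v.
Proof.
move=> uv; rewrite chart_eq_conic horner_Poly /= -uv; ring.
Qed.

Lemma lead_chart_quartic : q != 0 -> lead_coef chart_quartic = q.
Proof. by move=> q0; rewrite lead_coefE (PolyK (c := 0)). Qed.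

Lemma lead_chart_cubic : q *+ 4 != 0 -> lead_coef chart_cubic = q *+ 4.
Proof. by move=> q0; rewrite lead_coefE (PolyK (c := 0)). Qed.

End ChartQuartic.

Lemma map_chart_quartic (R R' : comNzRingType) (f : {rmorphism R -> R'}) q s a1 a2 b1 b2 :
  map_poly f (chart_quartic q s a1 a2 b1 b2) =
  chart_quartic (f q) (f s) (f a1) (f a2) (f b1) (f b2).
Proof.
rewrite map_Poly /chart_quartic /chart_prod /chart_lin_u /chart_lin_v /chart_cst /=.
by rewrite !(rmorphM, rmorphD, rmorphN, rmorph1).
Qed.

Lemma map_chart_cubic (R R' : comNzRingType) (f : {rmorphism R -> R'}) q s a1 a2 b1 b2 :
  map_poly f (chart_cubic q s a1 a2 b1 b2) =
  chart_cubic (f q) (f s) (f a1) (f a2) (f b1) (f b2).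
Proof. by rewrite -!deriv_chart_quartic -deriv_map map_chart_quartic. Qed.

Section Separability.
Variables (F : numClosedFieldType) (q s : F).
Hypotheses (qs : q * s = 1) (q_neq_s : q != s).

Lemma q_neq0 : q != 0.
Proof. by apply/eqP => q0; move/eqP: qs; rewrite q0 mul0r eq_sym oner_eq0. Qed.

Lemma s_neq0 : s != 0.
Proof. by apply/eqP => q0; move/eqP: qs; rewrite q0 mulr0 eq_sym oner_eq0. Qed.

(** The roots at the origin of the base are distinct because q s = 1 and q <> s. *)
Lemma chart_quartic0 : chart_quartic q s 0 0 0 0 =
  q *: \prod_(x <- [:: 1; -1; s; - s]) ('X - x%:P).
Proof.
rewrite !big_cons big_nil mulr1 /chart_quartic /chart_prod /chart_lin_u /chart_lin_v /chart_cst.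
apply/polyP => i; rewrite coef_Poly.
rewrite (_ : ('X - _) * _ = 'X^4 - (1 + s * s)%:P * 'X^2 + (s * s)%:P); last first.
  by rewrite !(polyCN, polyCD, polyCM) polyC1 !exprS expr0; ring.
rewrite !(coefZ, coefD, coefB, coefN, coefCM, coefXn, coefC).
have qss : q * (s * s) = s by rewrite mulrA qs mul1r.
case: i => [|[|[|[|[|i]]]]] /=; rewrite ?nth_nil; try ring.
- by rewrite -[in LHS]qss; ring.
- by rewrite -[X in _ - (_ + X)]qss; ring.
Qed.

Lemma uniq_chart_roots0 : uniq [:: 1; -1; s; - s].
Proof.
have s0 := s_neq0; have two0 : (2 : F) != 0 by rewrite pnatr_eq0.
have s1 : s * s != 1.
  apply/eqP => ss; case/eqP: q_neq_s; rewrite -[q]mulr1 -ss mulrA qs mul1r //.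
have neqN (x : F) : x != 0 -> x != - x.
  by move=> x0; rewrite -addr_eq0 -mulr2n mulrn_eq0.
rewrite /= !inE !negb_or; do ?[apply/andP; split] => //.
- by apply: neqN; exact: oner_neq0.
- by apply: contra s1 => /eqP <-; rewrite mulr1.
- by apply: contra s1 => /eqP e; rewrite -mulrNN -e mulr1.
- by apply: contra s1 => /eqP <-; rewrite mulrNN mulr1.
- by apply: contra s1 => /eqP /oppr_inj <-; rewrite mulr1.
- exact: neqN.
Qed.

Lemma size_chart_quartic a1 a2 b1 b2 : size (chart_quartic q s a1 a2 b1 b2) = 5.
Proof. by rewrite (PolyK (c := 0)) //= q_neq0. Qed.

(** The resultant of the quartic and its derivative, restricted to a line through the origin, is a
    polynomial that does not vanish at the origin. *)
Lemma generic_separable (a1 a2 b1 b2 : F) : exists2 rho : {poly F}, rho != 0 &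
  forall t, rho.[t] != 0 ->
    separable_poly (chart_quartic q s (a1 * t) (a2 * t) (b1 * t) (b2 * t)).
Proof.
pose Q := chart_quartic q%:P s%:P (a1%:P * 'X) (a2%:P * 'X) (b1%:P * 'X) (b2%:P * 'X).
pose Q' := chart_cubic q%:P s%:P (a1%:P * 'X) (a2%:P * 'X) (b1%:P * 'X) (b2%:P * 'X).
have q40 : q *+ 4 != 0 by rewrite mulrn_eq0 q_neq0.
have lQ : lead_coef Q = q%:P by rewrite lead_chart_quartic // polyC_eq0 q_neq0.
have lQ' : lead_coef Q' = (q *+ 4)%:P.
  by rewrite polyCMn lead_chart_cubic // -polyCMn polyC_eq0.
have ev (t : F) : map_poly (horner_eval t) Q =
    chart_quartic q s (a1 * t) (a2 * t) (b1 * t) (b2 * t).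
  by rewrite map_chart_quartic /= /horner_eval !hornerE.
have ev' (t : F) : map_poly (horner_eval t) Q' =
    chart_cubic q s (a1 * t) (a2 * t) (b1 * t) (b2 * t).
  by rewrite map_chart_cubic /= /horner_eval !hornerE.
have res (t : F) : (resultant Q Q').[t] =
    resultant (chart_quartic q s (a1 * t) (a2 * t) (b1 * t) (b2 * t))
              (chart_cubic q s (a1 * t) (a2 * t) (b1 * t) (b2 * t)).
  rewrite -ev -ev' -[LHS]/(horner_eval t _) map_resultant //.
    by rewrite lQ /= /horner_eval hornerC q_neq0.
  by rewrite lQ' /= /horner_eval hornerC.
have sep t : ((resultant Q Q').[t] != 0) =
    separable_poly (chart_quartic q s (a1 * t) (a2 * t) (b1 * t) (b2 * t)).
  rewrite res resultant_eq0 -leqNgt separable_poly.unlock deriv_chart_quartic /coprimep.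
  rewrite eqn_leq [(0 < _)%N]lt0n size_poly_eq0 gcdp_eq0 -size_poly_eq0.
  by rewrite size_chart_quartic /= andbT.
exists (resultant Q Q') => [|t]; last by rewrite sep.
suff : (resultant Q Q').[0] != 0 by apply: contra => /eqP ->; rewrite horner0.
rewrite sep !mulr0 chart_quartic0 separable_poly.unlock derivZ.
rewrite coprimepZl ?q_neq0 // coprimepZr ?q_neq0 //.
by have := separable_prod_XsubC [:: 1; -1; s; - s]; rewrite uniq_chart_roots0 separable_poly.unlock.
Qed.

Lemma separable_roots a1 a2 b1 b2 :
  separable_poly (chart_quartic q s a1 a2 b1 b2) ->
  exists2 r : seq F, uniq r /\ size r = 4%N &
    all (root (chart_quartic q s a1 a2 b1 b2)) r.
Proof.
move=> sep; have [r er] := closed_field_poly_normal (chart_quartic q s a1 a2 b1 b2).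
have l0 : lead_coef (chart_quartic q s a1 a2 b1 b2) != 0.
  by rewrite lead_coef_eq0 -size_poly_eq0 size_chart_quartic.
exists r; last first.
  by apply/allP => x xr; rewrite er rootZ // root_prod_XsubC.
split.
  rewrite -separable_prod_XsubC; move: sep; rewrite er separable_poly.unlock derivZ.
  by rewrite coprimepZl // coprimepZr.
have := size_chart_quartic a1 a2 b1 b2.
by rewrite {1}er size_scale // size_prod_XsubC => -[].
Qed.

End Separability.

Section MorphChart.
Variables (R R' : comNzRingType) (f : {rmorphism R -> R'}).

Lemma rmorph_chart_prod a1 a2 b1 b2 :
  f (chart_prod a1 a2 b1 b2) = chart_prod (f a1) (f a2) (f b1) (f b2).
Proof. by rewrite /chart_prod !(rmorphM, rmorphD, rmorphN, rmorph1). Qed.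

Lemma rmorph_chart_lin_u q s a1 a2 b1 b2 : f (chart_lin_u q s a1 a2 b1 b2) =
  chart_lin_u (f q) (f s) (f a1) (f a2) (f b1) (f b2).
Proof. by rewrite /chart_lin_u !(rmorphM, rmorphD, rmorphN, rmorph1). Qed.

Lemma rmorph_chart_lin_v q s a1 a2 b1 b2 : f (chart_lin_v q s a1 a2 b1 b2) =
  chart_lin_v (f q) (f s) (f a1) (f a2) (f b1) (f b2).
Proof. by rewrite /chart_lin_v !(rmorphM, rmorphD, rmorphN, rmorph1). Qed.

Lemma rmorph_chart_cst q s a1 a2 b1 b2 : f (chart_cst q s a1 a2 b1 b2) =
  chart_cst (f q) (f s) (f a1) (f a2) (f b1) (f b2).
Proof. by rewrite /chart_cst !(rmorphM, rmorphD, rmorphN, rmorph1). Qed.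

Lemma rmorph_chart_eq q s a1 a2 b1 b2 u v : f (chart_eq q s a1 a2 b1 b2 u v) =
  chart_eq (f q) (f s) (f a1) (f a2) (f b1) (f b2) (f u) (f v).
Proof. by rewrite /chart_eq /= !(rmorphM, rmorphD, rmorphN, rmorph1). Qed.

End MorphChart.

Section NormalForms.
Variables (F : numClosedFieldType) (q s : F).
Hypotheses (qs : q * s = 1) (q_neq_s : q != s).

Local Notation i0 := (@Ordinal 4 0 isT).
Local Notation i1 := (@Ordinal 4 1 isT).
Local Notation i2 := (@Ordinal 4 2 isT).
Local Notation i3 := (@Ordinal 4 3 isT).

Definition var6 k (k6 : (k < 6)%N) : {mpoly F[6]} := 'X_(Ordinal k6).
Local Notation X k := (@var6 k isT).
Local Notation U := (X 4).
Local Notation V := (X 5).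
Local Notation qC := (q%:MP : {mpoly F[_]}).
Local Notation sC := (s%:MP : {mpoly F[_]}).

Definition rel_prod : {mpoly F[6]} := U * V - chart_prod (X 0) (X 1) (X 2) (X 3).
Definition rel_tr : {mpoly F[6]} := chart_eq qC sC (X 0) (X 1) (X 2) (X 3) U V.

Definition on_chart (z : 'I_6 -> F) : Prop := rel_prod.@[z] = 0 /\ rel_tr.@[z] = 0.

Lemma on_chartP a1 a2 b1 b2 u v : on_chart (point6 a1 a2 b1 b2 u v) <->
  u * v = chart_prod a1 a2 b1 b2 /\ chart_eq q s a1 a2 b1 b2 u v = 0.
Proof.
rewrite /on_chart /rel_prod /rel_tr mevalB mevalM.
rewrite (rmorph_chart_prod (meval _)) (rmorph_chart_eq (meval _)) /=.
rewrite !mevalC /var6 !mevalXU /point6 /=.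
by split=> [[/eqP]|[-> ->]]; rewrite ?subrr // subr_eq0 => /eqP.
Qed.

Definition base_lift (r : {mpoly F[4]}) : {mpoly F[6]} :=
  r \mPo [tuple X 0; X 1; X 2; X 3].

Lemma base_lift_meval r (z : 'I_6 -> F) :
  (base_lift r).@[z] = r.@[fun i => z (widen_ord (isT : (4 <= 6)%N) i)].
Proof.
rewrite /base_lift comp_mpoly_meval; apply: meval_eq; elim/ord4P;
by rewrite (tnth_nth 0) /= /var6 mevalXU; congr z; apply: val_inj.
Qed.

(** As q and s are invertible, the relations express u v, u^2 and v^3 in terms of 1, u, v, v^2
    over the polynomials in a1, a2, b1, b2. *)
Definition nform (r : 'I_4 -> {mpoly F[4]}) : {mpoly F[6]} :=
  base_lift (r i0) + base_lift (r i1) * U + base_lift (r i2) * V +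
  base_lift (r i3) * (V * V).

Definition mod_rel (p p' : {mpoly F[6]}) : Prop :=
  exists g1 g2, p = p' + (g1 * rel_prod + g2 * rel_tr).

Lemma mod_rel_refl p : mod_rel p p.
Proof. by exists 0, 0; rewrite !mul0r !addr0. Qed.

Lemma mod_relD p p' r r' : mod_rel p p' -> mod_rel r r' -> mod_rel (p + r) (p' + r').
Proof.
by move=> [g1 [g2 ->]] [h1 [h2 ->]]; exists (g1 + h1), (g2 + h2); ring.
Qed.

Lemma mod_relMl x p p' : mod_rel p p' -> mod_rel (x * p) (x * p').
Proof. by move=> [g1 [g2 ->]]; exists (x * g1), (x * g2); ring. Qed.

Lemma mod_rel_trans p p' p'' : mod_rel p p' -> mod_rel p' p'' -> mod_rel p p''.
Proof.
by move=> [g1 [g2 ->]] [h1 [h2 ->]]; exists (g1 + h1), (g2 + h2); ring.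
Qed.

Lemma mod_rel_meval p p' z : mod_rel p p' -> on_chart z -> p.@[z] = p'.@[z].
Proof.
by move=> [g1 [g2 ->]] [z1 z2]; rewrite mevalD mevalD !mevalM z1 z2 !mulr0 !addr0.
Qed.

Definition var4 k (k4 : (k < 4)%N) : {mpoly F[4]} := 'X_(Ordinal k4).
Local Notation x k := (@var4 k isT).

Let w := chart_prod (x 0) (x 1) (x 2) (x 3).
Let lu := chart_lin_u qC sC (x 0) (x 1) (x 2) (x 3).
Let lv := chart_lin_v qC sC (x 0) (x 1) (x 2) (x 3).
Let e := chart_cst qC sC (x 0) (x 1) (x 2) (x 3).

Lemma base_lift_var k (k4 : (k < 4)%N) (k6 : (k < 6)%N) :
  base_lift (var4 k4) = var6 k6.
Proof.
rewrite /base_lift /var4 comp_mpolyXU; case: k k4 k6 => [|[|[|[|//]]]] k4 k6 /=;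
by rewrite /var6; congr 'X__; apply: val_inj.
Qed.

Lemma base_liftC a : base_lift a%:MP = a%:MP.
Proof. exact: comp_mpolyC. Qed.

Lemma base_liftD r r' : base_lift (r + r') = base_lift r + base_lift r'.
Proof. exact: rmorphD. Qed.

Lemma base_liftM r r' : base_lift (r * r') = base_lift r * base_lift r'.
Proof. exact: rmorphM. Qed.

Lemma base_liftN r : base_lift (- r) = - base_lift r.
Proof. exact: rmorphN. Qed.

Let W := chart_prod (X 0) (X 1) (X 2) (X 3).
Let Lu := chart_lin_u qC sC (X 0) (X 1) (X 2) (X 3).
Let Lv := chart_lin_v qC sC (X 0) (X 1) (X 2) (X 3).
Let E := chart_cst qC sC (X 0) (X 1) (X 2) (X 3).

Let liftX : (base_lift (x 0) = X 0) * (base_lift (x 1) = X 1) *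
  (base_lift (x 2) = X 2) * (base_lift (x 3) = X 3).
Proof. by do ?split; exact: base_lift_var. Qed.

Let liftw : base_lift w = W.
Proof.
rewrite /w /W -!liftX.
exact: (rmorph_chart_prod (comp_mpoly _)).
Qed.
Let liftlu : base_lift lu = Lu.
Proof.
rewrite /lu /Lu -!liftX -!(base_liftC q) -!(base_liftC s).
exact: (rmorph_chart_lin_u (comp_mpoly _)).
Qed.
Let liftlv : base_lift lv = Lv.
Proof.
rewrite /lv /Lv -!liftX -!(base_liftC q) -!(base_liftC s).
exact: (rmorph_chart_lin_v (comp_mpoly _)).
Qed.
Let lifte : base_lift e = E.
Proof.
rewrite /e /E -!liftX -!(base_liftC q) -!(base_liftC s).
exact: (rmorph_chart_cst (comp_mpoly _)).
Qed.

Let qsC n : (q%:MP * s%:MP : {mpoly F[n]}) = 1.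
Proof. by rewrite -mpolyCM qs mpolyC1. Qed.

Definition nform_U (r : 'I_4 -> {mpoly F[4]}) (k : 'I_4) : {mpoly F[4]} :=
  nth 0 [:: w * r i2 - qC * e * r i1; r i0 - qC * lu * r i1;
            w * r i3 - qC * lv * r i1; - (qC * qC) * r i1] k.
Definition nform_V (r : 'I_4 -> {mpoly F[4]}) (k : 'I_4) : {mpoly F[4]} :=
  nth 0 [:: w * r i1 - sC * lu * w * r i3; - (sC * sC) * w * r i3;
            r i0 - sC * e * r i3; r i2 - sC * lv * r i3] k.

Lemma rel_tr_conic : rel_tr = sC * (U * U) + qC * (V * V) + Lu * U + Lv * V + E.
Proof. exact: chart_eq_conic. Qed.

Lemma nform_UE r : mod_rel (U * nform r) (nform (nform_U r)).
Proof.
exists (base_lift (r i2) + base_lift (r i3) * V), (qC * base_lift (r i1)).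
rewrite rel_tr_conic /rel_prod -/W /nform /nform_U /=.
move: liftw liftlu liftlv lifte; move: (w) (lu) (lv) (e) => w' lu' lv' e' lw llu llv le.
rewrite !(base_liftD, base_liftM, base_liftN, base_liftC) lw llu llv le.
move: (base_lift (r i0)) (base_lift (r i1)) (base_lift (r i2)) (base_lift (r i3)).
move=> r0 r1 r2 r3; have := qsC 6; move: (q%:MP : {mpoly F[6]}) (s%:MP : {mpoly F[6]}).
by move=> Q S QS; ring: QS.
Qed.

Lemma nform_VE r : mod_rel (V * nform r) (nform (nform_V r)).
Proof.
exists (base_lift (r i1) - sC * base_lift (r i3) * Lu - sC * sC * base_lift (r i3) * U),
  (sC * base_lift (r i3) * V).
rewrite rel_tr_conic /rel_prod -/W /nform /nform_V /=.
move: liftw liftlu liftlv lifte; move: (w) (lu) (lv) (e) => w' lu' lv' e' lw llu llv le.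
rewrite !(base_liftD, base_liftM, base_liftN, base_liftC) lw llu llv le.
move: (base_lift (r i0)) (base_lift (r i1)) (base_lift (r i2)) (base_lift (r i3)).
move=> r0 r1 r2 r3; have := qsC 6; move: (q%:MP : {mpoly F[6]}) (s%:MP : {mpoly F[6]}).
by move=> Q S QS; ring: QS.
Qed.

Definition deg_le n d (p : {mpoly F[n]}) : Prop := (msize p <= d.+1)%N.

Lemma deg_leW n d d' (p : {mpoly F[n]}) : (d <= d')%N -> deg_le d p -> deg_le d' p.
Proof. by move=> dd' dp; apply: leq_trans dp _. Qed.

Lemma deg_leC n d a : deg_le d (a%:MP : {mpoly F[n]}).
Proof. by rewrite /deg_le msizeC; case: (a != 0). Qed.

Lemma deg_leN n d (p : {mpoly F[n]}) : deg_le d p -> deg_le d (- p).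
Proof. by rewrite /deg_le msizeN. Qed.

Lemma deg_leD n d (p r : {mpoly F[n]}) : deg_le d p -> deg_le d r -> deg_le d (p + r).
Proof.
by move=> dp dr; apply: leq_trans (msizeD_le _ _) _; rewrite geq_max dp dr.
Qed.

Lemma deg_leM n d d' (p r : {mpoly F[n]}) : deg_le d p -> deg_le d' r -> deg_le (d + d') (p * r).
Proof.
move=> dp dr; rewrite /deg_le; case: (eqVneq p 0) => [->|p0].
  by rewrite mul0r msize0.
case: (eqVneq r 0) => [->|r0]; first by rewrite mulr0 msize0.
by rewrite msizeM // -subn1 leq_subLR add1n -addSn -addnS leq_add.
Qed.

Lemma deg_leXU n (i : 'I_n) : deg_le 1 ('X_i : {mpoly F[n]}).
Proof. by rewrite /deg_le msizeX mdeg1. Qed.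

Lemma deg_leX k (k4 : (k < 4)%N) : deg_le 1 (var4 k4).
Proof. exact: deg_leXU. Qed.

Let deg_w : deg_le 4 w.
Proof.
rewrite /w /chart_prod -mpolyC1; apply: (@deg_leM 4 2 2);
apply: deg_leD; try (by apply: deg_leN; exact: deg_leC);
by apply: (@deg_leM 4 1 1); exact: deg_leX.
Qed.

Let deg2 (a : F) k l (k4 : (k < 4)%N) (l4 : (l < 4)%N) :
  deg_le 2 (a%:MP * (var4 k4 * var4 l4)).
Proof.
apply: (@deg_leM 4 0 2); first exact: deg_leC.
by apply: (@deg_leM 4 1 1); exact: deg_leX.
Qed.

Let deg_lu : deg_le 2 lu.
Proof.
rewrite /lu /chart_lin_u !mulrDr mulrN.
by do ![apply: deg_leD | apply: deg_leN]; exact: deg2.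
Qed.

Let deg_lv : deg_le 2 lv.
Proof.
rewrite /lv /chart_lin_v !mulrDr mulrN.
by do ![apply: deg_leD | apply: deg_leN]; exact: deg2.
Qed.

Let deg_e : deg_le 4 e.
Proof.
have X2 k l (k4 : (k < 4)%N) (l4 : (l < 4)%N) : deg_le 2 (var4 k4 * var4 l4).
  by apply: (@deg_leM 4 1 1); exact: deg_leX.
have XX k l (k4 : (k < 4)%N) (l4 : (l < 4)%N) : deg_le 2 (var4 k4 * var4 l4 - 1).
  by apply: deg_leD => //; apply: deg_leN; rewrite -mpolyC1; exact: deg_leC.
rewrite /e /chart_cst; apply: deg_leD; last first.
  by apply: deg_leN; apply: deg_leD; exact: deg_leC.
apply: deg_leD; apply: (@deg_leM 4 0 4); try exact: deg_leC;
apply: deg_leD; try (apply: deg_leN; exact: (@deg_leM 4 2 2));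
apply: deg_leD; try (apply: deg_leN; exact: (@deg_leM 4 2 2));
by rewrite -mulrA; exact: (@deg_leM 4 2 2).
Qed.

(** The degree d of the coefficients is kept for the dimension count. *)
Definition has_nform d p := exists2 r : 'I_4 -> {mpoly F[4]},
  forall k, deg_le d (r k) & mod_rel p (nform r).

Lemma has_nformW d d' p : (d <= d')%N -> has_nform d p -> has_nform d' p.
Proof.
by move=> dd' [r dr pr]; exists r => // k; apply: deg_leW (dr k).
Qed.

Lemma has_nformD d p p' : has_nform d p -> has_nform d p' -> has_nform d (p + p').
Proof.
move=> [r dr pr] [r' dr' pr']; exists (fun k => r k + r' k).
  by move=> k; exact: deg_leD.
apply: mod_rel_trans (mod_relD pr pr') _.
rewrite (_ : nform r + nform r' = nform (fun k => r k + r' k)).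
  exact: mod_rel_refl.
by rewrite /nform !base_liftD; ring.
Qed.

Lemma has_nformX d i p : has_nform d p -> has_nform (d + 6) ('X_i * p).
Proof.
move=> [r dr pr].
have deg_r k : deg_le (d + 6) (r k) by apply: deg_leW (dr k); exact: leq_addr.
have deg_mul f l : deg_le 6 f -> deg_le (d + 6) (f * r l).
  by move=> df; rewrite addnC; exact: deg_leM.
have deg_mulC (a : F) f l : deg_le 6 f -> deg_le (d + 6) (a%:MP * f * r l).
  by move=> df; apply: deg_mul; apply: (@deg_leM 4 0 6) => //; exact: deg_leC.
have dw : deg_le 6 w by apply: deg_leW deg_w.
have dlu : deg_le 6 lu by apply: deg_leW deg_lu.
have dlv : deg_le 6 lv by apply: deg_leW deg_lv.
have de : deg_le 6 e by apply: deg_leW deg_e.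
have base k (k4 : (k < 4)%N) (k6 : (k < 6)%N) : has_nform (d + 6) (var6 k6 * p).
  exists (fun l => var4 k4 * r l).
    by move=> l; apply: deg_mul; apply: deg_leW (deg_leX _).
  apply: mod_rel_trans (mod_relMl _ pr) _.
  rewrite (_ : var6 k6 * nform r = nform (fun l => var4 k4 * r l)).
    exact: mod_rel_refl.
  by rewrite /nform !base_liftM (base_lift_var k4 k6); ring.
elim/ord6P: i.
- exact: (@base 0%N isT isT).
- exact: (@base 1%N isT isT).
- exact: (@base 2%N isT isT).
- exact: (@base 3%N isT isT).
- exists (nform_U r); last exact: mod_rel_trans (mod_relMl _ pr) (nform_UE r).
  elim/ord4P; rewrite /nform_U /=.
  + by apply: deg_leD; [exact: deg_mul | apply: deg_leN; exact: deg_mulC].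
  + by apply: deg_leD; [exact: deg_r | apply: deg_leN; exact: deg_mulC].
  + by apply: deg_leD; [exact: deg_mul | apply: deg_leN; exact: deg_mulC].
  + by rewrite mulNr; apply: deg_leN; rewrite -mpolyCM; apply: deg_mul; exact: deg_leC.
- exists (nform_V r); last exact: mod_rel_trans (mod_relMl _ pr) (nform_VE r).
  elim/ord4P; rewrite /nform_V /=.
  + apply: deg_leD; [exact: deg_mul | apply: deg_leN; apply: deg_mul].
    by apply: (@deg_leM 4 2 4) => //; apply: (@deg_leM 4 0 2) => //; exact: deg_leC.
  + by rewrite -mpolyCM -mpolyCN; exact: deg_mulC.
  + by apply: deg_leD; [exact: deg_r | apply: deg_leN; exact: deg_mulC].
  + by apply: deg_leD; [exact: deg_r | apply: deg_leN; exact: deg_mulC].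
Qed.

Lemma has_nform_const d a p : has_nform d p -> has_nform d (a%:MP * p).
Proof.
move=> [r dr pr]; exists (fun k => a%:MP * r k).
  by move=> k; apply: (@deg_leM 4 0 d) => //; exact: deg_leC.
apply: mod_rel_trans (mod_relMl _ pr) _.
rewrite (_ : a%:MP * nform r = nform (fun l => a%:MP * r l)).
  exact: mod_rel_refl.
by rewrite /nform !base_liftM base_liftC; ring.
Qed.

(** Multiplication by a fixed polynomial raises the degree of normal forms by a constant
    that does not depend on the other factor: the bound in the dimension count is linear. *)
Lemma has_nformM p : exists k, forall d r, has_nform d r -> has_nform (d + k) (p * r).
Proof.
elim/mpoly_alg_ind: p => [a|i|p p' [k IHp] [k' IHp']|p p' [k IHp] [k' IHp']].
- by exists 0%N => d r; rewrite addn0; exact: has_nform_const.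
- by exists 6%N => d r; exact: has_nformX.
- exists (k + k')%N => d r dr; rewrite mulrDl; apply: has_nformD.
    by apply: has_nformW (IHp d r dr); rewrite leq_add2l leq_addr.
  by apply: has_nformW (IHp' d r dr); rewrite leq_add2l leq_addl.
- exists (k' + k)%N => d r dr; rewrite -mulrA addnA.
  exact: IHp (IHp' _ _ dr).
Qed.

Lemma has_nform1 : has_nform 0 1.
Proof.
exists (fun k => nth 0 [:: 1; 0; 0; 0] k).
  by elim/ord4P; rewrite /= -?mpolyC1 -?mpolyC0; exact: deg_leC.
rewrite (_ : nform _ = 1); first exact: mod_rel_refl.
by rewrite /nform /= -mpolyC1 -mpolyC0 !base_liftC mpolyC0 !mul0r !addr0.
Qed.

Lemma has_nform_ex p : exists d, has_nform d p.
Proof.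
by have [k /(_ _ _ has_nform1)] := has_nformM p; rewrite mulr1; exists (0 + k)%N.
Qed.

(** The restriction of p to the line through the origin and z. *)
Definition on_line (z : 'I_4 -> F) (p : {mpoly F[4]}) : {poly F} :=
  mmap (@polyC F) (fun i => (z i)%:P * 'X) p.

Lemma on_line_horner z p t : (on_line z p).[t] = p.@[fun i => z i * t].
Proof.
elim/mpoly_alg_ind: p => [a|i|p r IHp IHr|p r IHp IHr].
- by rewrite /on_line mmapC hornerC mevalC.
- by rewrite /on_line mmapX mmap1U mevalXU !hornerE.
- by rewrite /on_line mmapD hornerD mevalD -/(on_line _ _) IHp -/(on_line _ _) IHr.
- by rewrite /on_line rmorphM hornerM mevalM /= -/(on_line _ _) IHp -/(on_line _ _) IHr.
Qed.

(** Over a generic point of the base there are four points of the chart, with distinct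
    nonzero values of v; a normal form that vanishes at all four is 0 there. *)
Lemma nform_eq0 r : (forall z, on_chart z -> (nform r).@[z] = 0) -> forall k, r k = 0.
Proof.
move=> r0 k; apply: mpoly_eq0_meval => z.
have [rho rho0 sep] := generic_separable qs q_neq_s (z i0) (z i1) (z i2) (z i3).
pose wl := on_line z w.
have wlE t : wl.[t] = chart_prod (z i0 * t) (z i1 * t) (z i2 * t) (z i3 * t).
  rewrite /wl on_line_horner /w (rmorph_chart_prod (meval _)) /= /var4 !mevalXU.
  by [].
have wl0 : wl != 0.
  apply/eqP => e0; have := wlE 0; rewrite e0 horner0 /chart_prod !mulr0 sub0r mulrNN mulr1.
  by move/eqP; rewrite eq_sym oner_eq0.
suff : on_line z (r k) * (wl * rho) = 0.
  move/eqP; rewrite !mulf_eq0 (negbTE wl0) (negbTE rho0) !orbF => /eqP e0.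
  have := on_line_horner z (r k) 1; rewrite e0 horner0 => ->.
  by apply: meval_eq => i; rewrite mulr1.
apply: poly_eq0_horner => t _; rewrite !hornerM.
case: (eqVneq rho.[t] 0) => [->|rt]; first by rewrite !mulr0.
case: (eqVneq wl.[t] 0) => [->|wt]; first by rewrite mul0r mulr0.
suff -> : (on_line z (r k)).[t] = 0 by rewrite mul0r.
have [vs [uvs svs] /allP vroot] := separable_roots qs (sep t rt).
pose y (i : 'I_4) := z i * t; have wy : chart_prod (y i0) (y i1) (y i2) (y i3) != 0 by rewrite -wlE.
have s0 := s_neq0 qs.
pose rv l := (r l).@[y].
(* v times the normal form at (y, u, v), where u v = wl.[t]: a cubic in v with four roots *)
pose C : {poly F} := Poly [:: rv i1 * wl.[t]; rv i0; rv i2; rv i3].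
have C0 : C = 0.
  apply/eqP; apply: contraT => Cn; have := max_poly_roots Cn _ uvs.
  rewrite svs ltnNge (leq_trans (size_Poly _)) //; apply.
  apply/allP => v /vroot /rootP.
  have v0 : forall v, (chart_quartic q s (y i0) (y i1) (y i2) (y i3)).[v] = 0 -> v != 0.
    move=> v'; case: eqP => // ->; rewrite horner_Poly /= !mulr0 !add0r => /eqP; apply: contraTT => _.
    exact: mulf_neq0 (mulf_neq0 s0 wy) wy.
  move=> Qv; have vn0 := v0 v Qv.
  pose u := chart_prod (y i0) (y i1) (y i2) (y i3) / v.
  have uv : u * v = chart_prod (y i0) (y i1) (y i2) (y i3) by rewrite mulfVK.
  have zV : on_chart (point6 (y i0) (y i1) (y i2) (y i3) u v).
    apply/on_chartP; split=> //; move: Qv; rewrite (chart_quartic_horner _ _ uv).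
    by move/eqP; rewrite !mulf_eq0 (negbTE vn0) /= => /eqP.
  have := r0 _ zV; rewrite /nform !mevalD !mevalM !base_lift_meval /var6 !mevalXU.
  have ye l : (r l).@[fun i => point6 (y i0) (y i1) (y i2) (y i3) u v
                 (widen_ord (isT : (4 <= 6)%N) i)] = rv l.
    by apply: meval_eq; elim/ord4P; rewrite /point6 /=.
  rewrite !ye /point6 /= => e0; apply/rootP; rewrite horner_Poly /= wlE -!/(y _) -uv.
  rewrite (_ : _ + _ = v * (rv i0 + rv i1 * u + rv i2 * v + rv i3 * (v * v))); last by ring.
  by rewrite e0 mulr0.
have rv0 l : C`_l = 0 by rewrite C0 coef0.
rewrite on_line_horner -/y -/(rv k); elim/ord4P: k.
- by have := rv0 1%N; rewrite coef_Poly.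
- by have /eqP := rv0 0%N; rewrite coef_Poly /= mulf_eq0 (negbTE wt) orbF => /eqP.
- by have := rv0 2%N; rewrite coef_Poly.
- by have := rv0 3%N; rewrite coef_Poly.
Qed.

(** The normal form of a polynomial that vanishes on the chart is 0. *)
Lemma on_chart_ideal p : (forall z, on_chart z -> p.@[z] = 0) -> mod_rel p 0.
Proof.
move=> p0; have [d [r _ pr]] := has_nform_ex p.
have r0 : forall k, r k = 0.
  by apply: nform_eq0 => z zV; rewrite -(mod_rel_meval pr zV) p0.
by move: pr; rewrite /nform !r0 -mpolyC0 base_liftC mpolyC0 !mul0r !addr0.
Qed.

(** Multiplication by b multiplies the coefficients of the normal form by b, and these lie in an
    integral domain. *)
Lemma on_chart_torsion_free p b : b != 0 ->
  (forall z, on_chart z -> (base_lift b * p).@[z] = 0) ->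
  forall z, on_chart z -> p.@[z] = 0.
Proof.
move=> b0 bp0; have [d [r _ pr]] := has_nform_ex p.
have r0 k : r k = 0.
  apply/eqP; have : b * r k = 0.
    move: k; apply: nform_eq0 => z zV; rewrite -(bp0 z zV).
    rewrite mevalM (mod_rel_meval pr zV) -mevalM; congr (_.@[z]).
    by rewrite /nform !base_liftM; ring.
  by move/eqP; rewrite mulf_eq0 (negbTE b0).
move=> z zV; rewrite (mod_rel_meval pr zV) /nform !r0 -mpolyC0 base_liftC mpolyC0.
by rewrite !mul0r !addr0 meval0.
Qed.

End NormalForms.

(** * Dimensions *)

Section Counting.
Variable F : fieldType.

Lemma linear_dependence (A B : finType) (R : A -> B -> F) : (#|B| < #|A|)%N ->
  exists2 l : A -> F, (exists a, l a != 0) & forall b, \sum_a l a * R a b = 0.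
Proof.
move=> AB; pose M : 'M[F]_(#|A|, #|B|) := \matrix_(i, j) R (enum_val i) (enum_val j).
have : kermx M != 0.
  rewrite kermx_eq0 /row_free; apply: contraTneq AB => e.
  by rewrite -leqNgt -e rank_leq_col.
move=> /rowV0Pn[v /sub_kermxP vM v0].
exists (fun a => v 0 (enum_rank a)).
  have [j vj] : exists j, v 0 j != 0.
    by apply/existsP; apply: contraNT v0; rewrite negb_exists => /forallP z;
       apply/eqP/rowP => j; rewrite mxE; apply/eqP; rewrite -[_ == _]negbK.
  by exists (enum_val j); rewrite enum_valK.
move=> b; have /rowP/(_ (enum_rank b)) := vM; rewrite !mxE => e; rewrite -[RHS]e.
rewrite (reindex (@enum_val A A)) /=; last first.
  by exists enum_rank => a _; rewrite ?enum_valK ?enum_rankK.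
by apply: eq_bigr => j _; rewrite mxE enum_valK enum_rankK.
Qed.

Variable X : variety F.
Variable S : X -> Prop.

(** Dimension count: if the monomials of degree less than d in each of the m functions f
    span, on S, a space of dimension O(d^n) with n < m, then the f are dependent. The row e of
    R d holds the coordinates of the monomial with exponents e in a spanning set. *)
Lemma count_not_indep m n K (f : 'I_m -> X -> F) (T : nat -> finType)
    (R : forall d, {ffun 'I_m -> 'I_d} -> T d -> F) :
  (n < m)%N -> (forall d, (0 < d)%N -> (#|T d| <= K * d ^ n)%N) ->
  (forall d (l : {ffun 'I_m -> 'I_d} -> F), (0 < d)%N ->
     (forall t, \sum_e l e * R d e t = 0) ->
     forall x, S x -> \sum_e l e * \prod_i f i x ^+ (e i) = 0) ->
  ~ alg_indep_on S f.
Proof.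
(* K d^n < d^m for this d *)
move=> nm cT lT ind; pose d := K.+1.
have [|l [e0 l0] lR] := @linear_dependence {ffun 'I_m -> 'I_d} (T d) (@R d).
  apply: leq_ltn_trans (cT d isT) _; rewrite card_ffun !card_ord.
  apply: (@leq_trans (d * d ^ n)); first by rewrite ltn_mul2r expn_gt0 /= ltnSn.
  by rewrite -expnS leq_pexp2l.
pose mon (e : {ffun 'I_m -> 'I_d}) : 'X_{1..m} := [multinom (e i : nat) | i < m].
have mon_inj : injective mon.
  move=> e e' /mnmP ee; apply/ffunP => i; apply: val_inj.
  by have := ee i; rewrite !mnmE.
pose p : {mpoly F[m]} := \sum_e l e *: 'X_[mon e].
have p0 : p = 0.
  apply: ind => x Sx; rewrite /p raddf_sum /= -[RHS](lT d l isT lR x Sx).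
  apply: eq_bigr => e _; rewrite mevalZ mevalX; congr (_ * _).
  by apply: eq_bigr => i _; rewrite mnmE.
case/eqP: l0; have := congr1 (mcoeff (mon e0)) p0.
rewrite mcoeff0 /p raddf_sum (bigD1 e0) //= mcoeffZ mcoeffX eqxx mulr1.
rewrite big1 ?addr0 // => e ee0; rewrite mcoeffZ mcoeffX.
by rewrite (inj_eq mon_inj) (negbTE ee0) mulr0.
Qed.

Definition box_coef n D (r : {mpoly F[n]}) (g : {ffun 'I_n -> 'I_D.+1}) : F :=
  r@_[multinom (g i : nat) | i < n].

Lemma box_coef_eq0 n D (r : {mpoly F[n]}) : (msize r <= D.+1)%N ->
  (forall g : {ffun 'I_n -> 'I_D.+1}, box_coef r g = 0) -> r = 0.
Proof.
move=> rD r0; apply/mpolyP => m; rewrite mcoeff0.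
case: (ltnP (mdeg m) (msize r)) => [mr|/msize_mdeg_ge/memN_msupp_eq0 //].
have mD i : (m i < D.+1)%N.
  apply: leq_ltn_trans (leq_trans mr rD).
  by rewrite mdegE (bigD1 i) //= leq_addr.
have := r0 [ffun i => Ordinal (mD i)]; rewrite /box_coef; congr (r@_ _ = 0).
by apply/mnmP => i; rewrite mnmE ffunE.
Qed.

Lemma card_box n D : #|{ffun 'I_n -> 'I_D.+1}| = (D.+1 ^ n)%N.
Proof. by rewrite card_ffun !card_ord. Qed.

End Counting.

Section ChartCoordinates.
Variables (F : numClosedFieldType) (q s c : F).
Hypotheses (qs : q * s = 1) (q_neq_s : q != s) (cE : c = q + s).
Local Notation XC := (closed_subvariety (is_rep_C c)).
Local Notation RC := (rep_C c).
Local Notation chart := (chart q s).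
Local Notation on_chart := (on_chart q s).

Definition rep_chart (y : RC) : 'I_6 -> F := chart (repr y).

Lemma rep_chart_class (N : XC) : rep_chart (git_class N) = chart N.
Proof. by apply/(chart_git qs q_neq_s cE); exact: git_class_repr. Qed.

Lemma rep_chart_inj : injective rep_chart.
Proof.
move=> y y'; rewrite -(git_class_repr y) -(git_class_repr y') !rep_chart_class.
by move/(chart_git qs q_neq_s cE).
Qed.

Lemma rep_chart_on y : on_chart (rep_chart y).
Proof.
have [a1 [a2 [b1 [b2 [u [v [e e1 e2]]]]]]] := chart_point qs q_neq_s cE (repr y).
by rewrite /rep_chart e; apply/on_chartP.
Qed.

Lemma point6_eta (z : 'I_6 -> F) : exists a1 a2 b1 b2 u v, z = point6 a1 a2 b1 b2 u v.
Proof.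
exists (z (@Ordinal 6 0 isT)), (z (@Ordinal 6 1 isT)), (z (@Ordinal 6 2 isT)),
  (z (@Ordinal 6 3 isT)), (z (@Ordinal 6 4 isT)), (z (@Ordinal 6 5 isT)).
by apply/funext; elim/ord6P.
Qed.

Lemma rep_chart_surj z : on_chart z -> exists y, rep_chart y = z.
Proof.
have [a1 [a2 [b1 [b2 [u [v ->]]]]]] := point6_eta z.
move/on_chartP => [e1 e2]; have [N [_ e _ _]] := chart_surj qs q_neq_s cE e1 e2.
by exists (git_class N); rewrite rep_chart_class.
Qed.

Lemma regular_rep_chart (p : {mpoly F[6]}) : regular RC (fun y => p.@[rep_chart y]).
Proof.
have rc i : regular RC (git_descend (fun N => chart N i)).
  exact: regular_git_descend (inv_regular_chart q s c i).
exact: (@regular_meval F 4 (is_rep_C c) _ p (fun i N => git_descend (fun N' => chart N' i) (git_class N))).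
Qed.

Lemma rep_chart_generates f : regular RC f ->
  exists p : {mpoly F[6]}, f = fun y => p.@[rep_chart y].
Proof.
move=> /inv_regular_git_class /(chart_generates qs q_neq_s cE)[p fp].
by exists p; apply/funext => y; rewrite -{1}(git_class_repr y) fp.
Qed.

Definition base_ord (i : 'I_4) : 'I_6 := widen_ord (isT : (4 <= 6)%N) i.

Lemma rep_C_dim_ge : exists2 f : 'I_4 -> RC -> F,
  forall i, regular RC (f i) & alg_indep_on (fun _ : RC => True) f.
Proof.
exists (fun i y => ('X_(base_ord i) : {mpoly F[6]}).@[rep_chart y]).
  by move=> i; exact: regular_rep_chart.
(* a polynomial in a1, a2, b1, b2 is its own normal form *)
move=> p p0; pose r (k : 'I_4) : {mpoly F[4]} := nth 0 [:: p; 0; 0; 0] k.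
have := @nform_eq0 F q s qs q_neq_s r _ (@Ordinal 4 0 isT); apply.
move=> z /rep_chart_surj[y <-]; rewrite /nform /r /= -mpolyC0 base_liftC mpolyC0.
rewrite !mul0r !addr0 base_lift_meval -[RHS](p0 y I).
by apply: meval_eq => i; rewrite mevalXU.
Qed.

Lemma bound_ex n (P : 'I_n -> nat -> Prop) : (forall i, exists k, P i k) ->
  exists k : 'I_n -> nat, forall i, P i (k i).
Proof.
by move=> H; exists (fun i => sval (cid (H i))) => i; case: cid.
Qed.

Lemma prod_has_nform m (p : 'I_m -> {mpoly F[6]}) (k : 'I_m -> nat) (e : 'I_m -> nat) :
  (forall i d r, has_nform q s d r -> has_nform q s (d + k i) (p i * r)) ->
  has_nform q s (\sum_i k i * e i) (\prod_i p i ^+ e i).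
Proof.
move=> H; have Hn i n d r : has_nform q s d r -> has_nform q s (k i * n + d) (p i ^+ n * r).
  move=> dr; elim: n => [|n IHn]; first by rewrite muln0 mul1r.
  rewrite exprS mulnS -mulrA -addnA addnC; exact: H.
elim: (index_enum _) => [|i l IHl]; first by rewrite !big_nil; exact: has_nform1.
by rewrite !big_cons; exact: Hn.
Qed.

(** The monomials of degree less than d in each function have normal forms of degree O(d), which
    form a space of dimension O(d^4). *)
Lemma rep_C_dim_le m (f : 'I_m -> RC -> F) : (forall i, regular RC (f i)) ->
  alg_indep_on (fun _ : RC => True) f -> (m <= 4)%N.
Proof.
move=> rf; rewrite leqNgt => find; apply/negP => m4; move: find.
have [p fp] : exists p : 'I_m -> {mpoly F[6]}, forall i, f i = fun y => (p i).@[rep_chart y].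
  by exists (fun i => sval (cid (rep_chart_generates (rf i)))) => i; case: cid.
have [k kp] := bound_ex (fun i => has_nformM qs (p i)).
pose K := (\sum_i k i)%N.
have nf d (e : {ffun 'I_m -> 'I_d}) : has_nform q s (K * d) (\prod_i p i ^+ e i).
  apply: has_nformW (prod_has_nform _ kp); rewrite /K big_distrl leq_sum // => i _.
  by rewrite leq_mul2l (ltnW (ltn_ord _)) orbT.
pose r d e := s2val (cid2 (nf d e)).
have rdeg d e j : deg_le (K * d) (r d e j) := s2valP (cid2 (nf d e)) j.
have rmod d (e : {ffun 'I_m -> 'I_d}) : mod_rel q s (\prod_i p i ^+ e i) (nform (r d e)) :=
  s2valP' (cid2 (nf d e)).
apply: (@count_not_indep _ _ _ m 4 (4 * K.+1 ^ 4) f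
  (fun d => ('I_4 * {ffun 'I_4 -> 'I_(K * d).+1})%type)
  (fun d e t => box_coef (r d e t.1) t.2)) => // [d d0|d l d0 lR y _].
  rewrite card_prod card_box card_ord -mulnA leq_mul2l /= -expnMn leq_exp2r //.
  by rewrite mulSn addnC -addn1 leq_add2l.
have r0 j : \sum_e l e *: r d e j = 0.
  apply: (@box_coef_eq0 _ _ (K * d)).
    elim/big_ind: _ => [|a b|e _]; first by rewrite msize0.
      exact: deg_leD.
    by apply: leq_trans (msizeZ_le _ _) (rdeg d e j).
  move=> g; rewrite -[RHS](lR (j, g)) /box_coef raddf_sum /=.
  by apply: eq_bigr => e _; rewrite mcoeffZ.
have -> : \sum_e l e * \prod_i f i y ^+ e i = \sum_e l e * (nform (r d e)).@[rep_chart y].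
  apply: eq_bigr => e _; congr (_ * _).
  rewrite -(mod_rel_meval (rmod d e) (rep_chart_on y)) rmorph_prod /=.
  by apply: eq_bigr => i _; rewrite rmorphXn /= fp.
have -> : \sum_e l e * (nform (r d e)).@[rep_chart y] =
    (nform (fun j => \sum_e l e *: r d e j)).@[rep_chart y].
  have ms v (g : {ffun 'I_m -> 'I_d} -> {mpoly F[4]}) :
      (\sum_e l e *: g e).@[v] = \sum_e l e * (g e).@[v].
    by rewrite (raddf_sum (meval v)); apply: eq_bigr => e _; rewrite /= mevalZ.
  under eq_bigr do rewrite /nform !mevalD !mevalM !base_lift_meval.
  rewrite /nform !mevalD !mevalM !base_lift_meval !ms.
  move: ((@var6 F 4 isT).@[_]) ((@var6 F 5 isT).@[_]) => u v.
  by rewrite !mulr_suml -!big_split; apply: eq_bigr => e _ /=; ring.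
by rewrite /nform !r0 /base_lift comp_mpoly0 !mul0r !addr0 meval0.
Qed.

Lemma rep_C_dim : dim_eq (fun _ : RC => True) 4.
Proof. by split; [exact: rep_C_dim_ge | exact: rep_C_dim_le]. Qed.

Lemma diag_chartP y : diagonal_rep y <-> diag_chart (rep_chart y).
Proof.
split=> [[N -> dN]|[a a0 [b b0 e]]].
  rewrite rep_chart_class.
  have offd k : (k < 4)%N -> (val N)`_k 0 1 = 0 /\ (val N)`_k 1 0 = 0.
    move=> k4; have /is_diag_mxP d := dN (Ordinal k4).
    by rewrite (tnth_nth 0) /= in d; split; apply: d.
  have [A01 A10] := offd 0%N isT; have [B01 B10] := offd 1%N isT.
  have [C01 C10] := offd 2%N isT.
  have dA := rep_C_det N (isT : (0 < 4)%N); have dB := rep_C_det N (isT : (1 < 4)%N).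
  have dC := rep_C_det N (isT : (2 < 4)%N); have [tC _] := rep_C_tr N.
  have C2 : (val N)`_2 = diag_qs q s \/ (val N)`_2 = diag_qs s q.
    move: dC (etrans tC cE); rewrite det_mx2 tr2 C01 C10 mulr0 subr0 => dC' tC'.
    have : ((val N)`_2 0 0 - q) * ((val N)`_2 0 0 - s) == 0.
      rewrite (_ : _ * _ = (val N)`_2 0 0 * (val N)`_2 0 0 -
        (q + s) * (val N)`_2 0 0 + q * s); last by ring.
      by rewrite -tC' qs -dC'; apply/eqP; ring.
    rewrite mulf_eq0 !subr_eq0 => /orP[]/eqP e; [left | right];
      rewrite (mx2_eta (val N)`_2) C01 C10 e /diag_qs; congr mx2;
      apply: (addrI ((val N)`_2 0 0)); rewrite tC' e //; exact: addrC.
  have A0 : (val N)`_0 0 0 * (val N)`_0 1 1 = 1 by rewrite -dA det_mx2 A01 mul0r subr0.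
  have B0 : (val N)`_1 0 0 * (val N)`_1 1 1 = 1 by rewrite -dB det_mx2 B01 mul0r subr0.
  have unit (x x' : F) : x * x' = 1 -> x != 0 /\ x' = x^-1.
    move=> xx; have x0 : x != 0.
      by apply/eqP => x0; move/eqP: xx; rewrite x0 mul0r eq_sym oner_eq0.
    by split=> //; apply: (mulfI x0); rewrite mulfV.
  (* in the second case the chart, adapted to diag (q, s), reads the entries in the other order *)
  case: C2 => eC.
    have [a0 ea] := unit _ _ A0; have [b0 eb] := unit _ _ B0.
    exists ((val N)`_0 0 0) => //; exists ((val N)`_1 0 0) => //.
    by rewrite chart_slice // A01 B01 !mul0r ea eb.
  have [a0 ea] := unit _ _ (etrans (mulrC _ _) A0).
  have [b0 eb] := unit _ _ (etrans (mulrC _ _) B0).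
  exists ((val N)`_0 1 1) => //; exists ((val N)`_1 1 1) => //.
  have dp A : diag_part q s (diag_qs s q) A = A 1 1.
    rewrite /diag_part {1}(mx2_eta A) mx2M tr_mx2 tr2.
    by apply: (canLR (mulfK (qBs_neq0 q_neq_s))); ring.
  apply/funext; elim/ord6P; rewrite /chart /point6 eC /= !dp ?tr2 ?mul2E ?A10 ?B10 -?ea -?eb;
    ring.
exists (diag_rep qs cE a0 b0).
  by apply: rep_chart_inj; rewrite e rep_chart_class chart_diag_rep.
move=> k; rewrite /diag_rep SubK; apply/is_diag_mxP => i j ij.
case: k => [[|[|[|[|//]]]] Hk]; rewrite (tnth_nth 0) /=;
by case: (ord2P i) (ord2P j) ij => -> [] -> //=; rewrite ?mx2E.
Qed.

Lemma on_chart_diag a b : a != 0 -> b != 0 -> on_chart (point6 a a^-1 b b^-1 0 0).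
Proof.
move=> a0 b0; rewrite -(chart_diag_rep qs q_neq_s cE a0 b0) -rep_chart_class.
exact: rep_chart_on.
Qed.

Definition point2 (a b : F) (i : 'I_2) : F := nth 0 [:: a; b] i.

(** Clearing denominators turns a function on the diagonal representations, a Laurent polynomial
    in the eigenvalues of A and B, into a polynomial of degree linear in d. *)
Definition has_dform d (p : {mpoly F[6]}) : Prop := exists2 r : {mpoly F[2]},
  deg_le (4 * d) r & forall a b, a != 0 -> b != 0 ->
    (a * b) ^+ d * p.@[point6 a a^-1 b b^-1 0 0] = r.@[point2 a b].

Lemma has_dformM d d' p p' : has_dform d p -> has_dform d' p' ->
  has_dform (d + d') (p * p').
Proof.
move=> [r dr rE] [r' dr' rE']; exists (r * r'); first by rewrite mulnDr; exact: deg_leM.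
by move=> a b a0 b0; rewrite !mevalM -rE // -rE' // exprD; ring.
Qed.

Lemma has_dform1 d : has_dform d 1.
Proof.
exists (('X_0 * 'X_1) ^+ d).
  elim: d => [|d IHd]; first by rewrite expr0 -mpolyC1; exact: deg_leC.
  rewrite exprS mulnS; apply: deg_leM => //; apply: (@deg_leM _ _ 2 2);
  by apply: deg_leW (deg_leXU _ _).
by move=> a b a0 b0; rewrite meval1 mulr1 rmorphXn /= mevalM !mevalXU.
Qed.

Lemma has_dformW d d' p : (d <= d')%N -> has_dform d p -> has_dform d' p.
Proof.
move=> /subnKC <- dp; rewrite -[p]mulr1; apply: has_dformM dp _; exact: has_dform1.
Qed.

Lemma has_dform_ex p : exists d, has_dform d p.
Proof.
elim/mpoly_alg_ind: p => [x|i|p r [d dp] [d' dr]|p r [d dp] [d' dr]].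
- by exists 0%N, x%:MP => [|a b _ _]; [exact: deg_leC | rewrite !mevalC mul1r].
- exists 1%N; have dX (j k : 'I_2) : deg_le 4 ('X_j * ('X_k * 'X_k) : {mpoly F[2]}).
    apply: (@deg_leW _ _ 3) => //; apply: (@deg_leM _ _ 1 2); first exact: deg_leXU.
    by apply: (@deg_leM _ _ 1 1); exact: deg_leXU.
  have dX1 (j : 'I_2) : deg_le 4 ('X_j : {mpoly F[2]}) by apply: deg_leW (deg_leXU _ _).
  elim/ord6P: i.
  + exists ('X_1 * ('X_0 * 'X_0)) => // a b a0 b0.
    by rewrite !mevalM !mevalXU /point2 /point6 /=; ring.
  + by exists 'X_1 => // a b a0 b0; rewrite !mevalXU /point2 /point6 /=; field.
  + exists ('X_0 * ('X_1 * 'X_1)) => // a b a0 b0.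
    by rewrite !mevalM !mevalXU /point2 /point6 /=; ring.
  + by exists 'X_0 => // a b a0 b0; rewrite !mevalXU /point2 /point6 /=; field.
  + exists 0 => [|a b _ _]; first by rewrite -mpolyC0; exact: deg_leC.
    by rewrite meval0 mevalXU mulr0.
  + exists 0 => [|a b _ _]; first by rewrite -mpolyC0; exact: deg_leC.
    by rewrite meval0 mevalXU mulr0.
- have [r1 d1 e1] := has_dformW (leq_addr d' d) dp.
  have [r2 d2 e2] := has_dformW (leq_addl d d') dr.
  exists (d + d')%N, (r1 + r2); first exact: deg_leD.
  by move=> a b a0 b0; rewrite !mevalD mulrDr e1 ?e2.
- by exists (d + d')%N; exact: has_dformM.
Qed.

Lemma prod_has_dform m (p : 'I_m -> {mpoly F[6]}) (k : 'I_m -> nat) (e : 'I_m -> nat) :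
  (forall i, has_dform (k i) (p i)) ->
  has_dform (\sum_i k i * e i) (\prod_i p i ^+ e i).
Proof.
move=> H; elim: (index_enum _) => [|i l IHl]; first by rewrite !big_nil; exact: has_dform1.
rewrite !big_cons; apply: has_dformM => //.
elim: (e i) => [|n IHn]; first by rewrite muln0; exact: has_dform1.
by rewrite exprS mulnS; exact: has_dformM.
Qed.

Lemma diagonal_dim_ge : exists2 f : 'I_2 -> RC -> F,
  forall i, regular RC (f i) & alg_indep_on (@diagonal_rep _ c) f.
Proof.
pose j (i : 'I_2) : 'I_6 := if i == 0 then @Ordinal 6 0 isT else @Ordinal 6 2 isT.
exists (fun i y => ('X_(j i) : {mpoly F[6]}).@[rep_chart y]).
  by move=> i; exact: regular_rep_chart.
move=> p p0; suff /eqP : p * ('X_0 * 'X_1) = 0.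
  have X0 (i : 'I_2) : 'X_i != 0 :> {mpoly F[2]}.
    by rewrite -msize_poly_eq0 msizeX.
  by rewrite !mulf_eq0 !(negbTE (X0 _)) !orbF => /eqP.
apply: mpoly_eq0_meval => v; rewrite !mevalM !mevalXU.
case: (eqVneq (v 0) 0) => [->|v0]; first by rewrite mul0r mulr0.
case: (eqVneq (v 1) 0) => [->|v1]; first by rewrite !mulr0.
have [y ey] := rep_chart_surj (on_chart_diag v0 v1).
suff -> : p.@[v] = 0 by rewrite mul0r.
rewrite -(p0 y); first by apply: meval_eq => i; rewrite mevalXU ey; case: (ord2P i) => ->.
by apply/diag_chartP; rewrite ey; exists (v 0) => //; exists (v 1).
Qed.

Lemma diagonal_dim_le m (f : 'I_m -> RC -> F) : (forall i, regular RC (f i)) ->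
  alg_indep_on (@diagonal_rep _ c) f -> (m <= 2)%N.
Proof.
move=> rf; rewrite leqNgt => find; apply/negP => m2; move: find.
have [p fp] : exists p : 'I_m -> {mpoly F[6]}, forall i, f i = fun y => (p i).@[rep_chart y].
  by exists (fun i => sval (cid (rep_chart_generates (rf i)))) => i; case: cid.
have [k kp] := bound_ex (fun i => has_dform_ex (p i)).
pose K := (\sum_i k i)%N.
have nf d (e : {ffun 'I_m -> 'I_d}) : has_dform (K * d) (\prod_i p i ^+ e i).
  apply: has_dformW (prod_has_dform _ kp); rewrite /K big_distrl leq_sum // => i _.
  by rewrite leq_mul2l (ltnW (ltn_ord _)) orbT.
pose r d e := s2val (cid2 (nf d e)).
have rdeg d e : deg_le (4 * (K * d)) (r d e) := s2valP (cid2 (nf d e)).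
have rE d (e : {ffun 'I_m -> 'I_d}) : forall a b, a != 0 -> b != 0 ->
    (a * b) ^+ (K * d) * (\prod_i p i ^+ e i).@[point6 a a^-1 b b^-1 0 0] =
    (r d e).@[point2 a b] := s2valP' (cid2 (nf d e)).
apply: (@count_not_indep _ _ _ m 2 ((4 * K).+1 ^ 2) f
  (fun d => {ffun 'I_2 -> 'I_(4 * (K * d)).+1})
  (fun d e t => box_coef (r d e) t)) => // [d d0|d l d0 lR y].
  by rewrite card_box -expnMn leq_exp2r // mulnA (mulSn (4 * K) d) -[X in (X < _)%N]add0n ltn_add2r.
have r0 : \sum_e l e *: r d e = 0.
  apply: (@box_coef_eq0 _ _ (4 * (K * d))).
    elim/big_ind: _ => [|a b|e _]; first by rewrite msize0.
      exact: deg_leD.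
    by apply: leq_trans (msizeZ_le _ _) (rdeg d e).
  move=> g; rewrite -[RHS](lR g) /box_coef raddf_sum /=.
  by apply: eq_bigr => e _; rewrite mcoeffZ.
move=> /diag_chartP[a a0 [b b0 ey]].
have abn0 : (a * b) ^+ (K * d) != 0 by rewrite expf_neq0 // mulf_neq0.
have e0 : (\sum_e l e *: r d e).@[point2 a b] = 0 by rewrite r0 meval0.
apply: (mulfI abn0); rewrite mulr0 -[RHS]e0.
rewrite (raddf_sum (meval _)) mulr_sumr; apply: eq_bigr => e _.
rewrite /= mevalZ -rE // mulrCA; congr (_ * (_ * _)).
rewrite rmorph_prod /=; apply: eq_bigr => i _.
by rewrite rmorphXn /= fp ey.
Qed.

Lemma diagonal_dim : dim_eq (@diagonal_rep _ c) 2.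
Proof. by split; [exact: diagonal_dim_ge | exact: diagonal_dim_le]. Qed.

End ChartCoordinates.

(** * Tangent spaces and the singular locus *)

Section Centralizer.
Variable F : fieldType.

Lemma centralizer_scalar_span (L X : 'M[F]_2) : ~ (exists k, L = k%:A) -> X * L = L * X ->
  exists k l, X = k%:A + l *: L.
Proof.
move=> ns; rewrite (mx2_eta X) {1 2}(mx2_eta L) !mx2M.
move: (X 0 0) (X 0 1) (X 1 0) (X 1 1) => x0 x1 x2 x3 /mx2_inj[e1 e2 e3 _].
set a := L 0 0 in e1 e2 e3; set b := L 0 1 in e1 e2 e3.
set c := L 1 0 in e1 e2 e3; set d := L 1 1 in e1 e2 e3.
suff [l [l1 l2 l3]] : exists l, [/\ x1 = l * b, x2 = l * c & x0 - x3 = l * (a - d)].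
  exists (x0 - l * a), l; rewrite mx2_1 mx2Z (mx2_eta L) mx2Z mx2D -/a -/b -/c -/d l1 l2.
  congr mx2; try ring.
  by rewrite (_ : _ + l * d = x0 - l * (a - d)) -?l3; [ring | rewrite l3; ring].
have h1 : x1 * c = b * x2 by apply: (addrI (x0 * a)); rewrite e1; ring.
have h2 : (x0 - x3) * b = x1 * (a - d).
  have e : x0 * b = a * x1 + b * x3 - x1 * d by rewrite -e2 addrK.
  by ring: e.
have h3 : (x0 - x3) * c = x2 * (a - d).
  have e : c * x0 = x2 * a + x3 * c - d * x2 by rewrite e3 addrK.
  by ring: e.
case: (eqVneq b 0) => [b0|b0]; last first.
  exists (x1 / b); split; first by rewrite mulfVK.
    by rewrite mulrAC h1 mulrAC mulfV ?mul1r.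
  by apply: (mulIf b0); rewrite h2; field.
case: (eqVneq c 0) => [c0|c0]; last first.
  exists (x2 / c); split; last by apply: (mulIf c0); rewrite h3; field.
    by apply: (mulIf c0); rewrite h1; field.
  by rewrite mulfVK.
have ad : a - d != 0.
  apply/eqP => /eqP; rewrite subr_eq0 => /eqP ad; apply: ns; exists d.
  by rewrite mx2_1 mx2Z (mx2_eta L) -/a -/b -/c -/d b0 c0 ad; congr mx2; ring.
exists ((x0 - x3) / (a - d)); rewrite mulfVK //; split=> //; apply: (mulIf ad).
  by rewrite -h2 b0; ring.
by rewrite -h3 c0; ring.
Qed.


Lemma centralizer_comm (L X Y : 'M[F]_2) : ~ (exists k, L = k%:A) ->
  X * L = L * X -> Y * L = L * Y -> X * Y = Y * X.
Proof.
move=> ns XL /(centralizer_scalar_span ns)[k [l ->]].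
by rewrite mulrDr mulrDl -!scalerAr -!scalerAl mulr1 mul1r XL.
Qed.

End Centralizer.

Section ChartDifferential.
Variables (F : numClosedFieldType) (q s : F).
Hypotheses (qs : q * s = 1) (q_neq_s : q != s).

Section Formulas.
Variables a1 a2 b1 b2 u v d1 d2 e1 e2 f g : F.

(** The differentials of the two equations of the chart at (a1, a2, b1, b2, u, v) in the direction
    (d1, d2, e1, e2, f, g). *)
Definition d_prod : F := f * v + u * g -
  ((d1 * a2 + a1 * d2) * (b1 * b2 - 1) + (a1 * a2 - 1) * (e1 * b2 + b1 * e2)).

Definition d_tr : F :=
  let al := a1 * a2 - 1 in let be := b1 * b2 - 1 in
  let dal := d1 * a2 + a1 * d2 in let dbe := e1 * b2 + b1 * e2 in
  s * ((d1 * b1 + a1 * e1 + f) * (a2 * b2 + u) + (a1 * b1 + u) * (d2 * b2 + a2 * e2 + f) -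
       (2 * (a1 * d1) * be + a1 * a1 * dbe + (d1 * b2 + a1 * e2) * v + a1 * b2 * g +
        (d1 * b2 + a1 * e2) * u + a1 * b2 * f + 2 * (b2 * e2) * al + b2 * b2 * dal)) +
  q * ((d1 * b1 + a1 * e1 + g) * (a2 * b2 + v) + (a1 * b1 + v) * (d2 * b2 + a2 * e2 + g) -
       (2 * (b1 * e1) * al + b1 * b1 * dal + (d2 * b1 + a2 * e1) * v + a2 * b1 * g +
        (d2 * b1 + a2 * e1) * u + a2 * b1 * f + 2 * (a2 * d2) * be + a2 * a2 * dbe)).
End Formulas.

Section Variation.
Variables a1 a2 b1 b2 x y z w : F.
Hypotheses (hA : x * y = a1 * a2 - 1) (hB : z * w = b1 * b2 - 1).
Let A := mx2 a1 x y a2.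
Let B := mx2 b1 z w b2.
Let C := mx2 q 0 0 s.
Let Ci := mx2 s 0 0 q.

(** The gradients of \tr (C^-1 A B A^-1 B^-1) for the variations A -> (1 + xi) A and
    B -> B (1 + eta). *)
Definition grad_A := A * B * adj2 A * adj2 B * Ci - adj2 B * Ci * A * B * adj2 A.
Definition grad_B := adj2 A * adj2 B * Ci * A * B - adj2 B * Ci * A * B * adj2 A.

Let dT := d_tr a1 a2 b1 b2 (x * w) (z * y).

Lemma grad_AE : [/\ grad_A 1 0 = dT y 0 0 0 (a2 * w) 0,
  grad_A 0 1 = dT 0 x 0 0 0 (z * a1),
  grad_A 0 0 - grad_A 1 1 = dT a1 (- a2) 0 0 (x * w) (- (z * y))
  & grad_A 0 0 + grad_A 1 1 = 0].
Proof.
rewrite /grad_A /A /B /Ci !adj2_mx2 !mx2M mx2N mx2D !mx2E /dT /d_tr /=.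
by split; ring: hA hB.
Qed.

Lemma grad_BE : [/\ grad_B 1 0 = dT 0 0 0 w 0 (b1 * y),
  grad_B 0 1 = dT 0 0 z 0 (x * b2) 0,
  grad_B 0 0 - grad_B 1 1 = dT 0 0 b1 (- b2) (x * w) (- (z * y))
  & grad_B 0 0 + grad_B 1 1 = 0].
Proof.
rewrite /grad_B /A /B /Ci !adj2_mx2 !mx2M mx2N mx2D !mx2E /dT /d_tr /=.
by split; ring: hA hB.
Qed.
End Variation.

(** At a critical point of \tr L on SL_2 x SL_2, where L = C^-1 A B A^-1 B^-1, the matrices B C,
    B A B^-1 and C^-1 A commute with L, hence so do A, B and C. As L is not scalar, its
    centralizer is commutative, so A and B commute with the diagonal matrix C. *)
Lemma critical_diag (A B : 'M[F]_2) : \det A = 1 -> \det B = 1 ->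
  let Ci := diag_qs s q in
  \tr (Ci * A * B * adj2 A * adj2 B) = q + s ->
  A * B * adj2 A * adj2 B * Ci = adj2 B * Ci * A * B * adj2 A ->
  adj2 A * adj2 B * Ci * A * B = adj2 B * Ci * A * B * adj2 A ->
  [/\ A 0 1 = 0, A 1 0 = 0, B 0 1 = 0 & B 1 0 = 0].
Proof.
move=> dA dB Ci; set L := Ci * A * B * adj2 A * adj2 B => tL gA gB.
pose C := diag_qs q s.
have CCi : C * Ci = 1.
  by rewrite /C /Ci /diag_qs mx2M mx2_1 [s * q]mulrC qs; congr mx2; ring.
have CiC : Ci * C = 1.
  by rewrite /C /Ci /diag_qs mx2M mx2_1 [s * q]mulrC qs; congr mx2; ring.
have AA (X : 'M[F]_2) : X * A * adj2 A = X by rewrite -mulrA mul_2adj dA scale1r mulr1.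
have AA' (X : 'M[F]_2) : X * adj2 A * A = X by rewrite -mulrA mul_adj2 dA scale1r mulr1.
have BB (X : 'M[F]_2) : X * B * adj2 B = X by rewrite -mulrA mul_2adj dB scale1r mulr1.
have BB' (X : 'M[F]_2) : X * adj2 B * B = X by rewrite -mulrA mul_adj2 dB scale1r mulr1.
have CC (X : 'M[F]_2) : X * C * Ci = X by rewrite -mulrA CCi mulr1.
have CC' (X : 'M[F]_2) : X * Ci * C = X by rewrite -mulrA CiC mulr1.
have iB : adj2 B * B = 1 by rewrite mul_adj2 dB scale1r.
have Bi : B * adj2 B = 1 by rewrite mul_2adj dB scale1r.
have Ai : A * adj2 A = 1 by rewrite mul_2adj dA scale1r.
(* a scalar L = k would have k^2 = 1 and 2 k = q + s, so (q - s)^2 = 0 *)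
have nsL : ~ exists k, L = k%:A.
  move=> [k Lk]; case/eqP: q_neq_s; apply/eqP; rewrite -subr_eq0 -sqrf_eq0.
  have dL : k * k = 1.
    have : \det L = 1.
      rewrite !det2M !det_adj2 dA dB !mulr1 /Ci /diag_qs det_mx2E mulr0 subr0.
      by rewrite mulrC.
    by rewrite Lk mx2_1 mx2Z det_mx2E !mulr1 mulr0 mul0r subr0.
  have tk : q + s = 2 * k by rewrite -tL Lk mx2_1 mx2Z tr_mx2; ring.
  rewrite (_ : _ ^+ 2 = (q + s) * (q + s) - 4 * (q * s)); last by ring.
  rewrite tk qs (_ : _ - _ = 4 * (k * k - 1)); last by ring.
  by rewrite dL subrr mulr0.
pose comm (X : 'M[F]_2) := X * L = L * X.
have commM X Y : comm X -> comm Y -> comm (X * Y).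
  by rewrite /comm => eX eY; rewrite -mulrA eY mulrA eX mulrA.
have comm_adj X : comm X -> comm (adj2 X).
  by rewrite /comm adj2E mulrBl mulrBr => ->; rewrite -scalerAl -scalerAr mul1r mulr1.
have Z1 : comm (B * C).
  have e : B * (A * B * adj2 A * adj2 B * Ci) = L * B.
    by rewrite gA !mulrA Bi mul1r /L BB'.
  rewrite /comm; have -> : L * (B * C) = B * (A * B * adj2 A * adj2 B * Ci) * C by rewrite e mulrA.
  by rewrite /L !mulrA CC CC'.
have Z2 : comm (B * A * adj2 B).
  have R : adj2 B * Ci * A * B * A = A * adj2 B * Ci * A * B.
    have R0 : adj2 B * Ci * A * B = A * (adj2 B * Ci * A * B * adj2 A).
      by rewrite -gB !mulrA Ai mul1r.
    by rewrite {1}R0 !mulrA AA'.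
  rewrite /comm /L; have -> : B * A * adj2 B * (Ci * A * B * adj2 A * adj2 B) =
      B * (A * adj2 B * Ci * A * B) * adj2 A * adj2 B by rewrite !mulrA.
  by rewrite -R !mulrA Bi mul1r AA BB' AA'.
have Z3 : comm (Ci * A).
  have -> : Ci * A = L * (B * A * adj2 B) by rewrite /L !mulrA BB' AA' BB.
  by apply: commM Z2; rewrite /comm.
have ZBA : comm (B * A).
  have -> : B * A = (B * C) * (Ci * A) by rewrite !mulrA CC.
  exact: commM.
have ZB : comm B.
  have -> : B = adj2 (B * A * adj2 B) * (B * A).
    rewrite !adj2M adj2K !mulrA -(mulrA (B * adj2 A)) iB mulr1.
    by rewrite -mulrA mul_adj2 dA scale1r mulr1.
  by apply: commM => //; exact: comm_adj.
have ZA : comm A.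
  have -> : A = adj2 B * (B * A) by rewrite mulrA iB mul1r.
  by apply: commM => //; exact: comm_adj.
have ZC : comm C.
  have -> : C = adj2 B * (B * C) by rewrite mulrA iB mul1r.
  by apply: commM => //; exact: comm_adj.
have diag (X : 'M[F]_2) : comm X -> X 0 1 = 0 /\ X 1 0 = 0.
  move=> /(centralizer_comm nsL)/(_ ZC); rewrite (mx2_eta X) /C /diag_qs !mx2M !mx2E.
  move=> /mx2_inj[_ e1 e2 _].
  have z k : (q - s) * k = 0 -> k = 0.
    by move/eqP; rewrite mulf_eq0 (negbTE (qBs_neq0 q_neq_s)) => /eqP.
  split; apply: z; rewrite mulrBl; apply/eqP; rewrite subr_eq0; apply/eqP.
    by move: e1; rewrite mulr0 mul0r add0r addr0 [s * _]mulrC => ->.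
  by move: e2; rewrite mulr0 mul0r addr0 add0r [q * _]mulrC => ->.
by have [? ?] := diag A ZA; have [? ?] := diag B ZB.
Qed.

End ChartDifferential.

Section DirectionalDerivative.
Variables (F : fieldType) (n : nat) (z dz : 'I_n -> F).

Definition der (p : {mpoly F[n]}) : F := \sum_i dz i * (p^`M(i)).@[z].

Lemma derC a : der a%:MP = 0.
Proof. by apply: big1 => i _; rewrite mderivC meval0 mulr0. Qed.

Lemma derXU i : der 'X_i = dz i.
Proof.
have UU : (U_(i) - U_(i) = 0 :> 'X_{1..n})%MM.
  by apply/mnmP => j; rewrite mnmBE subnn mnm0E.
rewrite /der (bigD1 i) //= mderivX mnm1E eqxx scale1r UU mpolyX0 meval1 mulr1.
rewrite big1 ?addr0 // => j ji; rewrite mderivX mnm1E eq_sym (negbTE ji) scale0r.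
by rewrite meval0 mulr0.
Qed.

Lemma derD p r : der (p + r) = der p + der r.
Proof.
rewrite /der -big_split; apply: eq_bigr => i _.
by rewrite mderivD mevalD mulrDr.
Qed.

Lemma derN p : der (- p) = - der p.
Proof.
rewrite /der -sumrN; apply: eq_bigr => i _.
by rewrite mderivN mevalN mulrN.
Qed.

Lemma derM p r : der (p * r) = p.@[z] * der r + r.@[z] * der p.
Proof.
rewrite /der !mulr_sumr -big_split; apply: eq_bigr => i _.
by rewrite mderivM mevalD !mevalM /=; ring.
Qed.
End DirectionalDerivative.

Section TangentSpaces.
Variables (F : numClosedFieldType) (q s c : F).
Hypotheses (qs : q * s = 1) (q_neq_s : q != s) (cE : c = q + s).
Local Notation RC := (rep_C c).
Local Notation rep_chart := (@rep_chart F q s c).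
Local Notation rel_prodF := (rel_prod F).
Local Notation rel_trqs := (rel_tr q s).

Lemma der_rel_prod a1 a2 b1 b2 u v d1 d2 e1 e2 f g :
  der (point6 a1 a2 b1 b2 u v) (point6 d1 d2 e1 e2 f g) rel_prodF =
  d_prod a1 a2 b1 b2 u v d1 d2 e1 e2 f g.
Proof.
rewrite /rel_prod /chart_prod -mpolyC1 /var6.
rewrite !(derD, derN, derM, derC, derXU, mevalD, mevalN, mevalM, mevalC, mevalXU).
by rewrite /point6 /d_prod /=; ring.
Qed.

Lemma der_rel_tr a1 a2 b1 b2 u v d1 d2 e1 e2 f g :
  der (point6 a1 a2 b1 b2 u v) (point6 d1 d2 e1 e2 f g) rel_trqs =
  d_tr q s a1 a2 b1 b2 u v d1 d2 e1 e2 f g.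
Proof.
rewrite /rel_tr /chart_eq -mpolyC1 /var6 /=.
rewrite !(derD, derN, derM, derC, derXU, mevalD, mevalN, mevalM, mevalC, mevalXU).
by rewrite /point6 /d_tr /=; ring.
Qed.

Lemma mod_rel_der z dz p p' : on_chart q s z -> der z dz rel_prodF = 0 ->
  der z dz rel_trqs = 0 -> mod_rel q s p p' -> der z dz p = der z dz p'.
Proof.
move=> [z1 z2] d1 d2 [g1 [g2 ->]].
by rewrite derD derD !derM d1 d2 z1 z2 !(mulr0, mul0r, addr0).
Qed.

(** The directions used when m <> 0 come from variations of A and B in SL_2, which preserve the
    first equation; the second one is then critical for such variations. *)
Lemma dependent_diag z (l m : F) : on_chart q s z -> (l != 0) || (m != 0) ->
  (forall dz, l * der z dz rel_prodF + m * der z dz rel_trqs = 0) -> diag_chart z.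
Proof.
have [a1 [a2 [b1 [b2 [u [v ->]]]]]] := point6_eta z; move=> /on_chartP[uv E0] lm H.
have {}H d1 d2 e1 e2 f g : l * d_prod a1 a2 b1 b2 u v d1 d2 e1 e2 f g +
    m * d_tr q s a1 a2 b1 b2 u v d1 d2 e1 e2 f g = 0.
  by rewrite -der_rel_prod -der_rel_tr.
have fin : a1 * a2 = 1 -> b1 * b2 = 1 -> u = 0 -> v = 0 ->
    diag_chart (point6 a1 a2 b1 b2 u v).
  have unit (x x' : F) : x * x' = 1 -> x != 0 /\ x' = x^-1.
    move=> xx; have x0 : x != 0.
      by apply/eqP => x0; move/eqP: xx; rewrite x0 mul0r eq_sym oner_eq0.
    by split=> //; apply: (mulfI x0); rewrite mulfV.
  move=> /unit[a0 ->] /unit[b0 ->] -> ->.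
  by exists a1 => //; exists b1.
case: (eqVneq m 0) => [m0|m0].
  move: lm; rewrite m0 eqxx orbF => l0.
  have {}H d1 d2 e1 e2 f g : d_prod a1 a2 b1 b2 u v d1 d2 e1 e2 f g = 0.
    by apply: (mulfI l0); rewrite mulr0 -[RHS](H d1 d2 e1 e2 f g) m0 mul0r addr0.
  have v0 : v = 0 by rewrite -(H 0 0 0 0 1 0) /d_prod; ring.
  have u0 : u = 0 by rewrite -(H 0 0 0 0 0 1) /d_prod; ring.
  have e1 : a2 * (b1 * b2 - 1) = 0.
    by rewrite -[LHS]opprK -[RHS]oppr0 -(H 1 0 0 0 0 0) /d_prod; ring.
  have e2 : (a1 * a2 - 1) * b2 = 0.
    by rewrite -[LHS]opprK -[RHS]oppr0 -(H 0 0 1 0 0 0) /d_prod; ring.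
  have al : (a1 * a2 - 1) * (b1 * b2 - 1) = 0 by rewrite -[LHS]uv u0 mul0r.
  have b0 : b1 * b2 - 1 = 0.
    rewrite -[LHS]mul1r (_ : 1 * _ = a1 * (a2 * (b1 * b2 - 1)) -
      (a1 * a2 - 1) * (b1 * b2 - 1)); last by ring.
    by rewrite e1 al mulr0 subr0.
  have a0 : a1 * a2 - 1 = 0.
    rewrite -[LHS]mulr1 (_ : _ * 1 = (a1 * a2 - 1) * b2 * b1 -
      (a1 * a2 - 1) * (b1 * b2 - 1)); last by ring.
    by rewrite e2 al mul0r subr0.
  by apply: fin => //; apply/eqP; rewrite -subr_eq0 ?a0 ?b0.
have [x [y [z' [w [hA hB xw zy]]]]] := rank1_mx2 uv.
have tr0 d1 d2 e1 e2 f g : d_prod a1 a2 b1 b2 u v d1 d2 e1 e2 f g = 0 ->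
    d_tr q s a1 a2 b1 b2 (x * w) (z' * y) d1 d2 e1 e2 f g = 0.
  move=> d0; apply: (mulfI m0); rewrite mulr0 xw zy -[RHS](H d1 d2 e1 e2 f g).
  by rewrite d0 mulr0 add0r.
pose A := mx2 a1 x y a2; pose B := mx2 b1 z' w b2.
have dA : \det A = 1 by rewrite det_mx2E hA; ring.
have dB : \det B = 1 by rewrite det_mx2E hB; ring.
have two0 : (2 : F) != 0 by rewrite pnatr_eq0.
have vanish (Q : 'M[F]_2) : Q 1 0 = 0 -> Q 0 1 = 0 -> Q 0 0 - Q 1 1 = 0 ->
    Q 0 0 + Q 1 1 = 0 -> Q = 0.
  move=> q10 q01 /eqP; rewrite subr_eq0 => /eqP q00.
  rewrite q00 -mulr2n -mulr_natl => /eqP; rewrite mulf_eq0 (negbTE two0) /= => /eqP q11.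
  by rewrite mx2_0 [LHS]mx2_eta q10 q01 q00 q11.
have gA : grad_A q s a1 a2 b1 b2 x y z' w = 0.
  have [g1 g2 g3 g4] := grad_AE q s hA hB; apply: vanish; rewrite // ?g1 ?g2 ?g3;
    by apply: tr0; rewrite /d_prod -xw -zy; ring: hA hB.
have gB : grad_B q s a1 a2 b1 b2 x y z' w = 0.
  have [g1 g2 g3 g4] := grad_BE q s hA hB; apply: vanish; rewrite // ?g1 ?g2 ?g3;
    by apply: tr0; rewrite /d_prod -xw -zy; ring: hA hB.
have tL : \tr (diag_qs s q * A * B * adj2 A * adj2 B) = q + s.
  have := chart_eqE q s dA dB; rewrite !mx2E xw zy E0 => /esym/eqP.
  rewrite subr_eq0 => /eqP <-; rewrite !adj2M {2}/diag_qs adj2_mx2 !oppr0.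
  by rewrite -(mulrA _ (adj2 A)) tr2C /diag_qs !mulrA.
have [x0 y0 z0 w0] := critical_diag qs q_neq_s dA dB tL (subr0_eq gA) (subr0_eq gB).
rewrite !mx2E in x0 y0 z0 w0.
apply: fin; first by apply/eqP; rewrite -subr_eq0 -hA x0 mul0r.
- by apply/eqP; rewrite -subr_eq0 -hB z0 mul0r.
- by rewrite -xw x0 mul0r.
- by rewrite -zy z0 mul0r.
Qed.

Lemma diag_der_rel_prod z dz : diag_chart z -> der z dz rel_prodF = 0.
Proof.
move=> [a a0 [b b0 ->]]; have [d1 [d2 [e1 [e2 [f [g ->]]]]]] := point6_eta dz.
by rewrite der_rel_prod /d_prod !mulfV //; ring.
Qed.

Definition jac (z : 'I_6 -> F) : 'M[F]_(2, 6) := \matrix_(j, i)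
  ((if j == 0 then rel_prodF else rel_trqs)^`M(i)).@[z].

Lemma mul_jac z (v : 'rV[F]_6) j : (v *m (jac z)^T) 0 j =
  der z (fun i => v 0 i) (if j == 0 then rel_prodF else rel_trqs).
Proof. by rewrite mxE; apply: eq_bigr => i _; rewrite !mxE. Qed.

(** All partial derivatives of u v - (a1 a2 - 1) (b1 b2 - 1) vanish at the diagonal points. *)
Lemma jac_rank z : on_chart q s z -> \rank (jac z) = 2%N <-> ~ diag_chart z.
Proof.
move=> zV; split=> [r2 dz|nd].
  have rf : row_free (jac z) by rewrite /row_free r2.
  have : row 0 (jac z) = 0.
    apply/rowP => i; rewrite !mxE /=.
    have := @diag_der_rel_prod z (fun k => (k == i)%:R) dz.
    rewrite /der (bigD1 i) //= eqxx mul1r big1 ?addr0 // => k /negbTE ->.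
    by rewrite mul0r.
  rewrite rowE => /(canRL (mulmxKp rf))/matrixP/(_ 0 0).
  by rewrite mul0mx !mxE !eqxx => /eqP; rewrite oner_eq0.
apply/eqP; rewrite -[_ == _]/(row_free _) -kermx_eq0; apply/negPn/negP.
move=> /rowV0Pn[w /sub_kermxP wJ w0]; apply: nd.
apply: (@dependent_diag z (w 0 0) (w 0 1) zV).
  rewrite -negb_and; apply: contra w0 => /andP[/eqP e0 /eqP e1].
  by apply/eqP/rowP => i; rewrite mxE; case: (ord2P i) => ->.
move=> dz; rewrite /der !mulr_sumr -big_split big1 // => i _.
have /rowP/(_ i) := wJ; rewrite !mxE sum_ord2 !mxE /= => e.
by rewrite mulrCA [X in _ + X]mulrCA -mulrDr e mulr0.
Qed.

Definition rep_poly (f : RC -> F) : {mpoly F[6]} :=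
  if pselect (exists p : {mpoly F[6]}, f = fun y => p.@[rep_chart y]) is left e
  then sval (cid e) else 0.

Lemma rep_polyE f : regular RC f -> f = fun y => (rep_poly f).@[rep_chart y].
Proof.
move=> /(rep_chart_generates qs q_neq_s cE) e.
by rewrite {1}/rep_poly; case: pselect => // e'; case: cid.
Qed.

Lemma der_rep_poly y dz p f : der (rep_chart y) dz rel_prodF = 0 ->
  der (rep_chart y) dz rel_trqs = 0 -> f = (fun y => p.@[rep_chart y]) ->
  der (rep_chart y) dz (rep_poly f) = der (rep_chart y) dz p.
Proof.
move=> d1 d2 fE; apply/eqP; rewrite -subr_eq0 -derN -derD; apply/eqP.
have zV := rep_chart_on qs q_neq_s cE y.
rewrite (@mod_rel_der _ _ _ 0 zV d1 d2); first by rewrite -mpolyC0 derC.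
apply: (on_chart_ideal qs q_neq_s) => z /(rep_chart_surj qs q_neq_s cE)[y' <-].
rewrite mevalB; have : regular RC f.
  by rewrite fE; exact: regular_rep_chart.
by move/rep_polyE/(congr1 (fun h => h y')) => <-; rewrite fE subrr.
Qed.

Lemma tangent_der y d : tangent y d ->
  let dz i := d (fun y => ('X_i : {mpoly F[6]}).@[rep_chart y]) in
  forall p, d (fun y => p.@[rep_chart y]) = der (rep_chart y) dz p.
Proof.
move=> [dL dM] dz; have rp p := @regular_rep_chart F q s c p.
have r1 : regular RC (fun _ => 1).
  rewrite (_ : (fun _ => 1) = fun y => (1%:MP : {mpoly F[6]}).@[rep_chart y]); first exact: rp.
  by apply/funext => y'; rewrite mevalC.
have d1 : d (fun _ => 1) = 0.
  apply: (addrI (d (fun _ => 1))); rewrite addr0 -[in RHS](_ : (fun _ => 1 * 1) = fun _ => 1).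
    by rewrite (dM _ _ r1 r1) !mul1r.
  by apply/funext => y'; rewrite mulr1.
have r0 : regular RC (fun _ => 0).
  rewrite (_ : (fun _ => 0) = fun y => (0 : {mpoly F[6]}).@[rep_chart y]); first exact: rp.
  by apply/funext => y'; rewrite meval0.
have d0 : d (fun _ => 0) = 0.
  apply: (addrI (d (fun _ => 0))); rewrite addr0 -[in RHS](_ : (fun _ => 1 * 0 + 0) = fun _ => 0).
    by rewrite (dL 1 _ _ r0 r0) mul1r.
  by apply/funext => y'; rewrite mulr0 addr0.
elim/mpoly_alg_ind => [a|i|p r IHp IHr|p r IHp IHr].
- rewrite derC (_ : (fun _ => _) = fun _ => a * 1 + 0).
    by rewrite (dL a _ _ r1 r0) d1 d0 mulr0 addr0.
  by apply/funext => y'; rewrite mevalC mulr1 addr0.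
- by rewrite derXU.
- rewrite derD -IHp -IHr (_ : (fun _ => _) =
     fun y => 1 * p.@[rep_chart y] + r.@[rep_chart y]).
    by rewrite dL // mul1r.
  by apply/funext => y'; rewrite mevalD mul1r.
- rewrite derM -IHp -IHr (_ : (fun _ => _) =
     fun y => p.@[rep_chart y] * r.@[rep_chart y]); first by rewrite dM.
  by apply/funext => y'; rewrite mevalM.
Qed.

Lemma tangent_der_rel y d p : tangent y d -> (forall z, on_chart q s z -> p.@[z] = 0) ->
  der (rep_chart y) (fun i => d (fun y => ('X_i : {mpoly F[6]}).@[rep_chart y])) p = 0.
Proof.
move=> ty p0; rewrite -(tangent_der ty) (_ : (fun _ => _) = fun y => (0%:MP : {mpoly F[6]}).@[rep_chart y]).
  by rewrite (tangent_der ty) derC.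
by apply/funext => y'; rewrite mevalC p0 //; exact: rep_chart_on.
Qed.

(** A point derivation is determined by its values on the six coordinates, and these are subject
    only to the two equations because the equations generate the ideal of the chart. *)
Lemma rep_C_tangent_dim y : tangent_dim_eq y (6 - \rank (jac (rep_chart y))).
Proof.
pose z := rep_chart y; pose K := kermx (jac z)^T.
have rK : \rank K = (6 - \rank (jac z))%N by rewrite mxrank_ker mxrank_tr.
rewrite -rK; have [B BK Bfree] : exists2 B : 'M[F]_(\rank K, 6), (B :=: K)%MS & row_free B.
  by exists (row_base K); [exact: eq_row_base | exact: row_base_free].
have BJ : B *m (jac z)^T = 0 by apply/sub_kermxP; rewrite BK.
pose D (k : 'I_(\rank K)) (f : RC -> F) : F := der z (fun i => B k i) (rep_poly f).
have dB k : der z (fun i => B k i) rel_prodF = 0 /\ der z (fun i => B k i) rel_trqs = 0.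
  have rB j : (row k B *m (jac z)^T) 0 j = 0 by rewrite -row_mul BJ !mxE.
  have -> : (fun i => B k i) = fun i => row k B 0 i by apply/funext => i; rewrite mxE.
  by split; [rewrite -[RHS](rB 0) | rewrite -[RHS](rB 1)]; rewrite mul_jac.
have DE k p : D k (fun y => p.@[rep_chart y]) = der z (fun i => B k i) p.
  by have [d1 d2] := dB k; exact: der_rep_poly.
exists D; split.
- move=> k; split=> [a f g|f g] /rep_polyE ef /rep_polyE eg; rewrite {1}ef {1}eg.
    rewrite (_ : (fun _ => _) = fun y => (a%:MP * rep_poly f + rep_poly g).@[rep_chart y]).
      by rewrite DE derD derM derC mulr0 addr0 mevalC.
    by apply/funext => y'; rewrite mevalD mevalM mevalC.
  rewrite (_ : (fun _ => _) = fun y => (rep_poly f * rep_poly g).@[rep_chart y]).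
    have efy : (rep_poly f).@[z] = f y := esym (congr1 (fun h => h y) ef).
    have egy : (rep_poly g).@[z] = g y := esym (congr1 (fun h => h y) eg).
    by rewrite DE derM efy egy.
  by apply/funext => y'; rewrite mevalM.
- move=> a a0; have : \row_k a k *m B = 0.
    apply/rowP => i; rewrite !mxE -[RHS](a0 (fun y => ('X_i : {mpoly F[6]}).@[rep_chart y])).
      by apply: eq_bigr => k _; rewrite mxE DE derXU.
    exact: regular_rep_chart.
  move/(canRL (mulmxKp Bfree)); rewrite mul0mx => /rowP e k.
  by have := e k; rewrite !mxE.
- move=> d td; pose dz := \row_i d (fun y => ('X_i : {mpoly F[6]}).@[rep_chart y]).
  have dzK : (dz <= B)%MS.
    rewrite BK; apply/sub_kermxP/rowP => j; rewrite mul_jac mxE.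
    rewrite -[RHS](@tangent_der_rel y d (if j == 0 then rel_prodF else rel_trqs)) //.
      by apply: eq_bigr => i _; rewrite mxE.
    by move=> x [x1 x2]; case: ifP.
  have [a ea] := submxP dzK; exists (fun k => a 0 k) => f /rep_polyE ef.
  rewrite {1}ef (tangent_der td) /D /der.
  under [RHS]eq_bigr do rewrite mulr_sumr.
  rewrite exchange_big; apply: eq_bigr => i _ /=.
  have /rowP/(_ i) := ea; rewrite !mxE => ->; rewrite mulr_suml.
  by apply: eq_bigr => k _; rewrite mulrA.
Qed.

End TangentSpaces.

Section DimensionUnique.
Variables (F : fieldType) (X : variety F).

Lemma dim_eq_uniq (S : X -> Prop) n m : dim_eq S n -> dim_eq S m -> n = m.
Proof.
move=> [[f rf fi] fmax] [[g rg gi] gmax]; apply/eqP; rewrite eqn_leq.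
by rewrite (gmax _ _ rf fi) (fmax _ _ rg gi).
Qed.

Lemma tangent_dim_le (x : X) n m : tangent_dim_eq x n -> tangent_dim_eq x m -> (n <= m)%N.
Proof.
move=> [D [tD iD _]] [E [tE _ gE]].
have ex k : exists a : 'I_m -> F, forall f, regular X f -> D k f = \sum_i a i * E i f.
  exact: gE.
pose a k := sval (cid (ex k)).
have aE k : forall f, regular X f -> D k f = \sum_i a k i * E i f := svalP (cid (ex k)).
pose A : 'M[F]_(n, m) := \matrix_(k, i) a k i.
have : row_free A.
  rewrite -kermx_eq0; apply/negPn/negP => /rowV0Pn[v /sub_kermxP vA v0].
  case/eqP: v0; apply/rowP => k; rewrite mxE.
  apply: (iD (fun k => v 0 k)) => f rf.
  under eq_bigr do rewrite aE // mulr_sumr.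
  rewrite exchange_big big1 // => i _ /=.
  have /rowP/(_ i) := vA; rewrite !mxE => e.
  transitivity ((\sum_j v 0 j * A j i) * E i f); last by rewrite e mul0r.
  by rewrite mulr_suml; apply: eq_bigr => k' _; rewrite mxE mulrA.
by rewrite /row_free => /eqP <-; exact: rank_leq_col.
Qed.

Lemma tangent_dim_uniq (x : X) n m : tangent_dim_eq x n -> tangent_dim_eq x m -> n = m.
Proof.
by move=> tn tm; apply/eqP; rewrite eqn_leq (tangent_dim_le tn tm) (tangent_dim_le tm tn).
Qed.
End DimensionUnique.

Section SingularLocus.
Variables (F : numClosedFieldType) (q s c : F).
Hypotheses (qs : q * s = 1) (q_neq_s : q != s) (cE : c = q + s).

Lemma singularP (y : rep_C c) : singular y <-> diagonal_rep y.
Proof.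
rewrite (diag_chartP qs q_neq_s cE); have yV := rep_chart_on qs q_neq_s cE y.
have d4 := rep_C_dim qs q_neq_s cE; have td := rep_C_tangent_dim qs q_neq_s cE y.
have rl : (\rank (jac q s (rep_chart q s y)) <= 2)%N by exact: rank_leq_row.
split=> [sing|dy [n dn tn]].
  case: (pselect (diag_chart (rep_chart q s y))) => // /(jac_rank qs q_neq_s yV) r2.
  by case: sing; exists 4%N => //; rewrite r2 in td.
have n4 := dim_eq_uniq dn d4; rewrite n4 in tn.
have e := tangent_dim_uniq td tn.
have /(jac_rank qs q_neq_s yV) // : \rank (jac q s (rep_chart q s y)) = 2%N.
by move: e rl; case: (\rank _) => [|[|[|]]].
Qed.

End SingularLocus.

(** * The double covering *)

Section RegularAlgebra.
Variables (F : fieldType) (n : nat) (S : pred (n.-tuple 'M[F]_2)).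
Local Notation X := (git_quotient S).

Lemma regular_git_cst a : regular X (fun _ => a).
Proof. exact: regular_cst. Qed.

Lemma regular_gitD f g : regular X f -> regular X g -> regular X (fun y => f y + g y).
Proof. exact: regularD. Qed.

Lemma regular_gitM f g : regular X f -> regular X g -> regular X (fun y => f y * g y).
Proof. exact: regularM. Qed.

Lemma regular_gitN f : regular X f -> regular X (fun y => - f y).
Proof. exact: regularN. Qed.

Lemma regular_git_sum (I : Type) (r : seq I) (f : I -> X -> F) :
  (forall i, regular X (f i)) -> regular X (fun y => \sum_(i <- r) f i y).
Proof. exact: (@regular_sum F n S I r (fun i M => f i (git_class M))). Qed.

Lemma regular_git_prod (I : Type) (r : seq I) (f : I -> X -> F) :
  (forall i, regular X (f i)) -> regular X (fun y => \prod_(i <- r) f i y).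
Proof.
move=> rf; elim: r => [|i r IHr].
  rewrite (_ : (fun y => _) = fun _ => 1); first exact: regular_git_cst.
  by apply/funext => y; rewrite big_nil.
rewrite (_ : (fun y => _) = fun y => f i y * \prod_(i <- r) f i y).
  exact: regular_gitM.
by apply/funext => y; rewrite big_cons.
Qed.

Lemma regular_git_det m (f : 'I_m -> 'I_m -> X -> F) :
  (forall i j, regular X (f i j)) -> regular X (fun y => \det (\matrix_(i, j) f i j y)).
Proof.
move=> rf; rewrite (_ : (fun y => _) = fun y =>
   \sum_(p : 'S_m) (-1) ^+ p * \prod_i f i (p i) y).
  apply: regular_git_sum => p; apply: regular_gitM; first exact: regular_git_cst.
  by apply: regular_git_prod.
apply/funext => y; apply: eq_bigr => p _; congr (_ * _).
by apply: eq_bigr => i _; rewrite mxE.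
Qed.
End RegularAlgebra.

Section Covering.
Variables (F : numClosedFieldType) (q s c : F).
Hypotheses (qs : q * s = 1) (q_neq_s : q != s) (cE : c = q + s).
Local Notation XP := (closed_subvariety (is_rep_P1 c)).
Local Notation XC := (closed_subvariety (is_rep_C c)).
Local Notation RP := (rep_P1 c).
Local Notation RC := (rep_C c).
Local Notation Phi := (@Phi_top F c).
Local Notation rep_chart := (@rep_chart F q s c).

Lemma regular_Phi (f : RC -> F) : regular RC f -> regular RP (f \o Phi).
Proof.
move=> /inv_regular_git_class[[p fp] _].
change (regular XP (fun M => f (Phi (conj_class M)))).
rewrite (_ : (fun M => _) = fun M => p.@[coord (val (phi0 M))]); last first.
  by apply/funext => M; rewrite Phi_topE fp.
apply: (@regular_meval F 5 (is_rep_P1 c) _ p (fun i M => coord (val (phi0 M)) i)) => i.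
rewrite /coord; case: (enum_val i) => -[a k] l.
have w j (j5 : (j < 5)%N) := @word_nth F 5 (is_rep_P1 c) j j5.
suff [rw _] : word (fun M : XP => tnth (val (phi0 M)) a) by exact: rw.
case: a => [[|[|[|[|//]]]] Ha].
- rewrite (_ : (fun M => _) = fun M : XP => (val M)`_1 * (val M)`_2 * (val M)`_3).
    by do 2?apply: wordM; exact: w.
  by apply/funext => M; rewrite (tnth_nth 0).
- rewrite (_ : (fun M => _) = fun M : XP => (val M)`_3 * (val M)`_4).
    by apply: wordM; exact: w.
  by apply/funext => M; rewrite (tnth_nth 0).
- rewrite (_ : (fun M => _) = fun M : XP => (val M)`_2); first exact: w.
  by apply/funext => M; rewrite (tnth_nth 0).
- rewrite (_ : (fun M => _) = fun M : XP => (val M)`_4 * (val M)`_2 * adj2 (val M)`_4).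
    by do 2?apply: wordM; try apply: word_adj2; exact: w.
  by apply/funext => M; rewrite (tnth_nth 0) /= inv2 // rep_P1_det.
Qed.

Lemma Phi_surj (y : RC) : exists x, Phi x = y.
Proof.
have [M eM] := phi0_surj qs q_neq_s cE (repr y).
by exists (conj_class M); rewrite Phi_topE eM git_class_repr.
Qed.

Definition Psi_top (x : RP) : RP := conj_class (psi0 (repr x)).

Lemma Psi_topE (M : XP) : Psi_top (conj_class M) = conj_class (psi0 M).
Proof.
apply/conj_classP/psi0_conj/conj_classP; exact: conj_class_repr.
Qed.

Lemma Psi_topK : involutive Psi_top.
Proof.
move=> x; rewrite -(conj_class_repr x) !Psi_topE psi0K //.
Qed.

Lemma Phi_Psi x : Phi (Psi_top x) = Phi x.
Proof.
by rewrite -(conj_class_repr x) Psi_topE !Phi_topE phi0_psi0.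
Qed.

Lemma Phi_fiber x x' : Phi x = Phi x' -> x' = x \/ x' = Psi_top x.
Proof.
rewrite -(conj_class_repr x) -(conj_class_repr x') Psi_topE !Phi_topE.
move=> /(phi0_fiber qs q_neq_s cE)[|] /conj_classP ->; first by left.
by right.
Qed.

Definition oddc (k : 'I_4) : RP -> F := conj_descend (odd_coord q s k).

Lemma oddcE k M : oddc k (conj_class M) = odd_coord q s k M.
Proof. exact: conj_descendE (inv_regular_odd_coord q s c k). Qed.

Lemma regular_oddc k : regular RP (oddc k).
Proof. exact: regular_conj_descend (inv_regular_odd_coord q s c k). Qed.

Lemma oddc_Psi k x : oddc k (Psi_top x) = - oddc k x.
Proof. by rewrite -(conj_class_repr x) Psi_topE !oddcE odd_coord_psi0. Qed.

(** The decomposition of f on the quotient; the odd coefficients ho are not unique. *)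
Definition splits (f : RP -> F) (he : RC -> F) (ho : 'I_4 -> RC -> F) : Prop :=
  [/\ regular RC he, forall k, regular RC (ho k)
    & forall x, f x = he (Phi x) + \sum_k oddc k x * ho k (Phi x)].

Lemma splits_ex f : regular RP f -> exists he ho, splits f he ho.
Proof.
move=> /inv_regular_conj_class /(odd_decomposition qs q_neq_s cE)[he [ho [rhe rho fE]]].
exists (git_descend he), (fun k => git_descend (ho k)); split.
- exact: regular_git_descend.
- by move=> k; exact: regular_git_descend.
- move=> x; rewrite -(conj_class_repr x) fE Phi_topE git_descendE //; congr (_ + _).
  by apply: eq_bigr => k _; rewrite oddcE git_descendE.
Qed.

Lemma splits_even f he ho x : splits f he ho -> f x + f (Psi_top x) = 2 * he (Phi x).
Proof.
move=> [_ _ fE]; rewrite !fE Phi_Psi.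
under [X in _ + (_ + X)]eq_bigr do rewrite oddc_Psi mulNr.
by rewrite sumrN; ring.
Qed.

Lemma two_neq0 : (2 : F) != 0. Proof. by rewrite pnatr_eq0. Qed.

(** 2 he = f + f o Psi for the even part he, since the odd part changes its sign. *)
Lemma even_lift f : regular RP f -> (forall x, f (Psi_top x) = f x) ->
  exists2 h, regular RC h & forall x, f x = h (Phi x).
Proof.
move=> rf fPsi; have [he [ho sp]] := splits_ex rf; exists he; first by case: sp.
move=> x; apply: (mulfI two_neq0); rewrite -(splits_even x sp) fPsi; ring.
Qed.

Lemma regular_Psi f : regular RP f -> regular RP (f \o Psi_top).
Proof.
move=> /splits_ex[he [ho [rhe rho fE]]].
change (regular XP (fun M => f (Psi_top (conj_class M)))).
have rPhi h : regular RC h -> regular XP (fun M => h (Phi (conj_class M))) by exact: regular_Phi.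
have rodd k : regular XP (fun M => oddc k (conj_class M)) := regular_oddc k.
rewrite (_ : (fun M => _) = fun M : XP => he (Phi (conj_class M)) +
   - \sum_k oddc k (conj_class M) * ho k (Phi (conj_class M))); last first.
  apply/funext => M; rewrite fE Phi_Psi -sumrN; congr (_ + _).
  by apply: eq_bigr => k _; rewrite oddc_Psi mulNr.
apply: regularD; first exact: rPhi.
apply: regularN; apply: regular_sum => k; apply: regularM => //; exact: rPhi.
Qed.

Lemma Phi_finite : finite_morphism Phi.
Proof.
split; first exact: regular_Phi.
exists 5%N, (fun i : 'I_5 => if unlift ord0 i is Some k then oddc k else fun _ => 1).
split.
  move=> i; case: (unliftP ord0 i) => [k _|_]; first exact: regular_oddc.
  exact: (@regular_cst F 5 (is_rep_P1 c) 1).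
move=> f /splits_ex[he [ho [rhe rho fE]]].
exists (fun i : 'I_5 => if unlift ord0 i is Some k then ho k else he).
  by move=> i; case: (unliftP ord0 i).
move=> x; rewrite fE [RHS]big_ord_recl unlift_none mulr1; congr (_ + _).
by apply: eq_bigr => k _; rewrite liftK mulrC.
Qed.

Lemma Psi_fixedP x : Psi_top x = x <-> forall k, oddc k x = 0.
Proof.
rewrite -(conj_class_repr x) Psi_topE.
split=> [/conj_classP/(psi0_fixed qs q_neq_s cE) e k|e]; first by rewrite oddcE.
by apply/conj_classP/(psi0_fixed qs q_neq_s cE) => k; rewrite -oddcE.
Qed.

Lemma Psi_moved x : Psi_top x <> x -> exists k, oddc k x != 0.
Proof.
move=> nx; apply/existsP; apply: contraT; rewrite negb_exists => /forallP z.
case: nx; apply/Psi_fixedP => k; apply/eqP.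
by rewrite -[_ == _]negbK.
Qed.

Lemma antidiag_mx2 (A : 'M[F]_2) : A 0 0 = 0 -> A 1 1 = 0 -> A = mx2 0 (A 0 1) (A 1 0) 0.
Proof. by move=> a0 a1; rewrite {1}(mx2_eta A) a0 a1. Qed.

Lemma fixed_slice x : (forall k, oddc k x = 0) -> exists M : XP,
  [/\ x = conj_class M, slice q s M & forall k, exists b' c',
        (val M)`_(branch k) = mx2 0 b' c' 0].
Proof.
move=> ox; have [M MN sM] := P1_to_slice qs q_neq_s cE (repr x).
have ex : x = conj_class M by rewrite -(conj_class_repr x); apply/conj_classP.
exists M; split=> // k; have ok : odd_coord q s k M = 0 by rewrite -oddcE -ex.
exists ((val M)`_(branch k) 0 1), ((val M)`_(branch k) 1 0).
apply: antidiag_mx2; first by rewrite -(odd_coord_slice q_neq_s k sM).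
by rewrite (branch_11 q_neq_s k sM) ok oppr0.
Qed.

Lemma dihedralP x : dihedral_rep x <-> forall k, oddc k x = 0.
Proof.
split=> [[M -> /= [d2 [a0 a1 a3 a4]]] k|/fixed_slice[M [-> sM aM]]].
  rewrite oddcE /odd_coord /diag_part.
  have ab : forall i, (val M)`_(branch k) i i = 0 by elim/ord4P: k.
  have /is_diag_mxP d := d2.
  rewrite {1}(mx2_eta (val M)`_(branch k)) (mx2_eta (val M)`_2) !ab mx2M tr_mx2 tr2 !ab.
  by rewrite (d 0 1) // (d 1 0) // !(mulr0, mul0r, addr0, subr0).
exists M => //=; split.
  rewrite sM; apply/is_diag_mxP => i j.
  by case: (ord2P i) (ord2P j) => -> [] ->; rewrite ?mx2E.
have anti k : antidiagonal_mx (val M)`_(branch k).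
  by have [b' [c' ->]] := aM k => i; case: (ord2P i) => ->; rewrite mx2E.
split; [exact: (anti (@Ordinal 4 0 isT)) | exact: (anti (@Ordinal 4 1 isT)) |
        exact: (anti (@Ordinal 4 2 isT)) | exact: (anti (@Ordinal 4 3 isT))].
Qed.

(** The words A, B, C_1, C_2 contain an even number of antidiagonal factors. Conversely the fiber
    above a diagonal representation contains a dihedral one, which is fixed and hence alone. *)
Lemma diagonal_fixed x : diagonal_rep (Phi x) <-> Psi_top x = x.
Proof.
split=> [/(diag_chartP qs q_neq_s cE)[a a0 [b b0 e]]|/Psi_fixedP/fixed_slice[M [-> sM aM]]].
  have [M eM oM] := diag_rep_lift qs q_neq_s cE a0 b0.
  have fM : Psi_top (conj_class M) = conj_class M by apply/Psi_fixedP => k; rewrite oddcE.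
  have : Phi (conj_class M) = Phi x.
    apply: (rep_chart_inj qs q_neq_s cE); rewrite e Phi_topE eM.
    by rewrite rep_chart_class // chart_diag_rep.
  by case/Phi_fiber => ->; rewrite ?fM.
rewrite Phi_topE; exists (phi0 M) => // k; apply/is_diag_mxP => i j ij.
have [x1 [y1 e1]] := aM (@Ordinal 4 1 isT); have [x3 [y3 e3]] := aM (@Ordinal 4 2 isT).
have [x4 [y4 e4]] := aM (@Ordinal 4 3 isT).
have d4 := rep_P1_det M (isT : (4 < 5)%N).
rewrite (tnth_nth 0) /phi0 SubK /= inv2 //.
rewrite [(val M)`_1]e1 [(val M)`_2]sM [(val M)`_3]e3 [(val M)`_4]e4 /diag_qs adj2_mx2.
case: k => [[|[|[|[|//]]]] Hk] /=; rewrite ?mx2M;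
by case: (ord2P i) (ord2P j) ij => -> [] -> //= _; rewrite mx2E; ring.
Qed.

End Covering.

(** * Branching and ramification *)

Section Branching.
Variables (F : numClosedFieldType) (q s c : F).
Hypotheses (qs : q * s = 1) (q_neq_s : q != s) (cE : c = q + s).
Local Notation XP := (closed_subvariety (is_rep_P1 c)).
Local Notation XC := (closed_subvariety (is_rep_C c)).
Local Notation RP := (rep_P1 c).
Local Notation RC := (rep_C c).
Local Notation Phi := (@Phi_top F c).
Local Notation Psi := (@Psi_top F c).
Local Notation oddc := (@oddc F q s c).
Local Notation rep_chart := (@rep_chart F q s c).
Local Notation even_lift := (even_lift qs q_neq_s cE).
Local Notation splits := (@splits F q s c).

Lemma oddc_mul_lift k l : exists2 h, regular RC h &
  forall x, oddc k x * oddc l x = h (Phi x).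
Proof.
apply: even_lift => [|x]; last by rewrite !oddc_Psi mulrNN.
by apply: (@regularM F 5 (is_rep_P1 c)); exact: regular_oddc.
Qed.

(** Where an odd function m does not vanish, every odd function is m times an even one,
    so that 1 and m form a basis; the two points of the fiber are separated by m. *)
Lemma etale_nondiagonal y : ~ diagonal_rep y -> etale_at 2 Phi y.
Proof.
have [x ex] := Phi_surj qs q_neq_s cE y; rewrite -ex => nd.
have [k mk] : exists k, oddc k x != 0.
  by apply: (Psi_moved qs q_neq_s cE) => fx; apply: nd; apply/(diagonal_fixed qs q_neq_s cE).
have [g rg gE] := oddc_mul_lift k k.
exists g; split=> //; first by rewrite -gE mulf_neq0.
pose e (i : 'I_2) : RP -> F := if i == 0 then fun _ => 1 else oddc k.
split.
  exists e; split.
  - move=> i; rewrite /e; case: ifP => _; last exact: regular_oddc.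
    exact: (@regular_cst F 5 (is_rep_P1 c) 1).
  - move=> f /(splits_ex qs q_neq_s cE)[he [ho [rhe rho fE]]].
    pose h l := s2val (cid2 (oddc_mul_lift l k)).
    have rh l : regular RC (h l) := s2valP (cid2 (oddc_mul_lift l k)).
    have hE l : forall x, oddc l x * oddc k x = h l (Phi x) := s2valP' (cid2 (oddc_mul_lift l k)).
    exists 1%N, (fun i y => if i == 0 then g y * he y else \sum_l h l y * ho l y).
    split=> [i|x' _].
      case: (ord2P i) => ->; first exact: (regular_gitM rg rhe).
      by apply: (@regular_git_sum _ _ _ _ _ (fun l y => h l y * ho l y)) => l; exact: regular_gitM.
    rewrite expr1 sum_ord2 /e /= mulr1 fE mulrDr; congr (_ + _).
    rewrite mulr_sumr mulr_suml; apply: eq_bigr => l _.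
    by rewrite -gE -hE; ring.
  - move=> a ra a0 i y' gy'; have [x' ex'] := Phi_surj qs q_neq_s cE y'.
    have gx' : g (Phi x') != 0 by rewrite ex'.
    have gp' : g (Phi (Psi x')) != 0 by rewrite Phi_Psi.
    have m0 : oddc k x' != 0 by apply: contra gx' => /eqP e0; rewrite -gE e0 mul0r.
    have := a0 _ gp'; have := a0 _ gx'; rewrite !sum_ord2 /e /= !mulr1 Phi_Psi oddc_Psi ex'.
    move=> e1 e2; have a00 : a 0 y' = 0.
      apply: (mulfI (two_neq0 F)); rewrite mulr0.
      rewrite (_ : 2 * _ = (a 0 y' + a 1 y' * oddc k x') + (a 0 y' + a 1 y' * - oddc k x')).
        by rewrite e1 e2 addr0.
      by ring.
    have a10 : a 1 y' = 0 by apply: (mulIf m0); rewrite mul0r -[RHS]e1 a00 add0r.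
    by case: (ord2P i) => ->.
move=> y' gy'; have [x' ex'] := Phi_surj qs q_neq_s cE y'.
have m0 : oddc k x' != 0.
  by apply: contra gy' => /eqP e0; rewrite -ex' -gE e0 mul0r.
have xx' : x' != Psi x'.
  apply: contra m0 => /eqP fx; have /(Psi_fixedP qs q_neq_s cE) -> // : Psi x' = x' by [].
exists [tuple x'; Psi x'] => [|x1]; first by rewrite /= inE xx'.
rewrite !inE; apply/eqP/orP => [e1|[]/eqP ->]; last 2 first.
- exact: ex'.
- by rewrite Phi_Psi.
have /(Phi_fiber qs q_neq_s cE)[->|->] : Phi x' = Phi x1 by rewrite e1.
  by left.
by right.
Qed.

(** The fiber above a diagonal representation is a single point. *)
Lemma branch_diagonal (y : RC) : branch_point 2 Phi y <-> diagonal_rep y.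
Proof.
split=> [by_|dy [g [rg gy [_ fib]]]].
  by case: (pselect (diagonal_rep y)) => // /etale_nondiagonal.
have [[[|x1 [|x2 [|//]]] //= sz] us sE] := fib y gy.
have e1 : Phi x1 = y by apply/eqP; rewrite sE inE eqxx.
have e2 : Phi x2 = y by apply/eqP; rewrite sE !inE eqxx orbT.
have f1 : Psi x1 = x1 by apply/(diagonal_fixed qs q_neq_s cE); rewrite e1.
move: us; rewrite /= inE andbT; case/eqP.
by have [->|->] := Phi_fiber qs q_neq_s cE (etrans e1 (esym e2)); rewrite ?f1.
Qed.

(** a1 a2 - 1 vanishes at the diagonal points and is not a zero divisor. *)
Lemma nondiagonal_dense h y : regular RC h -> h y != 0 ->
  exists2 y', h y' != 0 & ~ diagonal_rep y'.
Proof.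
move=> rh hy; apply: contrapT => nex.
have hd y' : ~ diagonal_rep y' -> h y' = 0.
  by move=> nd; apply/eqP; apply: contraT => hn; case: nex; exists y'.
have [p hE] := rep_chart_generates qs q_neq_s cE rh.
case/eqP: hy; rewrite hE.
pose b : {mpoly F[4]} := @var4 F 0 isT * @var4 F 1 isT - 1.
have b0 : b != 0.
  apply/eqP => /(congr1 (meval (fun _ => 0))); rewrite mevalB mevalM !mevalXU meval1 meval0.
  by rewrite mulr0 sub0r => /eqP; rewrite oppr_eq0 oner_eq0.
apply: (on_chart_torsion_free qs q_neq_s b0); last exact: rep_chart_on.
move=> z /(rep_chart_surj qs q_neq_s cE)[y' <-]; rewrite mevalM.
case: (pselect (diagonal_rep y')) => [/(diag_chartP qs q_neq_s cE)[a1 a10 [b1 b10 e]]|nd].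
  rewrite base_lift_meval /b mevalB mevalM meval1 !mevalXU e /point6 /=.
  by rewrite mulfV // subrr mul0r.
by have := hd y' nd; rewrite hE => ->; rewrite mulr0.
Qed.

Lemma Phi_branched : branched_covering 2 Phi.
Proof.
split; [exact: (Phi_finite qs q_neq_s cE) | exact: (Phi_surj qs q_neq_s cE) |].
move=> h rh [y hy]; have [y' hy' nd] := nondiagonal_dense rh hy.
by exists y' => //; exact: etale_nondiagonal.
Qed.

Lemma Psi_galois : galois_involution Phi Psi.
Proof.
split.
- by move=> f; exact: (regular_Psi qs q_neq_s cE).
- exact: Psi_topK.
- have [y _ nd] := @nondiagonal_dense (fun _ => 1)
    (git_class (diag_rep qs cE (oner_neq0 F) (oner_neq0 F)))
    (regular_git_cst _ 1) (oner_neq0 F).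
  have [x ex] := Phi_surj qs q_neq_s cE y; exists x; apply/eqP => fx.
  by apply: nd; rewrite -ex; apply/(diagonal_fixed qs q_neq_s cE).
- exact: Phi_Psi.
- exact: (Phi_fiber qs q_neq_s cE).
Qed.

Section Ramification.
Variable x : RP.

Lemma tangent_add d f g : tangent x d -> regular RP f -> regular RP g ->
  d (fun z => f z + g z) = d f + d g.
Proof.
move=> [dL _] rf rg; have := dL 1 f g rf rg; rewrite mul1r => <-; congr d.
by apply/funext => z; rewrite mul1r.
Qed.

Lemma regular_RP_sum (I : Type) (r : seq I) (f : I -> RP -> F) :
  (forall i, regular RP (f i)) -> regular RP (fun z => \sum_(i <- r) f i z).
Proof. exact: (@regular_sum F 5 (is_rep_P1 c) I r (fun i M => f i (conj_class M))). Qed.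

(** If m_k <> 0 at x, the vanishing of d on the even functions m_k m_l forces d m_l = 0
    for all l, hence d = 0. *)
Lemma ramification_fixed : ramification_point Phi x -> Psi x = x.
Proof.
move=> [d [td [f rf df] dPhi]]; apply: contrapT => nx.
have [k mk] := Psi_moved qs q_neq_s cE nx.
have rm l : regular RP (oddc l) := regular_oddc q s c l.
have dprod l l' : oddc l x * d (oddc l') + oddc l' x * d (oddc l) = 0.
  have [h rh hE] := oddc_mul_lift l l'; have [_ dM] := td.
  rewrite -(dM _ _ (rm l) (rm l')) -[RHS](dPhi h rh); congr d.
  by apply/funext => z; rewrite hE.
have dk : d (oddc k) = 0.
  apply: (mulfI mk); apply: (mulfI (two_neq0 F)); rewrite !mulr0 -[RHS](dprod k k).
  by ring.
have dm l : d (oddc l) = 0.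
  by apply: (mulfI mk); rewrite mulr0 -[RHS](dprod k l) dk mulr0 addr0.
have [he [ho [rhe rho fE]]] := splits_ex qs q_neq_s cE rf.
case/eqP: df; rewrite (_ : f = fun z => (he \o Phi) z + \sum_l oddc l z * (ho l \o Phi) z).
  have rh l : regular RP (ho l \o Phi) := regular_Phi (rho l).
  have rml l : regular RP (fun z => oddc l z * (ho l \o Phi) z).
    exact: (@regularM F 5 (is_rep_P1 c) _ _ (rm l) (rh l)).
  rewrite tangent_add //; [|exact: regular_Phi | exact: regular_RP_sum].
  rewrite dPhi // add0r; elim: (index_enum _) => [|l r IHr].
    rewrite (_ : (fun z => _) = (fun _ => 0) \o Phi); first by rewrite dPhi //; exact: regular_git_cst.
    by apply/funext => z; rewrite big_nil.
  rewrite (_ : (fun z => _) = fun z => oddc l z * (ho l \o Phi) z +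
     \sum_(l <- r) oddc l z * (ho l \o Phi) z).
    rewrite tangent_add //; last exact: regular_RP_sum.
    have [_ dM] := td; rewrite IHr addr0 (dM _ _ (rm l) (rh l)) dPhi // dm.
    by rewrite !mulr0 addr0.
  by apply/funext => z; rewrite big_cons.
by apply/funext => z; rewrite fE.
Qed.

(** The values at Phi x of the relations between the odd coordinates over the functions of C: the
    fiber at Phi x of the module of odd functions is the quotient of F^4 by these vectors. *)
Definition odd_relation (v : 'rV[F]_4) : Prop := exists h : 'I_4 -> RC -> F,
  [/\ forall k, regular RC (h k), forall z, \sum_k oddc k z * h k (Phi z) = 0
    & forall k, v 0 k = h k (Phi x)].

(** The fiber of the module of odd functions at Phi x is not 0: four relations independent at
    Phi x would by Cramer's rule make all odd coordinates vanish above a neighborhood of Phi x,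
    which contains points that are not diagonal. *)
Lemma odd_cotangent : exists2 w : 'cV[F]_4, w != 0 & forall v, odd_relation v -> v *m w = 0.
Proof.
apply: contrapT => nex.
(* otherwise each set of fewer than four independent relations can be enlarged: a vector w
   orthogonal to them is not orthogonal to all relations *)
have grow r : (r <= 4)%N -> exists2 A : 'M[F]_(r, 4),
    row_free A & forall i, odd_relation (row i A).
  elim: r => [|r IHr] r4.
    by exists 0 => [|[]//]; rewrite /row_free mxrank0.
  have [A fA rA] := IHr (ltnW r4).
  have : kermx A^T != 0.
    rewrite kermx_eq0 /row_free mxrank_tr; apply: contraTneq r4 => e.
    by rewrite -e -leqNgt; have := fA; rewrite /row_free => /eqP ->.
  move=> /rowV0Pn[w /sub_kermxP wA w0].
  have [v rv vw] : exists2 v, odd_relation v & v *m w^T != 0.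
    apply: contrapT => nv; apply: nex; exists w^T; first by rewrite -trmx0 (inj_eq trmx_inj).
    by move=> v rv; apply/eqP; apply: contraT => vw; case: nv; exists v.
  exists (col_mx v A : 'M_(1 + r, 4)); last first.
    move=> i; case: (@split_ordP 1 r i) => j ->.
      by rewrite (rowKu j v A) ord1 row_id.
    by rewrite (rowKd j v A).
  rewrite -kermx_eq0; apply/negPn/negP => /rowV0Pn[u /sub_kermxP].
  move: u; rewrite -[r.+1]/(1 + r)%N => u.
  rewrite -[u](@hsubmxK _ 1 1 r) mul_row_col => uA u0.
  have /(congr1 (mulmx^~ w^T)) := uA; rewrite /= mulmxDl -!mulmxA.
  have -> : A *m w^T = 0 by rewrite -[A]trmxK -trmx_mul wA trmx0.
  rewrite mulmx0 addr0 mul0mx [lsubmx u]mx11_scalar mul_scalar_mx => /eqP.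
  rewrite scaler_eq0 (negbTE vw) orbF => /eqP l0.
  have lu0 : lsubmx u = 0 by rewrite [lsubmx u]mx11_scalar l0 raddf0.
  move: uA; rewrite lu0 mul0mx add0r => /(canRL (mulmxKp fA)); rewrite mul0mx => r0.
  by rewrite lu0 r0 row_mx0 eqxx in u0.
have [A fA rA] := grow 4%N isT.
pose h i := sval (cid (rA i)).
have hP i : [/\ forall k, regular RC (h i k), forall z, \sum_k oddc k z * h i k (Phi z) = 0
    & forall k, row i A 0 k = h i k (Phi x)] := svalP (cid (rA i)).
pose H y := \matrix_(i, k) h i k y.
have HA : H (Phi x) = A.
  by apply/matrixP => i k; have [_ _ /(_ k) e] := hP i; rewrite mxE -e mxE.
have rH : regular RC (fun y => \det (H y)).
  by apply: regular_git_det => i k; have [rh _ _] := hP i.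
have dA : \det (H (Phi x)) != 0.
  by rewrite HA -unitfE -unitmxE -row_free_unit.
have [y' dy' nd] := nondiagonal_dense rH dA.
have [x' ex'] := Phi_surj qs q_neq_s cE y'.
have [k mk] : exists k, oddc k x' != 0.
  by apply: (Psi_moved qs q_neq_s cE) => fx; apply: nd; rewrite -ex'; apply/(diagonal_fixed qs q_neq_s cE).
have Hm : H y' *m (\col_k oddc k x') = 0.
  apply/matrixP => i j; rewrite !mxE; have [_ /(_ x') e _] := hP i.
  by rewrite -[RHS]e; apply: eq_bigr => l _; rewrite !mxE ex' mulrC.
have uH : H y' \in unitmx by rewrite unitmxE unitfE.
have := congr1 (mulmx (invmx (H y'))) Hm; rewrite mulKmx // mulmx0 => /matrixP/(_ k 0).
by rewrite !mxE => e; rewrite e eqxx in mk.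
Qed.

Lemma regular_splits f he ho : splits f he ho -> regular RP f.
Proof.
move=> [rhe rho fE]; rewrite (_ : f = fun z => (he \o Phi) z + \sum_l oddc l z * (ho l \o Phi) z).
  have rs : regular RP (fun z => \sum_l oddc l z * (ho l \o Phi) z).
    apply: (@regular_RP_sum _ _ (fun l z => oddc l z * (ho l \o Phi) z)) => l.
    exact: (@regularM F 5 (is_rep_P1 c) _ _ (regular_oddc q s c l) (regular_Phi (rho l))).
  exact: (@regularD F 5 (is_rep_P1 c) _ _ (regular_Phi rhe) rs).
by apply/funext => z; rewrite fE.
Qed.

Lemma splits_odd_eq f g he ho ge go : splits f he ho -> splits g ge go -> f = g ->
  forall z, \sum_k oddc k z * (ho k (Phi z) - go k (Phi z)) = 0.
Proof.
move=> spf spg fg z; have e := splits_even z spf; have e' := splits_even z spg.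
have he_ge : he (Phi z) = ge (Phi z).
  by apply: (mulfI (two_neq0 F)); rewrite -e -e' fg.
have [_ _ fE] := spf; have [_ _ gE] := spg.
under eq_bigr do rewrite mulrBr; rewrite sumrB; apply/eqP; rewrite subr_eq0; apply/eqP.
by apply: (addrI (he (Phi z))); rewrite -fE {1}he_ge -gE fg.
Qed.

(** A functional on the fiber at Phi x of the module of odd functions, extended by 0 to the even
    functions, is a derivation at x since the odd functions vanish at x and their products two
    by two are even. *)
Lemma fixed_ramification : Psi x = x -> ramification_point Phi x.
Proof.
move=> /(Psi_fixedP qs q_neq_s cE) mx; have [w w0 wP] := odd_cotangent.
have sp f : exists p : (RC -> F) * ('I_4 -> RC -> F), regular RP f -> splits f p.1 p.2.
  case: (pselect (regular RP f)) => [/(splits_ex qs q_neq_s cE)[he [ho e]]|nr].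
    by exists (he, ho).
  by exists ((fun _ => 0), (fun _ _ => 0)).
(* the value of d does not depend on the choice of the odd coefficients, w being orthogonal to
   the relations *)
pose d (f : RP -> F) : F := \sum_k w k 0 * (sval (cid (sp f))).2 k (Phi x).
have dE f he ho : splits f he ho -> d f = \sum_k w k 0 * ho k (Phi x).
  move=> spf; rewrite /d; case: (cid (sp f)) => -[ge go] /= H.
  have rf : regular RP f.
    exact: regular_splits spf.
  have spg := H rf; have [_ rho _] := spf; have [_ rgo _] := spg.
  have : odd_relation (\row_k (ho k (Phi x) - go k (Phi x))).
    exists (fun k y => ho k y - go k y); split=> [k|z|k]; last by rewrite mxE.
      by apply: regular_gitD => //; exact: regular_gitN.
    exact: splits_odd_eq spf spg _ z.
  move=> /wP/matrixP/(_ 0 0); rewrite !mxE => e.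
  apply/eqP; rewrite eq_sym -subr_eq0 -sumrB -[X in _ == X]e; apply/eqP.
  by apply: eq_bigr => k _; rewrite mxE; ring.
exists d; split.
- split=> [a f g|f g] /(splits_ex qs q_neq_s cE)[fe [fo [rfe rfo fE]]]
      /(splits_ex qs q_neq_s cE)[ge [go [rge rgo gE]]].
    rewrite (dE _ _ _ (And3 rfe rfo fE)) (dE _ _ _ (And3 rge rgo gE)).
    rewrite (dE _ (fun y => a * fe y + ge y) (fun k y => a * fo k y + go k y)).
      by rewrite mulr_sumr -big_split; apply: eq_bigr => k _ /=; ring.
    split=> [|k|z]; try by apply: regular_gitD => //; apply: regular_gitM => //; exact: regular_git_cst.
    rewrite fE gE mulrDr mulr_sumr addrACA -big_split; congr (_ + _).
    by apply: eq_bigr => k _ /=; ring.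
  rewrite (dE _ _ _ (And3 rfe rfo fE)) (dE _ _ _ (And3 rge rgo gE)).
  pose m2 k l := s2val (cid2 (oddc_mul_lift k l)).
  have rm2 k l : regular RC (m2 k l) := s2valP (cid2 (oddc_mul_lift k l)).
  have m2E k l : forall z, oddc k z * oddc l z = m2 k l (Phi z) := s2valP' (cid2 (oddc_mul_lift k l)).
  rewrite (dE _ (fun y => fe y * ge y + \sum_k \sum_l m2 k l y * (fo k y * go l y))
    (fun k y => fe y * go k y + fo k y * ge y)).
    have value h he ho : splits h he ho -> h x = he (Phi x).
      by move=> [_ _ ->]; rewrite big1 ?addr0 // => k _; rewrite mx mul0r.
    rewrite (value _ _ _ (And3 rfe rfo fE)) (value _ _ _ (And3 rge rgo gE)).
    by rewrite !mulr_sumr -big_split; apply: eq_bigr => k _ /=; ring.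
  split=> [|k|z].
  + apply: regular_gitD; first exact: regular_gitM.
    by do 2![apply: regular_git_sum => ?]; do 2?apply: regular_gitM.
  + by apply: regular_gitD; exact: regular_gitM.
  + rewrite fE gE.
    have -> : \sum_k oddc k z * (fe (Phi z) * go k (Phi z) + fo k (Phi z) * ge (Phi z)) =
        fe (Phi z) * (\sum_k oddc k z * go k (Phi z)) +
        (\sum_k oddc k z * fo k (Phi z)) * ge (Phi z).
      by rewrite mulr_sumr mulr_suml -big_split; apply: eq_bigr => k _ /=; ring.
    have -> : \sum_k \sum_l m2 k l (Phi z) * (fo k (Phi z) * go l (Phi z)) =
        (\sum_k oddc k z * fo k (Phi z)) * (\sum_k oddc k z * go k (Phi z)).
      rewrite mulr_suml; apply: eq_bigr => k _; rewrite mulr_sumr.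
      by apply: eq_bigr => l _; rewrite -m2E; ring.
    ring.
- have [k wk] : exists k, w k 0 != 0.
    apply/existsP; apply: contraT; rewrite negb_exists => /forallP z; case/eqP: w0.
    by apply/matrixP => k j; rewrite ord1 mxE; apply/eqP; rewrite -[_ == _]negbK.
  exists (oddc k); first exact: regular_oddc.
  rewrite (dE _ (fun _ => 0) (fun l _ => (l == k)%:R)).
    by rewrite (bigD1 k) //= eqxx mulr1 big1 ?addr0 // => l /negbTE ->; rewrite mulr0.
  split=> [|l|z]; try exact: regular_git_cst.
  by rewrite add0r (bigD1 k) //= eqxx mulr1 big1 ?addr0 // => l /negbTE ->; rewrite mulr0.
- move=> a ra; rewrite (dE _ a (fun _ _ => 0)); first by rewrite big1 // => k _; rewrite mulr0.
  split=> // [k|z]; first exact: regular_git_cst.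
  by rewrite big1 ?addr0 // => k _; rewrite mulr0.
Qed.

End Ramification.

Lemma ramificationP x : ramification_point Phi x <-> Psi x = x.
Proof. by split; [exact: ramification_fixed | exact: fixed_ramification]. Qed.

Lemma quotient_isomorphism (PsiK : involutive Psi) :
  exists2 iota : RC -> quot_invol PsiK,
    isomorphism iota & forall x, iota (Phi x) = quot_invol_proj PsiK x.
Proof.
pose sec y := sval (cid (Phi_surj qs q_neq_s cE y)).
have secE y : Phi (sec y) = y := svalP (cid (Phi_surj qs q_neq_s cE y)).
have projP x x' : quot_invol_proj PsiK x = quot_invol_proj PsiK x' <-> orbit2 Psi x x'.
  exact: quot_projP.
have iotaE x : quot_invol_proj PsiK (sec (Phi x)) = quot_invol_proj PsiK x.
  by apply/projP; apply: (Phi_fiber qs q_neq_s cE); rewrite secE.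
exists (fun y => quot_invol_proj PsiK (sec y)) => //.
pose inv (z : quot_invol PsiK) : RC := Phi (repr z).
have invE x : inv (quot_invol_proj PsiK x) = Phi x.
  have /projP[e|e] : quot_invol_proj PsiK (repr (quot_invol_proj PsiK x)) = quot_invol_proj PsiK x.
  - exact: quot_repr.
  - by rewrite {2}e.
  - by rewrite {2}e Phi_Psi.
split.
  move=> f rf; have [|h rh hE] := @even_lift (fun x => f (quot_invol_proj PsiK x)) rf.
    move=> x; congr f; apply/projP; rewrite /orbit2; right; by rewrite PsiK.
  by rewrite (_ : _ \o _ = h) //; apply/funext => y /=; rewrite hE secE.
exists inv.
  move=> f rf; change (regular RP (fun x => f (inv (quot_invol_proj PsiK x)))).
  by rewrite (_ : (fun x => _) = f \o Phi); [exact: regular_Phi | apply/funext => x; rewrite invE].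
split=> [y|z]; first by rewrite invE secE.
by rewrite /inv iotaE; exact: quot_repr.
Qed.

End Branching.

(** * The eigenvalues of the monodromy at t *)

Section Cosine.
Variable R : realType.
Local Open Scope complex_scope.

Lemma sin_eq0_int (x : R) : sin x = 0 -> exists k : int, x = pi * k%:~R.
Proof.
move=> sx; have pi0 : (0 : R) < pi := pi_gt0 R.
have red := alternatingn (@sinDpi R).
(* reduction of x modulo pi to [0, pi), where sin vanishes only at 0 *)
have [k /andP[kx xk]] : exists k : int, (pi * k%:~R <= x) && (x < pi * (k + 1)%:~R).
  exists (Num.floor (x / pi)); rewrite mulrC -ler_pdivlMr // floor_le_tmp.
  by rewrite mulrC -ltr_pdivrMr // floorD1_gt.
exists k; apply/eqP; rewrite eq_le kx andbT leNgt; apply/negP => kx'.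
have : 0 < sin (x - pi * k%:~R).
  apply: sin_gt0_pi; rewrite subr_gt0 kx' ltrBlDr /=.
  by rewrite -{1}[pi]mulr1 -mulrDr addrC -[1]/(1%:~R) -intrD.
suff -> : sin (x - pi * k%:~R) = 0 by rewrite ltxx.
case: k {kx xk kx'} => n.
  have := red n (x - pi * n%:~R); rewrite pmulrn mulrzr subrK sx => /esym/eqP.
  by rewrite mulf_eq0 signr_eq0 /= => /eqP.
by rewrite NegzE mulrNz mulrN opprK -[_%:~R]/(n.+1%:R) mulr_natr red sx mulr0.
Qed.

(** q and s are the exponentials of 2 pi i nu and its opposite; if they agree, comparing real and
    imaginary parts gives that nu is real and sin (2 pi nu) = 0. *)
Lemma two_ccos (nu : R[i]) : (forall k : int, 2 * nu != k%:~R) ->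
  exists q s : R[i], [/\ q * s = 1, q != s & 2 * ccos (2 * cpi R * nu) = q + s].
Proof.
move=> nu_half; pose z := 2 * cpi R * nu; exists (cexp ('i%C * z)), (cexp (- ('i%C * z))); split.
- rewrite /cexp; case: ('i%C * z) => a b; simpc => /=.
  rewrite cosN sinN expRN; have e0 : expR a != 0 by rewrite expR_eq0.
  apply/eqP; rewrite eq_complex /=; apply/andP; split; apply/eqP; last by field.
  by rewrite -[RHS](cos2Dsin2 b); field.
- case: nu @z nu_half => x y z nu_half.
  have -> : 'i%C * z = (- (2 * pi * y)) +i* (2 * pi * x).
    by rewrite /z /cpi; apply/eqP; rewrite eq_complex /=; apply/andP; split; apply/eqP; ring.
  rewrite /cexp /=; apply/eqP => /eqP; rewrite eq_complex /= opprK cosN sinN.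
  move=> /andP[/eqP eR /eqP eI].
  have sx : sin (2 * pi * x) = 0.
    have : (expR (- (2 * pi * y)) + expR (2 * pi * y)) * sin (2 * pi * x) = 0.
      by rewrite mulrDl eI; ring.
    move=> /eqP; rewrite mulf_eq0 => /orP[|/eqP //].
    by rewrite gt_eqF // addr_gt0 // expR_gt0.
  have cx : cos (2 * pi * x) != 0.
    by rewrite -normr_eq0 sin0cos1 // oner_eq0.
  have y0 : y = 0.
    have /expR_inj e := mulIf cx eR.
    have /eqP : 2 * pi * y *+ 2 = 0 by rewrite mulr2n -{1}e; ring.
    rewrite mulrn_eq0 /= !mulf_eq0 pnatr_eq0 /= gt_eqF ?pi_gt0 //= => /eqP //.
  have [k xk] := sin_eq0_int sx; case/eqP: (nu_half k).
  have x2 : 2 * x = k%:~R.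
    by apply: (mulfI (lt0r_neq0 (pi_gt0 R))); rewrite -xk; ring.
  rewrite -(rmorph_int (real_complex R)) -x2 y0.
  by apply/eqP; rewrite eq_complex /=; apply/andP; split; apply/eqP; ring.
- rewrite /ccos -/z mulrC divfK // pnatr_eq0 //.
Qed.
End Cosine.

Theorem theorem4p1 (R : realType) (nu : R[i])
    (nu_half : forall k : int, 2 * nu != k%:~R) :
  let c : R[i] := 2 * ccos (2 * cpi R * nu) in
  let Phi : rep_P1 c -> rep_C c := @Phi_top _ c in
  branched_covering 2 Phi /\
  (forall y : rep_C c, branch_point 2 Phi y <-> diagonal_rep y) /\
  (forall y : rep_C c, singular y <-> diagonal_rep y) /\
  dim_eq (@diagonal_rep _ c) 2 /\
  exists (Psi : rep_P1 c -> rep_P1 c) (PsiK : involutive Psi),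
    galois_involution Phi Psi /\
    (forall x, ramification_point Phi x <-> Psi x = x) /\
    (forall x, ramification_point Phi x <-> dihedral_rep x) /\
    exists2 iota : rep_C c -> quot_invol PsiK,
      isomorphism iota & forall x, iota (Phi x) = quot_invol_proj PsiK x.
Proof.
move=> c Phi; have [q [s [qs q_neq_s cE]]] := two_ccos nu_half.
split; first exact: (Phi_branched qs q_neq_s cE).
split; first exact: (branch_diagonal qs q_neq_s cE).
split; first exact: (singularP qs q_neq_s cE).
split; first exact: (diagonal_dim qs q_neq_s cE).
exists (@Psi_top _ c), (@Psi_topK _ c).
split; first exact: (Psi_galois qs q_neq_s cE).
split; first exact: (ramificationP qs q_neq_s cE).
split; last exact: (quotient_isomorphism qs q_neq_s cE).
move=> x; apply: (iff_trans (ramificationP qs q_neq_s cE x)).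
apply: (iff_trans (Psi_fixedP qs q_neq_s cE x)).
exact: (iff_sym (dihedralP qs q_neq_s cE x)).
Qed.
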